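(* Let $v$ be a viscosity solution of $H(x,c+v_x)=h(c)$ on $\mathbb{T}^n$ corresponding to a KAM torus with a $(\nu,\eta)$-Diophantine rotation vector, and for $\varepsilon>0$ let $v^\varepsilon$ be the unique viscosity solution of $\varepsilon v^\varepsilon+H(x,c+v^\varepsilon_x)=h(c)$ on $\mathbb{T}^n$. Then there exists a constant $\beta>0$ independent of $\varepsilon$ such that, after adding to $v$ a constant which may depend on $\varepsilon$, $$\|v^\varepsilon-v\|_{C^0(\mathbb{T}^n)}\le\beta\,\varepsilon^{\frac{1}{1+2\eta}}\quad\text{as }\varepsilon\to0.$$
   Context: $H:\mathbb{T}^n\times\mathbb{R}^n\to\mathbb{R}$ is $C^2$, $H_{pp}$ is positive definite, $H(x,p)/|p|\to+\infty$ as $|p|\to\infty$ uniformly in $x$. $c\in\mathbb{R}^n$ is fixed and $h(c)$ is the unique constant for which $H(x,c+v_x)=h(c)$ has a viscosity solution on $\mathbb{T}^n$. $\phi^s_H$ is the flow of $x'=H_p(x,p)$, $p'=-H_x(x,p)$. $\mathrm{graph}(c+v_x):=\{(x,c+v_x(x)): v\text{ differentiable at }x\}$. ''$v$ corresponds to a KAM torus with a $(\nu,\eta)$-Diophantine rotation vector $\omega\in\mathbb{R}^n$'' means: $\mathrm{graph}(c+v_x)$ is a smooth $\phi^s_H$-invariant torus and there is a $C^1$ embedding $\Phi=(\varphi,\psi):\mathbb{T}^n\to\mathbb{T}^n\times\mathbb{R}^n$ with $\Phi(\mathbb{T}^n)=\mathrm{graph}(c+v_x)$ such that for every $(x_0,p_0)\in\mathrm{graph}(c+v_x)$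 there is $\theta_0\in\mathbb{T}^n$ (depending on $(x_0,p_0)$) with $\phi^s_H(x_0,p_0)=\Phi(\omega s+\theta_0)$ for all $s$, and $|\omega\cdot z|\ge\nu(|z_1|+\dots+|z_n|)^{-\eta}$ for all $z\in\mathbb{Z}^n\setminus\{0\}$, where $\nu>0$, $\eta>n-1$. *)

(* Defs.v *)
(* R : realType, R^n = 'rV[R]_n, T^n lifted to R^n. *)
From mathcomp Require Import all_boot all_order all_algebra.
From mathcomp Require Import all_classical all_reals all_analysis.
Set Implicit Arguments. Unset Strict Implicit. Unset Printing Implicit Defensive.
Import Order.TTheory GRing.Theory Num.Theory.
Import numFieldNormedType.Exports.
Local Open Scope ring_scope.
Local Open Scope classical_set_scope.

Section Defs.
Context {R : realType} {n : nat}.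

Definition phase := ('rV[R]_n * 'rV[R]_n)%type.

Definition intvec (k : 'rV[int]_n) : 'rV[R]_n := map_mx (fun m : int => m%:~R) k.

Definition ev (i : 'I_n) : 'rV[R]_n := delta_mx 0 i.

Definition cong_tor (x y : 'rV[R]_n) := exists k : 'rV[int]_n, x = y + intvec k.
Definition cong_phase (z w : phase) :=
  exists k : 'rV[int]_n, z.1 = w.1 + intvec k /\ z.2 = w.2.

Definition periodic {T : Type} (f : 'rV[R]_n -> T) :=
  forall x (k : 'rV[int]_n), f (x + intvec k) = f x.

Definition grad (f : 'rV[R]_n -> R) (x : 'rV[R]_n) : 'rV[R]_n :=
  \row_i 'D_(ev i) f x.

Definition C1 (f : 'rV[R]_n -> R) :=
  continuous f /\
  forall u : 'rV[R]_n, (forall x, derivable f x u) /\ continuous ('D_u f).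

Definition Hz (H : 'rV[R]_n -> 'rV[R]_n -> R) (z : phase) : R := H z.1 z.2.

Definition C2_ham (H : 'rV[R]_n -> 'rV[R]_n -> R) :=
  continuous (Hz H) /\
  forall u w : phase,
    (forall z, derivable (Hz H) z u) /\
    (forall z, derivable ('D_u (Hz H)) z w) /\
    continuous ('D_w ('D_u (Hz H))).

Definition dirx (i : 'I_n) : phase := (ev i, 0).
Definition dirp (i : 'I_n) : phase := (0, ev i).

Definition Hpp (H : 'rV[R]_n -> 'rV[R]_n -> R) (x p : 'rV[R]_n) : 'M[R]_n :=
  \matrix_(i, j) 'D_(dirp j) ('D_(dirp i) (Hz H)) (x, p).

Definition Hpp_posdef (H : 'rV[R]_n -> 'rV[R]_n -> R) :=
  forall x p (xi : 'rV[R]_n), xi != 0 -> 0 < (xi *m Hpp H x p *m xi^T) 0 0.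

Definition superlinear (H : 'rV[R]_n -> 'rV[R]_n -> R) :=
  forall M : R, exists K : R, 0 < K /\
    forall x p : 'rV[R]_n, K <= `|p| -> M <= H x p / `|p|.

Definition periodic_ham (H : 'rV[R]_n -> 'rV[R]_n -> R) :=
  forall x p (k : 'rV[int]_n), H (x + intvec k) p = H x p.

Definition ham_field (H : 'rV[R]_n -> 'rV[R]_n -> R) (z : phase) : phase :=
  (\row_i 'D_(dirp i) (Hz H) z, - \row_i 'D_(dirx i) (Hz H) z).

(* s |-> gamma s is an orbit of the Hamiltonian flow phi^s_H (on the lift),
   i.e. gamma s = phi^s_H (gamma 0) for all s *)
Definition ham_traj (H : 'rV[R]_n -> 'rV[R]_n -> R) (gamma : R -> phase) :=
  forall s : R, derivable gamma s 1 /\ 'D_1 gamma s = ham_field H (gamma s).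

Definition graph_dv (c : 'rV[R]_n) (v : 'rV[R]_n -> R) : set phase :=
  [set z | differentiable v z.1 /\ z.2 = c + \row_i (('d v (z.1) : 'rV[R]_n -> R) (ev i))].

Definition ham_invariant (H : 'rV[R]_n -> 'rV[R]_n -> R) (S : set phase) :=
  forall gamma, ham_traj H gamma -> S (gamma 0) -> forall s, S (gamma s).

Fixpoint iterD (f : 'rV[R]_n -> phase) (l : seq 'rV[R]_n) : 'rV[R]_n -> phase :=
  match l with
  | [::] => f
  | u :: l' => 'D_u (iterD f l')
  end.

Definition Cinf_map (f : 'rV[R]_n -> phase) :=
  forall l : seq 'rV[R]_n, continuous (iterD f l) /\
    forall u x, derivable (iterD f l) x u.

Definition C1_map (f : 'rV[R]_n -> phase) :=
  continuous f /\
  forall u : 'rV[R]_n, (forall x, derivable f x u) /\ continuous ('D_u f).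

(* Phi : R^n -> R^n x R^n is the lift of a C^1 embedding
   T^n -> T^n x R^n whose image is S (S given as a Z^n-invariant lifted set):
   well defined on T^n, injective on T^n, immersion (T^n compact, so an
   injective immersion is an embedding) *)
Definition C1_torus_embedding (Phi : 'rV[R]_n -> phase) (S : set phase) :=
  C1_map Phi /\
  (forall th (k : 'rV[int]_n), cong_phase (Phi (th + intvec k)) (Phi th)) /\
  (forall th th', cong_phase (Phi th) (Phi th') -> cong_tor th th') /\
  (forall th u, 'D_u Phi th = 0 -> u = 0) /\
  (forall z, S z <-> exists th, cong_phase (Phi th) z).

Definition smooth_torus (S : set phase) :=
  exists Psi : 'rV[R]_n -> phase, Cinf_map Psi /\ C1_torus_embedding Psi S.

Definition KAM_torus (H : 'rV[R]_n -> 'rV[R]_n -> R) (c : 'rV[R]_n)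
    (v : 'rV[R]_n -> R) (omega : 'rV[R]_n) :=
  smooth_torus (graph_dv c v) /\ ham_invariant H (graph_dv c v) /\
  exists Phi : 'rV[R]_n -> phase,
    C1_torus_embedding Phi (graph_dv c v) /\
    forall z0, graph_dv c v z0 ->
      exists th0 : 'rV[R]_n,
        forall gamma, ham_traj H gamma -> gamma 0 = z0 ->
          forall s : R, cong_phase (gamma s) (Phi (s *: omega + th0)).

Definition diophantine (nu eta : R) (omega : 'rV[R]_n) :=
  forall z : 'rV[int]_n, z != 0 ->
    nu * ((\sum_i `|(z 0 i)%:~R : R|) `^ (- eta))
      <= `| \sum_i omega 0 i * (z 0 i)%:~R |.

Definition visc_sub (F : 'rV[R]_n -> R -> 'rV[R]_n -> R) (u : 'rV[R]_n -> R) :=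
  forall (phi : 'rV[R]_n -> R) (x0 : 'rV[R]_n), C1 phi ->
    (\forall y \near x0, u y - phi y <= u x0 - phi x0) ->
    F x0 (u x0) (grad phi x0) <= 0.

Definition visc_super (F : 'rV[R]_n -> R -> 'rV[R]_n -> R) (u : 'rV[R]_n -> R) :=
  forall (phi : 'rV[R]_n -> R) (x0 : 'rV[R]_n), C1 phi ->
    (\forall y \near x0, u x0 - phi x0 <= u y - phi y) ->
    0 <= F x0 (u x0) (grad phi x0).

Definition visc_sol_torus (F : 'rV[R]_n -> R -> 'rV[R]_n -> R) (u : 'rV[R]_n -> R) :=
  continuous u /\ periodic u /\ visc_sub F u /\ visc_super F u.

Definition cell_eq (H : 'rV[R]_n -> 'rV[R]_n -> R) (c : 'rV[R]_n) (h : R) :=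
  fun x (r : R) p => H x (c + p) - h.
Definition discounted_eq (H : 'rV[R]_n -> 'rV[R]_n -> R) (c : 'rV[R]_n) (h eps : R) :=
  fun x (r : R) p => eps * r + H x (c + p) - h.

End Defs.

(* Main.v *)
(* Write [w = veps - v]. Along an orbit [(x(s), p(s))] of the invariant torus, [v] is
   differentiable at [x(s)] with derivative [p(s) - c], so convexity of [H] in [p] makes
   [w(x(s))] grow at rate at most [- eps * veps], which is [O(eps)] by comparison of
   [veps] with [v]. The Diophantine condition makes the orbit [1/m]-dense within time
   [O(m ^ (2 eta))], whence [w y <= w x + O(eps m ^ (2 eta)) + O(1/m)] for all points of
   the projected torus; [m = eps ^ (- 1 / (1 + 2 eta))] balances the two errors.

   The projected torus contains all differentiability points of [v]. They are dense
   because [v] is semiconcave: the three-point doubling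
   [v x + v y - 2 v z - al |x + y - 2 z|^2 - K |x - y|^2] has no positive maximum for
   large [K], as the second derivative of [H] along the segment joining the two test
   gradients would be positive there. *)
Require Import Defs.
From HB Require Import structures.
From mathcomp Require Import all_boot all_order all_algebra.
From mathcomp Require Import all_classical all_reals all_analysis.
From mathcomp Require Import ring lra zify.
Set Implicit Arguments. Unset Strict Implicit. Unset Printing Implicit Defensive.
Import Order.TTheory GRing.Theory Num.Theory.
Import numFieldNormedType.Exports.
Local Open Scope ring_scope.
Local Open Scope classical_set_scope.

(** * Directional derivatives *)

(** Invariance and conjugacy in [KAM_torus] quantify over solution curves of Hamilton's equations,
    so they yield information only once a curve defined for all times exists through a given point;
    [ham_traj_exists] supplies it. [veps] is merely continuous and viscosity tests are [C1]. Each
    estimate therefore maximises a functional with a quadratic penalty and reads off test gradients.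
    Sublevel sets of [H] are bounded in [p]; this bounds the gradients, hence makes the distance of
    the doubled points inversely proportional to the penalty weight. The time [m ^ (2 eta)] comes
    from averaging squared trigonometric polynomials with about [m ^ n] frequencies, whose small
    divisors are at least of order [m ^ (- eta)]. A time [T] is long enough when
    [(T * m ^ (- eta)) ^ 2] dominates [m ^ n]; as [n <= 2 * eta] for [n >= 2], [T] of order
    [m ^ (2 eta)] does. For [n = 1] the orbit meets every point of the circle within time
    [1 / nu]. *)

Lemma near_normP (R : realType) (V : normedModType R) (x : V) (P : V -> Prop) :
  (\forall y \near x, P y) <->
  exists2 d : R, 0 < d & forall y, `|y - x| < d -> P y.
Proof.
split=> [/nbhs_normP[d /= d0 dP]|[d d0 dP]].
  by exists d => // y xy; apply: dP; rewrite /= distrC.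
by apply/nbhs_normP; exists d => //= y; rewrite /= distrC; exact: dP.
Qed.

Lemma continuous_normP (R : realType) (V W : normedModType R) (f : V -> W) (x : V) :
  {for x, continuous f} <-> forall e : R, 0 < e ->
  exists2 d : R, 0 < d & forall y, `|y - x| < d -> `|f y - f x| < e.
Proof.
split=> [/cvgrPdist_lt cf e e0|cf].
  have /near_normP[d d0 dP] := cf _ e0.
  by exists d => // y /dP; rewrite distrC.
apply/cvgrPdist_lt => e /cf[d d0 dP]; apply/near_normP; exists d => // y /dP.
by rewrite distrC.
Qed.

Lemma is_derive_line (R : realType) (V W : normedModType R) (f : V -> W)
    (x u : V) (t : R) : derivable f (x + t *: u) u ->
  is_derive t (1 : R) (fun s => f (x + s *: u)) ('D_u f (x + t *: u)).
Proof.
move=> df.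
have E : (fun h : R => h^-1 *: (((fun s => f (x + s *: u)) \o shift t) (h *: (1 : R)) - f (x + t *: u)))
       = (fun h : R => h^-1 *: ((f \o shift (x + t *: u)) (h *: u) - f (x + t *: u))).
  apply/funext => h /=; congr (_ *: (f _ - _)).
  by rewrite scalerDl [h *: 1]mulr1 addrCA.
split; first by rewrite /derivable E.
by rewrite /derive E.
Qed.

Lemma mvt_line (R : realType) (V : normedModType R) (f : V -> R) (x u : V) (h : R) :
  (forall y, derivable f y u) ->
  exists2 t : R, `|t| <= `|h| & f (x + h *: u) - f x = h * 'D_u f (x + t *: u).
Proof.
move=> df.
have D s : is_derive s (1 : R) (fun s => f (x + s *: u)) ('D_u f (x + s *: u)).
  exact: is_derive_line.
have C a b : {within `[a, b], continuous (fun s => f (x + s *: u))}.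
  apply: continuous_subspaceT => s.
  by apply: differentiable_continuous; apply/derivable1_diffP; case: (D s).
have [h0|h0] := leP 0 h.
  have [c] := MVT_segment h0 (fun s _ => D s) (C 0 h).
  rewrite in_itv/= scale0r addr0 subr0 mulrC => /andP[c0 ch] ->.
  by exists c => //; rewrite !ger0_norm.
have [c] := MVT_segment (ltW h0) (fun s _ => D s) (C h 0).
rewrite in_itv/= scale0r addr0 sub0r => /andP[ch c0] E.
exists c; first by rewrite !ler0_norm ?lerN2// ltW.
by apply: oppr_inj; rewrite opprB E mulrN mulrC.
Qed.

(** The increment splits into a step along [u] and a step along [w] from the displaced point. The
    mean value theorem turns the second into ['D_w f] at a point tending to [x], where continuity of
    ['D_w f] applies. *)
Lemma deriveDr (R : realType) (V : normedModType R) (f : V -> R) (x u w : V) :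
  (forall y, derivable f y u) -> (forall y, derivable f y w) ->
  {for x, continuous ('D_w f)} ->
  'D_(u + w) f x = 'D_u f x + 'D_w f x.
Proof.
move=> du dw cw.
apply: (@cvg_lim R) => //.
have -> : (fun h : R => h^-1 *: ((f \o shift x) (h *: (u + w)) - f x)) =
  (fun h : R => h^-1 *: ((f \o shift x) (h *: u) - f x)
    + h^-1 *: (f (h *: u + x + h *: w) - f (h *: u + x))).
  apply/funext => h /=; rewrite -scalerDr; congr (_ *: _).
  by rewrite scalerDr addrAC [RHS]addrC addrA subrK.
apply: cvgD; first exact: (du x).
apply/cvgrPdist_le => /= e e0.
have [d d0 dP] := proj1 (continuous_normP _ _) cw e e0.
near=> h.
have [t th ->] := mvt_line (h *: u + x) h dw.
have h0 : h != 0 by near: h; exact: nbhs_dnbhs_neq.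
rewrite /GRing.scale/= mulKf// distrC ltW//; apply: dP => /=.
rewrite addrAC addrK.
rewrite (le_lt_trans (ler_normD _ _))// !normrZ.
have : `|h| * (`|w| + `|u| + 1) < d.
  rewrite -ltr_pdivlMr; last by rewrite ltr_wpDl// addr_ge0.
  near: h; apply: dnbhs0_lt; apply: divr_gt0 => //; by rewrite ltr_wpDl// addr_ge0.
have := ler_wpM2r (normr_ge0 w) th; have := normr_ge0 h.
rewrite !mulrDr mulr1; lra.
Unshelve. all: by end_near. Qed.

Lemma is_derive_lineP (R : realType) (V W : normedModType R) (f : V -> W)
    (x u : V) (d : W) :
  is_derive x u f d <-> is_derive (0 : R) (1 : R) (fun s => f (x + s *: u)) d.
Proof.
split=> [[df <-]|].
  by have := @is_derive_line R V W f x u 0; rewrite scale0r addr0; apply.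
have E : (fun h : R => h^-1 *: (((fun s => f (x + s *: u)) \o shift 0) (h *: (1 : R)) - f (x + 0 *: u)))
       = (fun h : R => h^-1 *: ((f \o shift x) (h *: u) - f x)).
  apply/funext => h /=; rewrite scale0r !addr0 [h *: 1]mulr1.
  by rewrite (addrC x).
by case=> df dd; split; [move: df; rewrite /derivable E | move: dd; rewrite /derive E].
Qed.

Lemma is_derive_dirZ (R : realType) (V : normedModType R) (f : V -> R) (x u : V) (a d : R) :
  is_derive x u f d -> is_derive x (a *: u) f (a * d).
Proof.
move=> /is_derive_lineP du; apply/is_derive_lineP.
have -> : (fun s => f (x + s *: (a *: u))) = (fun s => f (x + s *: u)) \o (fun s => s * a).
  by apply/funext => s /=; rewrite scalerA.
rewrite mulrC; apply: is_derive1_comp; first by rewrite mul0r.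
have -> : (fun s : R => s * a) = a \*: id by apply/funext => s /=; rewrite mulrC.
by apply: is_derive_eq; rewrite [_ *: _]mulr1.
Qed.

Lemma derive_dirZ (R : realType) (V : normedModType R) (f : V -> R) (x u : V) (a : R) :
  derivable f x u -> 'D_(a *: u) f x = a * 'D_u f x.
Proof. by move=> /derivableP/(is_derive_dirZ a)[]. Qed.

(** ['d f x] is a bundled linear map; this packs a bare function with its proof of linearity so that
    the two can be compared. *)
Lemma ex_linear (R : realType) (V W : normedModType R) (g : V -> W) :
  linear g -> exists L : {linear V -> W}, (L : V -> W) = g.
Proof.
move=> lg.
pose m := GRing.isLinear.Build R V W *:%R g lg.
pose L : {linear V -> W} := HB.pack g m.
by exists L.
Qed.

Lemma differentiable_normP (R : realType) (V W : normedModType R) (f : V -> W) (x : V)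
    (df : {linear V -> W}) : continuous df ->
  (forall e : R, 0 < e -> exists2 d : R, 0 < d &
    forall w, `|w| < d -> `|f (x + w) - f x - df w| <= e * `|w|) ->
  differentiable f x /\ 'd f x = df :> (V -> W).
Proof.
move=> cdf est.
have E : f \o shift x = cst (f x) + df +o_ 0 id.
  apply/eqaddoP => e e0; have [d d0 dP] := est e e0.
 apply/near_normP; exists d => // w; rewrite subr0 => /dP.
  by rewrite /= !fctE /cst /= opprD addrA (addrC w).
have dfE := diff_unique cdf E.
split=> //; apply/diff_locallyP; rewrite dfE; split=> //.
Qed.

Lemma differentiable_norm (R : realType) (V W : normedModType R) (f : V -> W) (x : V) :
  differentiable f x -> forall e : R, 0 < e -> exists2 d : R, 0 < d &
    forall w, `|w| < d -> `|f (x + w) - f x - 'd f x w| <= e * `|w|.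
Proof.
move=> /diff_locally /eqaddoP df e e0.
have /near_normP[d d0 dP] := df e e0; exists d => // w wd.
have := dP w; rewrite subr0 => /(_ wd).
by rewrite /= !fctE /cst /= opprD addrA (addrC w).
Qed.

Definition cdiff (R : realType) (V : normedModType R) (f : V -> R) :=
  forall u, (forall x, derivable f x u) /\ continuous ('D_u f).

(** Abstract finite coordinates, so that one proof of differentiability serves both ['rV[R]_n] and
    [phase]. The bound by the norm holds with constant 1 because both norms are sup norms. *)
Definition finspan (R : realType) (V : normedModType R) (I : finType)
    (e : I -> V) (k : V -> I -> R) :=
  [/\ forall w, w = \sum_i k w i *: e i & forall w i, `|k w i| <= `|w| ].

Section cdiff.
Context (R : realType) (V : normedModType R) (I : finType).
Context (e : I -> V) (k : V -> I -> R).
Context (ek : finspan e k).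

Lemma cdiff_sum (f : V -> R) (z : V) (J : Type) (s : seq J) (a : J -> R) (w : J -> V) :
  cdiff f -> 'D_(\sum_(j <- s) a j *: w j) f z = \sum_(j <- s) a j * 'D_(w j) f z.
Proof.
move=> cf; elim: s => [|j s ih]; first by rewrite !big_nil derive0.
rewrite !big_cons deriveDr ?ih ?derive_dirZ//; first by case: (cf (w j)).
- by case: (cf (a j *: w j)).
- by case: (cf (\sum_(j <- s) a j *: w j)).
- by case: (cf (\sum_(j <- s) a j *: w j)) => _; exact.
Qed.

Lemma cdiff_coord (f : V -> R) (z w : V) :
  cdiff f -> 'D_w f z = \sum_i k w i * 'D_(e i) f z.
Proof. by move=> cf; rewrite {1}(ek.1 w) cdiff_sum. Qed.

Lemma cdiff_linear (f : V -> R) (z : V) : cdiff f -> linear (fun w => 'D_w f z).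
Proof.
move=> cf a u w; rewrite deriveDr ?derive_dirZ//; first by case: (cf u).
- by case: (cf (a *: u)).
- by case: (cf w).
- by case: (cf w) => _; exact.
Qed.

Lemma cdiff_bound (f : V -> R) (z w : V) : cdiff f ->
  `|'D_w f z| <= (\sum_i `|'D_(e i) f z|) * `|w|.
Proof.
move=> cf; rewrite (cdiff_coord _ _ cf) (le_trans (ler_norm_sum _ _ _))// mulr_suml.
by apply: ler_sum => i _; rewrite normrM mulrC ler_wpM2l ?ek.2.
Qed.

(** The mean value theorem along [w] reduces the first-order error to the variation of finitely many
    partial derivatives near [z], each continuous. *)
Lemma cdiff_differentiable (f : V -> R) (z : V) : cdiff f ->
  differentiable f z /\ 'd f z = (fun w => 'D_w f z) :> (V -> R).
Proof.
move=> cf; have [L LE] := ex_linear (cdiff_linear z cf).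
rewrite -LE; apply: differentiable_normP.
  move=> x; apply/continuous_normP => r r0.
  set B := (\sum_i `|'D_(e i) f z|) + 1.
  have B0 : 0 < B by rewrite ltr_wpDl// sumr_ge0.
  exists (r / B); first exact: divr_gt0.
  move=> y; rewrite -linearB LE ltr_pdivlMr// => yx.
  rewrite (le_lt_trans (cdiff_bound _ _ cf))// (le_lt_trans _ yx)// mulrC.
  by rewrite ler_wpM2l// lerDl.
move=> r r0.
have [d d0 dP] : exists2 d : R, 0 < d & forall y, `|y - z| < d ->
    \sum_i `|'D_(e i) f y - 'D_(e i) f z| <= r.
  have : \sum_i `|'D_(e i) f y - 'D_(e i) f z| @[y --> z] --> (\sum_(i : I) 0 : R).
    apply: cvg_big; [exact: add_continuous|move=> i _]; rewrite -(normr0 R) -(subrr ('D_(e i) f z)).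
    by apply: cvg_norm; apply: cvgB; [exact: (cf (e i)).2|exact: cvg_cst].
  rewrite big1// => /cvgr0_norm_le/(_ r r0)/near_normP[d d0 dP].
  by exists d => // y /dP; apply: le_trans; exact: ler_norm.
exists d => // w wd; rewrite LE.
have := @mvt_line R V f z w 1 (cf w).1; rewrite scale1r normr1 => -[t t1 ->]; rewrite mul1r.
have tw : `|t *: w| <= `|w| by rewrite normrZ ler_piMl.
rewrite !(cdiff_coord _ _ cf) -sumrB.
rewrite (le_trans (ler_norm_sum _ _ _))//.
apply: (@le_trans _ _ (\sum_i `|'D_(e i) f (z + t *: w) - 'D_(e i) f z| * `|w|)).
  by apply: ler_sum => i _; rewrite -mulrBr normrM mulrC ler_wpM2l// ek.2.
rewrite -mulr_suml ler_wpM2r// dP// addrAC subrr add0r.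
exact: le_lt_trans wd.
Qed.
End cdiff.

Lemma mvt_segment_line (R : realType) (V : normedModType R) (f : V -> R) (x u : V) :
  (forall y, derivable f y u) ->
  exists2 t : R, 0 <= t <= 1 & f (x + u) - f x = 'D_u f (x + t *: u).
Proof.
move=> df.
have D s : is_derive s (1 : R) (fun s => f (x + s *: u)) ('D_u f (x + s *: u)).
  exact: is_derive_line.
have C : {within `[0, 1], continuous (fun s : R => f (x + s *: u))}.
  apply: continuous_subspaceT => s.
  by apply: differentiable_continuous; apply/derivable1_diffP; case: (D s).
have [t] := MVT_segment ler01 (fun s _ => D s) C.
rewrite in_itv/= scale0r addr0 subr0 mulr1 scale1r => t01 ->.
by exists t.
Qed.

Lemma derive_second_lower (R : realType) (V : normedModType R) (f : V -> R)
    (x u : V) (m : R) :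
  (forall y, derivable f y u) -> (forall y, derivable ('D_u f) y u) ->
  (forall t, `|t| <= 1 -> m <= 'D_u ('D_u f) (x + t *: u)) ->
  m <= f (x + u) + f (x - u) - 2 * f x.
Proof.
move=> df ddf dm.
(* The claim is [phi 0 <= phi 1]. The derivative of [phi] is an increment of ['D_u f] over a segment
   of length [2 * s], minus [2 * m * s], hence nonnegative by a second mean value theorem. *)
pose phi := fun s : R => f (x + s *: u) + f (x + (- s) *: u) - m * s ^+ 2.
have D s : is_derive s (1 : R) (fun s => f (x + s *: u)) ('D_u f (x + s *: u)).
  exact: is_derive_line.
have Dphi s : is_derive s (1 : R) phi
    ('D_u f (x + s *: u) - 'D_u f (x + (- s) *: u) - m * (2 * s)).
  have DN : is_derive s (1 : R) (fun s => f (x + (- s) *: u)) (- 'D_u f (x + (- s) *: u)).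
    rewrite -mulrN1.
    have := @is_derive1_comp R (fun s => f (x + s *: u)) -%R s _ (-1) (D (- s)).
    apply; exact: is_deriveNid.
  rewrite /phi; apply: is_deriveB.
  apply: is_deriveZ; split; first exact: exprn_derivable.
  by rewrite exp_derive expr1 [_ *: _]mulr1.
have C : {within `[0, 1], continuous phi}.
  apply: continuous_subspaceT => s.
  by apply: differentiable_continuous; apply/derivable1_diffP; case: (Dphi s).
have [t] := MVT_segment ler01 (fun s _ => Dphi s) C.
rewrite in_itv/= subr0 mulr1 /phi scale0r oppr0 scale0r !addr0 scale1r scaleN1r => /andP[t0 t1].
rewrite expr1n mulr1 expr0n/= mulr0 subr0.
suff : 0 <= 'D_u f (x + t *: u) - 'D_u f (x + (- t) *: u) - m * (2 * t) by lra.
have := @mvt_segment_line R V ('D_u f) (x + (- t) *: u) ((2 * t) *: u).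
have -> : x + (- t) *: u + (2 * t) *: u = x + t *: u.
  by rewrite -addrA -scalerDl; congr (_ + _ *: _); ring.
have dz y : derivable ('D_u f) y ((2 * t) *: u).
  by have [] := @is_derive_dirZ R V ('D_u f) y u (2 * t) _ (derivableP (ddf y)).
move=> /(_ dz)[s s01 ->]; rewrite derive_dirZ// scalerA -addrA -scalerDl.
have /dm : `|- t + s * (2 * t)| <= 1 by rewrite ler_norml; nra.
by move: ('D_u _ _) => d md; nra.
Qed.

(** * Coordinates, periodicity and compactness *)

Lemma norm_coord (R : realType) (n : nat) (x : 'rV[R]_n) (i : 'I_n) : `|x 0 i| <= `|x|.
Proof. by rewrite {2}/Num.norm/= mx_normrE (le_bigmax _ (fun i => `|x i.1 i.2|) (0, i)). Qed.

Lemma norm_rV_le (R : realType) (n : nat) (x : 'rV[R]_n) (r : R) :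
  0 <= r -> (forall i, `|x 0 i| <= r) -> `|x| <= r.
Proof.
move=> r0 xr; rewrite {1}/Num.norm/= mx_normrE bigmax_le// => -[i j] _ /=.
by rewrite (ord1 i).
Qed.

Definition phase_dir (R : realType) (n : nat) (i : 'I_n + 'I_n) : @phase R n :=
  match i with inl i => dirx i | inr i => dirp i end.

Definition phase_coord (R : realType) (n : nat) (z : @phase R n) (i : 'I_n + 'I_n) : R :=
  match i with inl i => z.1 0 i | inr i => z.2 0 i end.

Lemma rV_finspan (R : realType) (n : nat) :
  finspan (@ev R n) (fun (x : 'rV[R]_n) i => x 0 i).
Proof. by split=> [w|w i]; [exact: row_sum_delta|exact: norm_coord]. Qed.

Lemma pair_sum (U V : zmodType) (I : Type) (s : seq I) (f : I -> U * V) :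
  \sum_(i <- s) f i = (\sum_(i <- s) (f i).1, \sum_(i <- s) (f i).2).
Proof. by elim/big_rec3: _ => [|i x y z _ ->]. Qed.

Lemma phase_finspan (R : realType) (n : nat) :
  finspan (@phase_dir R n) (@phase_coord R n).
Proof.
split=> [[x p]|[x p] i].
  rewrite big_sumType /= !pair_sum /=.
  rewrite [X in (_, X) + _]big1 ?[X in _ + (X, _)]big1 => [|i _|i _]; try by rewrite /= scaler0.
  rewrite -!row_sum_delta -[x in LHS]addr0 -[p in LHS]add0r; reflexivity.
case: i => i /=; rewrite prod_normE/= le_max norm_coord ?orbT//.
Qed.

Lemma derive_periodic (R : realType) (V : normedModType R) (f : V -> R) (a u z : V) :
  (forall z, f (z + a) = f z) -> 'D_u f (z + a) = 'D_u f z.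
Proof.
move=> fa; rewrite /derive.
have -> // : (fun h : R => h^-1 *: ((f \o shift (z + a)) (h *: u) - f (z + a))) =
  (fun h : R => h^-1 *: ((f \o shift z) (h *: u) - f z)).
by apply/funext => h /=; rewrite addrA !fa.
Qed.

Lemma ex_shift_cube (R : realType) (n : nat) (x : 'rV[R]_n) :
  exists k : 'rV[int]_n, forall i, 0 <= (x + intvec k) 0 i <= 1.
Proof.
exists (\row_i - Num.floor (x 0 i)) => i; rewrite !mxE mulrNz subr_ge0.
by rewrite ge_floor/= lerBlDr addrC ltW// -intrD1 floorD1_gt.
Qed.

Lemma cube_compact (R : realType) (n : nat) (a b : R) :
  compact [set x : 'rV[R]_n | forall i, a <= x 0 i <= b].
Proof.
have := @rV_compact R n (fun=> `[a, b]%classic) (fun=> @segment_compact R a b).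
by congr compact; apply/seteqP; split=> x /= H i; have := H i; rewrite /= in_itv.
Qed.

Lemma ball_rV_compact (R : realType) (n : nat) (r : R) : 0 <= r ->
  compact [set x : 'rV[R]_n | `|x| <= r].
Proof.
move=> r0; have := @cube_compact R n (- r) r; congr compact.
apply/seteqP; split=> x /= H.
  by apply: norm_rV_le => // i; rewrite ler_norml.
by move=> i; rewrite -ler_norml (le_trans (norm_coord _ _)).
Qed.

Lemma compact_ex_bound (R : realType) (T : topologicalType) (A : set T) (f : T -> R) :
  compact A -> continuous f -> exists2 C : R, 0 < C & forall x, A x -> `|f x| <= C.
Proof.
move=> cA cf.
have [->|A0] := eqVneq A set0; first by exists 1.
have /set0P A0' := A0.
have [|c _ cmax] := @compact_EVT_max T R (fun x => `|f x|) A A0' cA.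
  by apply: continuous_subspaceT => x; apply: continuous_comp; [exact: cf|exact: norm_continuous].
exists (`|f c| + 1); first by rewrite ltr_wpDl.
by move=> x Ax; rewrite (le_trans (cmax x _)) ?inE// lerDl.
Qed.

Definition xperiodic (R : realType) (n : nat) (T : Type) (g : @phase R n -> T) :=
  forall z (k : 'rV[int]_n), g (z + (intvec k, 0)) = g z.

(** Positions reduce to the unit cube by an integer translation, so only momenta have to be
    restricted for compactness to apply. *)
Lemma strip_bound (R : realType) (n : nat) (g : @phase R n -> R) (B : R) :
  continuous g -> xperiodic g ->
  exists2 C : R, 0 < C & forall z, `|z.2| <= B -> `|g z| <= C.
Proof.
move=> cg pg.
have [B0|B0] := ltP B 0.
  by exists 1 => // z; rewrite leNgt (lt_le_trans B0).
have [C C0 CP] := compact_ex_bound (compact_setX (@cube_compact R n 0 1) (@ball_rV_compact R n B B0)) cg.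
exists C => // -[x p] /= pB; have [k kP] := ex_shift_cube x.
rewrite -(pg _ k); apply: CP; split=> //=.
by rewrite addr0.
Qed.

(** The strip of bounded momenta is convex, so the mean value theorem applies on segments inside it,
    with the partial derivatives bounded by [strip_bound]. *)
Lemma strip_lipschitz (R : realType) (n : nat) (g : @phase R n -> R) (B : R) :
  cdiff g -> xperiodic g ->
  exists2 C : R, 0 < C & forall z z', `|z.2| <= B -> `|z'.2| <= B ->
     `|g z - g z'| <= C * `|z - z'|.
Proof.
move=> cg pg.
have H (i : 'I_n + 'I_n) := @strip_bound R n ('D_(phase_dir R i) g) B (cg _).2
  (fun z k => derive_periodic _ _ (pg^~ k)).
pose C := fun i => projT1 (cid2 (H i)).
have CP i z : `|z.2| <= B -> `|'D_(phase_dir R i) g z| <= C i.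
  by rewrite /C; case: (cid2 _) => /= c _; exact.
have C0 i : 0 < C i by rewrite /C; case: (cid2 _).
exists (\sum_i C i + 1); first by rewrite ltr_wpDl// sumr_ge0// => i _; rewrite ltW.
move=> z z' zB zB'; have [t /andP[t0 t1] E] := @mvt_segment_line R _ g z' (z - z') (cg _).1.
have {}E : g z - g z' = 'D_(z - z') g (z' + t *: (z - z')) by rewrite -E (addrC z') subrK.
rewrite E (le_trans (cdiff_bound (@phase_finspan R n) _ _ cg))// ler_wpM2r//.
rewrite (@le_trans _ _ (\sum_i C i)) ?lerDl//; apply: ler_sum => i _; apply: CP => /=.
have -> : z'.2 + t *: (z.2 - z'.2) = (1 - t) *: z'.2 + t *: z.2.
  by rewrite scalerBr scalerBl scale1r addrAC addrA.
rewrite (le_trans (ler_normD _ _))// !normrZ !ger0_norm ?subr_ge0//.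
nra.
Qed.

(** * The Hamiltonian *)

Lemma ham_cdiff2 (R : realType) (n : nat) (H : 'rV[R]_n -> 'rV[R]_n -> R) (u : phase) :
  C2_ham H -> cdiff ('D_u (Hz H)).
Proof. by move=> [_ C2] w; have [_ [? ?]] := C2 u w. Qed.

Lemma ham_cdiff (R : realType) (n : nat) (H : 'rV[R]_n -> 'rV[R]_n -> R) :
  C2_ham H -> cdiff (Hz H).
Proof.
move=> C2 u; split=> [x|x]; first by have [d _] := C2.2 u u; exact: d.
apply: differentiable_continuous.
exact: (cdiff_differentiable (@phase_finspan R n) _ (ham_cdiff2 u C2)).1.
Qed.

Lemma ham_xperiodic (R : realType) (n : nat) (H : 'rV[R]_n -> 'rV[R]_n -> R) :
  periodic_ham H -> xperiodic (Hz H).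
Proof. by move=> pH [x p] k; rewrite /Hz/= addr0 pH. Qed.

Lemma D_xperiodic (R : realType) (n : nat) (g : @phase R n -> R) u :
  xperiodic g -> xperiodic ('D_u g).
Proof. by move=> pg z k; apply: derive_periodic => y; exact: pg. Qed.

Lemma derive_lincomb (R : realType) (V : normedModType R) (I : Type) (s : seq I)
    (a : I -> R) (g : I -> V -> R) (x w : V) :
  (forall i, derivable (g i) x w) ->
  is_derive x w (fun y => \sum_(i <- s) a i * g i y) (\sum_(i <- s) a i * 'D_w (g i) x).
Proof.
move=> dg; elim: s => [|i s ih].
  rewrite big_nil; under eq_fun do rewrite big_nil.
  exact: is_derive_cst.
rewrite big_cons; under eq_fun do rewrite big_cons.
apply: is_deriveD; apply: is_deriveZ; exact/derivableP.
Qed.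

Lemma second_derive_coord (R : realType) (n : nat) (H : 'rV[R]_n -> 'rV[R]_n -> R)
    (z w u : phase) : C2_ham H ->
  'D_w ('D_u (Hz H)) z = \sum_i phase_coord w i * (\sum_j phase_coord u j *
     'D_(phase_dir R i) ('D_(phase_dir R j) (Hz H)) z).
Proof.
move=> C2; rewrite (cdiff_coord (@phase_finspan R n) _ _ (ham_cdiff2 u C2)).
apply: eq_bigr => i _; congr (_ * _).
have -> : 'D_u (Hz H) = fun y => \sum_j phase_coord u j * 'D_(phase_dir R j) (Hz H) y.
  by apply/funext => y; exact: (cdiff_coord (@phase_finspan R n) _ _ (ham_cdiff C2)).
apply: derive_val; apply: derive_lincomb => j.
exact: (ham_cdiff2 _ C2 _).1.
Qed.

Lemma sum_phase_coord_vert (R : realType) (n : nat) (xi : 'rV[R]_n) (F : 'I_n + 'I_n -> R) :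
  \sum_i phase_coord (0, xi) i * F i = \sum_i xi 0 i * F (inr i).
Proof.
by rewrite big_sumType /= big1 ?add0r// => i _; rewrite mxE mul0r.
Qed.

Lemma second_derive_vert (R : realType) (n : nat) (H : 'rV[R]_n -> 'rV[R]_n -> R)
    (x p xi : 'rV[R]_n) : C2_ham H ->
  'D_((0, xi) : phase) ('D_((0, xi) : phase) (Hz H)) (x, p) = (xi *m Hpp H x p *m xi^T) 0 0.
Proof.
move=> C2; rewrite (second_derive_coord _ _ _ C2) sum_phase_coord_vert mxE; apply: eq_bigr => i _.
rewrite sum_phase_coord_vert !mxE mulrC; congr (_ * _).
by apply: eq_bigr => j _; rewrite mxE.
Qed.

(** Two mean value theorems along the vertical vector [(0, q - p)]: the first-order remainder is a
    nonnegative multiple of a second vertical derivative, which is the quadratic form of [Hpp]. *)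
Lemma ham_convex (R : realType) (n : nat) (H : 'rV[R]_n -> 'rV[R]_n -> R)
    (x p q : 'rV[R]_n) : C2_ham H -> Hpp_posdef H ->
  H x p + \sum_i 'D_(dirp i) (Hz H) (x, p) * (q - p) 0 i <= H x q.
Proof.
move=> C2 pd; have cH := ham_cdiff C2.
pose w : phase := (0, q - p).
have dE : 'D_w (Hz H) (x, p) = \sum_i 'D_(dirp i) (Hz H) (x, p) * (q - p) 0 i.
  rewrite (cdiff_coord (@phase_finspan R n) _ _ cH) sum_phase_coord_vert.
  by apply: eq_bigr => i _; rewrite mulrC.
have D2 z : 0 <= 'D_w ('D_w (Hz H)) z.
  case: z => y r; rewrite second_derive_vert//.
  have [->|qp] := eqVneq (q - p) 0; first by rewrite !mul0mx mxE.
  by rewrite ltW// pd.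
have [t /andP[t0 t1] E] := mvt_segment_line (x, p) (cH w).1.
have {}E : H x q - H x p = 'D_w (Hz H) ((x, p) + t *: w).
  rewrite -E /Hz /= addr0; congr (H _ _ - _).
  by rewrite addrC subrK.
have dtw y : derivable ('D_w (Hz H)) y (t *: w).
  by have [] := is_derive_dirZ t (derivableP ((ham_cdiff2 w C2 w).1 y)).
have [s /andP[s0 s1] E2] := mvt_segment_line (x, p) dtw.
rewrite -dE -lerBrDl E -subr_ge0 E2 derive_dirZ ?mulr_ge0//.
exact: (ham_cdiff2 w C2 w).1.
Qed.

(** Source of all gradient bounds: a subsolution test yields [H x p <= A]. Superlinearity with slope
    1 gives [|p| <= H x p] once [|p| >= K]. *)
Lemma ham_coercive (R : realType) (n : nat) (H : 'rV[R]_n -> 'rV[R]_n -> R) (A : R) :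
  superlinear H -> exists2 Q : R, 0 < Q & forall x p, H x p <= A -> `|p| <= Q.
Proof.
move=> /(_ 1)[K [K0 KP]]; exists (Num.max K A); first by rewrite lt_max K0.
move=> x p Hp; rewrite le_max; have [//|/ltW Kp /=] := leP `|p| K.
apply: le_trans Hp; have := KP x p Kp.
by rewrite ler_pdivlMr ?mul1r//; exact: lt_le_trans Kp.
Qed.

Lemma second_derive_bound (R : realType) (n : nat) (H : 'rV[R]_n -> 'rV[R]_n -> R) (B : R) :
  C2_ham H -> periodic_ham H ->
  exists2 C : R, 0 < C & forall z w u, `|z.2| <= B ->
    `|'D_w ('D_u (Hz H)) z| <= C * `|w| * `|u|.
Proof.
move=> C2 /ham_xperiodic pH.
have Hb (ij : ('I_n + 'I_n) * ('I_n + 'I_n)) := @strip_bound R n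
  ('D_(phase_dir R ij.1) ('D_(phase_dir R ij.2) (Hz H))) B
  (ham_cdiff2 _ C2 _).2 (D_xperiodic _ (D_xperiodic _ pH)).
pose C := fun ij => projT1 (cid2 (Hb ij)).
have CP ij z : `|z.2| <= B ->
    `|'D_(phase_dir R ij.1) ('D_(phase_dir R ij.2) (Hz H)) z| <= C ij.
  by rewrite /C; case: (cid2 _) => /= c _; exact.
have C0 ij : 0 < C ij by rewrite /C; case: (cid2 _).
exists (\sum_ij C ij + 1); first by rewrite ltr_wpDl// sumr_ge0// => i _; rewrite ltW.
move=> z w u zB; rewrite second_derive_coord//.
apply: (@le_trans _ _ ((\sum_ij C ij) * `|w| * `|u|)); last first.
  by rewrite -!mulrA ler_wpM2r ?mulr_ge0// lerDl.
rewrite !mulr_suml (le_trans (ler_norm_sum _ _ _))//.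
rewrite (eq_bigr (fun ij => C (ij.1, ij.2) * `|w| * `|u|)); last by case.
rewrite -(pair_bigA _ (fun i j => C (i, j) * `|w| * `|u|)).
apply: ler_sum => i _; rewrite normrM -!mulr_suml mulrAC mulrC.
rewrite ler_pM ?(phase_finspan R n).2// (le_trans (ler_norm_sum _ _ _))// mulr_suml.
by apply: ler_sum => j _; rewrite normrM mulrC ler_pM ?(phase_finspan R n).2 ?(CP (i, j)).
Qed.

Lemma mx_continuous_coord (R : realType) (n : nat) (i : 'I_n) :
  continuous (fun x : 'rV[R]_n => x 0 i).
Proof. by move=> x; exact: coord_continuous. Qed.

Lemma continuous_sumr (R : realType) (T : topologicalType) (I : Type) (s : seq I)
   (g : I -> T -> R) : (forall i, continuous (g i)) ->
   continuous (fun x => \sum_(i <- s) g i x).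
Proof. by move=> cg; apply: continuous_big => //; exact: add_continuous. Qed.

(** The form is positive and continuous on the compact product of the unit cube, a ball of momenta
    and the unit sphere, so it has a positive minimum there; homogeneity of degree 2 and periodicity
    extend the bound. *)
Lemma ham_uniform_convex (R : realType) (n : nat) (H : 'rV[R]_n -> 'rV[R]_n -> R) (B : R) :
  (0 < n)%N -> C2_ham H -> periodic_ham H -> Hpp_posdef H ->
  exists2 th : R, 0 < th & forall x p xi, `|p| <= B ->
    th * `|xi| ^+ 2 <= 'D_((0, xi) : phase) ('D_((0, xi) : phase) (Hz H)) (x, p).
Proof.
move=> n0 C2 pH pd.
have [B0|B0] := ltP B 0; first by exists 1 => // x p xi; rewrite leNgt (lt_le_trans B0).
pose A : set (@phase R n * 'rV[R]_n) :=
  ([set x : 'rV[R]_n | forall i, 0 <= x 0 i <= 1] `*` [set p | `|p| <= B]) `*`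
  [set xi | `|xi| = 1].
pose g (y : @phase R n * 'rV[R]_n) := \sum_i y.2 0 i * (\sum_j y.2 0 j *
     'D_(dirp i) ('D_(dirp j) (Hz H)) y.1).
have gE x p xi : 'D_((0, xi) : phase) ('D_((0, xi) : phase) (Hz H)) (x, p) = g ((x, p), xi).
  rewrite (second_derive_coord _ _ _ C2) sum_phase_coord_vert.
  by apply: eq_bigr => i _; rewrite sum_phase_coord_vert.
have cg : continuous g.
  have c2 i : continuous (fun y : @phase R n * 'rV[R]_n => y.2 0 i).
    move=> y; apply: (@continuous_comp _ _ _ snd (fun x : 'rV[R]_n => x 0 i)).
      exact: cvg_snd.
    exact: mx_continuous_coord.
  have c1 i j : continuous (fun y : @phase R n * 'rV[R]_n =>
      y.2 0 j * 'D_(dirp i) ('D_(dirp j) (Hz H)) y.1).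
    have cD : continuous (fun y : @phase R n * 'rV[R]_n => 'D_(dirp i) ('D_(dirp j) (Hz H)) y.1).
      move=> y; apply: (@continuous_comp _ _ _ fst ('D_(dirp i) ('D_(dirp j) (Hz H)))).
        exact: cvg_fst.
      exact: (ham_cdiff2 _ C2 _).2.
    by move=> y; exact: (continuousM (c2 j y) (cD y)).
  have c3 i : continuous (fun y : @phase R n * 'rV[R]_n => y.2 0 i * 
     (\sum_j y.2 0 j * 'D_(dirp i) ('D_(dirp j) (Hz H)) y.1)).
    by move=> y; exact: (continuousM (c2 i y) (continuous_sumr (c1 i) (x := y))).
  by move=> y; exact: (continuous_sumr c3).
have cA : compact A.
  apply: compact_setX; first by apply: compact_setX; [exact: cube_compact|exact: ball_rV_compact].
  apply: (subclosed_compact _ (@ball_rV_compact R n 1 ler01)) => [|x /= ->//].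
  rewrite (_ : [set xi | _] = (fun xi : 'rV[R]_n => `|xi|) @^-1` [set 1])//.
  by apply: closed_comp => [x _|]; [exact: norm_continuous|exact: closed_eq].
(* In the sup norm the vector of ones lies on the unit sphere; [n0] provides the coordinate that
   shows it. *)
have A0 : A !=set0.
  exists ((0, 0), const_mx 1); split=> //=; first split=> /=.
  - by move=> i; rewrite mxE lexx ler01.
  - by rewrite normr0.
  apply/eqP; rewrite eq_le norm_rV_le//=; last by move=> i; rewrite mxE normr1.
  by rewrite (le_trans _ (norm_coord _ (Ordinal n0)))// mxE normr1.
have [[[x p] xi]] := compact_EVT_min A0 cA (continuous_subspaceT cg).
rewrite inE => -[[/= xA pA] xiA] gmin.
exists (g ((x, p), xi)).
  rewrite -gE second_derive_vert//; apply: pd.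
  by rewrite -normr_eq0 xiA oner_eq0.
move=> x' p' xi' p'B.
have [->|xi0] := eqVneq xi' 0.
  by rewrite normr0 expr0n/= mulr0 derive0.
have nxi : 0 < `|xi'| by rewrite normr_gt0.
have [k kP] := ex_shift_cube x'.
have Ax : A ((x' + intvec k, p'), `|xi'|^-1 *: xi').
  split; first by split.
  by rewrite /= normrZ normfV normr_id mulVf// gt_eqF.
have := gmin _ (mem_set Ax).
rewrite -(gE (x' + intvec k)) => gm; rewrite -ler_pdivlMr ?exprn_gt0//; apply: le_trans gm _.
have E w u : 'D_w ('D_u (Hz H)) (x' + intvec k, p') = 'D_w ('D_u (Hz H)) (x', p').
  have -> : (x' + intvec k, p') = (x', p') + (intvec k, 0) :> phase.
    by congr pair; rewrite /= addr0.
  exact: (D_xperiodic _ (D_xperiodic _ (ham_xperiodic pH))).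
rewrite E.
rewrite (second_derive_vert _ _ _ C2) (second_derive_vert _ _ _ C2).
rewrite -scalemxAl -scalemxAl linearZ/= -scalemxAr !mxE.
rewrite mulrA mulrC; rewrite -expr2 exprVn; exact: lexx.
Qed.

(** The mixed terms cost at most [8 * C * K * E ^+ 2], linear in [K], while the vertical term gains
    [16 * th * K ^+ 2 * E ^+ 2]. Once [K * th >= C + 1] the gain also covers the horizontal term and
    leaves [E ^+ 2]. *)
Lemma semiconcave_algebra (R : realType) (K C th E d1 d2 d3 d4 : R) :
  1 <= K -> 0 < C -> C + 1 <= K * th ->
  - (C * E * E) <= d1 -> - (C * E * (4 * K * E)) <= d2 ->
  - (C * (4 * K * E) * E) <= d3 -> th * (4 * K * E) ^+ 2 <= d4 ->
  E ^+ 2 <= (d1 + d3) + (d2 + d4).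
Proof.
move=> K1 C0 Kth h1 h2 h3 h4.
have h4' : 16 * K * (C + 1) * E ^+ 2 <= d4.
  apply: le_trans h4.
  rewrite (_ : th * _ = 16 * K * (K * th) * E ^+ 2); last by ring.
  by rewrite ler_wpM2r ?sqr_ge0// ler_wpM2l// mulr_ge0// (le_trans ler01).
have p1 : 0 <= (K - 1) * E ^+ 2 by rewrite mulr_ge0 ?sqr_ge0// subr_ge0.
have p2 : 0 <= (K - 1) * C * E ^+ 2.
  by rewrite mulr_ge0 ?sqr_ge0// mulr_ge0 ?subr_ge0// ltW.
have p3 : 0 <= C * E ^+ 2 by rewrite mulr_ge0 ?sqr_ge0// ltW.
have p4 : 0 <= E ^+ 2 by rewrite sqr_ge0.
lra.
Qed.

(** The direction [(e, 4 K e)] is the one met in the doubling: points [m + e] and [m - e] are [2 e]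
    apart, and the penalty [K |x - y|^2] gives them the test gradients [P + 4 K e] and
    [P - 4 K e]. *)
Lemma semiconcave_constant (R : realType) (n : nat) (H : 'rV[R]_n -> 'rV[R]_n -> R) (B : R) :
  (0 < n)%N -> C2_ham H -> periodic_ham H -> Hpp_posdef H ->
  exists2 K : R, 0 < K & forall x p e, `|p| <= B -> forall w : phase, w = (e, (4 * K) *: e) ->
    `|e| ^+ 2 <= 'D_w ('D_w (Hz H)) (x, p).
Proof.
move=> n0 C2 pH pd.
have [th th0 thP] := ham_uniform_convex B n0 C2 pH pd.
have [C C0 CP] := second_derive_bound B C2 pH.
pose K := Num.max 1 ((C + 1) / th).
have K1 : 1 <= K by rewrite le_max lexx.
have Kth : C + 1 <= K * th by rewrite -ler_pdivrMr// le_max lexx orbT.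
exists K; first exact: lt_le_trans K1.
move=> x p e pB w ->.
have [a Ea] : exists a : phase, a = (e, 0) by eexists.
have [b Eb] : exists b : phase, b = (0, (4 * K) *: e) by eexists.
have -> : (e, (4 * K) *: e) = a + b.
  by rewrite Ea Eb; congr pair; rewrite /= ?addr0 ?add0r.
have cH := ham_cdiff C2.
have D1 z : 'D_(a + b) (Hz H) z = 'D_a (Hz H) z + 'D_b (Hz H) z.
  by apply: deriveDr; [exact: (cH a).1|exact: (cH b).1|exact: (cH b).2].
have D2 u z : 'D_(a + b) ('D_u (Hz H)) z = 'D_a ('D_u (Hz H)) z + 'D_b ('D_u (Hz H)) z.
  have cu := ham_cdiff2 u C2.
  by apply: deriveDr; [exact: (cu a).1|exact: (cu b).1|exact: (cu b).2].
have S : 'D_(a + b) (Hz H) = 'D_a (Hz H) + 'D_b (Hz H) by apply/funext => z; exact: D1.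
have E2 : 'D_(a + b) ('D_(a + b) (Hz H)) (x, p) =
    ('D_a ('D_a (Hz H)) (x, p) + 'D_b ('D_a (Hz H)) (x, p)) +
    ('D_a ('D_b (Hz H)) (x, p) + 'D_b ('D_b (Hz H)) (x, p)).
  have DE (F G : @phase R n -> R) : F = G -> 'D_(a + b) F (x, p) = 'D_(a + b) G (x, p) by move=> ->.
  have A : derivable ('D_a (Hz H)) (x, p) (a + b) by exact: (ham_cdiff2 a C2 _).1.
  have B' : derivable ('D_b (Hz H)) (x, p) (a + b) by exact: (ham_cdiff2 b C2 _).1.
  exact: (etrans (DE _ _ S) (etrans (deriveD A B') (f_equal2 +%R (D2 a _) (D2 b _)))).
rewrite E2.
have na : `|a| = `|e| by rewrite Ea prod_normE/= normr0 max_l.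
have nb' : `|(4 * K) *: e| = 4 * K * `|e|.
  by rewrite normrZ ger0_norm// mulr_ge0// (le_trans ler01).
have nb : `|b| = 4 * K * `|e| by rewrite Eb prod_normE/= normr0 max_r// nb'.
have bnd y u : - (C * `|y| * `|u|) <= 'D_y ('D_u (Hz H)) (x, p).
  by have := CP (x, p) y u pB; rewrite ler_norml => /andP[].
have h4 := thP x p ((4 * K) *: e) pB; rewrite -Eb nb' in h4.
have h1 := bnd a a; have h2 := bnd a b; have h3 := bnd b a.
rewrite na in h1; rewrite na nb in h2; rewrite na nb in h3.
exact: (semiconcave_algebra K1 C0 Kth h1 h2 h3 h4).
Qed.

(** * Quadratic test functions *)

(** The norm of ['rV[R]_n] is the sup norm, which is not smooth; penalties use the Euclidean square
    [dot x x], compared with the norm by [dot_ge] and [dot_le]. *)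
Definition dot (R : realType) (n : nat) (x y : 'rV[R]_n) : R := \sum_i x 0 i * y 0 i.

Lemma dotC (R : realType) (n : nat) (x y : 'rV[R]_n) : dot x y = dot y x.
Proof. by apply: eq_bigr => i _; rewrite mulrC. Qed.

Lemma dotDl (R : realType) (n : nat) (x y z : 'rV[R]_n) : dot (x + y) z = dot x z + dot y z.
Proof. by rewrite -big_split; apply: eq_bigr => i _; rewrite mxE mulrDl. Qed.

Lemma dotZl (R : realType) (n : nat) (a : R) (x z : 'rV[R]_n) : dot (a *: x) z = a * dot x z.
Proof. by rewrite /dot mulr_sumr; apply: eq_bigr => i _; rewrite mxE mulrA. Qed.

Lemma dotNl (R : realType) (n : nat) (x z : 'rV[R]_n) : dot (- x) z = - dot x z.
Proof. by rewrite -scaleN1r dotZl mulN1r. Qed.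

Lemma dotDr (R : realType) (n : nat) (x y z : 'rV[R]_n) : dot z (x + y) = dot z x + dot z y.
Proof. by rewrite ![dot z _]dotC dotDl. Qed.

Lemma dotZr (R : realType) (n : nat) (a : R) (x z : 'rV[R]_n) : dot z (a *: x) = a * dot z x.
Proof. by rewrite ![dot z _]dotC dotZl. Qed.

Lemma dotNr (R : realType) (n : nat) (x z : 'rV[R]_n) : dot z (- x) = - dot z x.
Proof. by rewrite ![dot z _]dotC dotNl. Qed.

Definition dotE := (dotDl, dotDr, dotNl, dotNr, dotZl, dotZr).

Lemma dot_ge (R : realType) (n : nat) (x : 'rV[R]_n) : `|x| ^+ 2 <= dot x x.
Proof.
have [->|x0] := eqVneq `|x| 0.
  by rewrite expr0n/= sumr_ge0// => i _; rewrite -expr2 sqr_ge0.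
have /mx_norm_neq0[[i j] E] : mx_norm x != 0 by [].
have -> : `|x| = `|x 0 j| by rewrite -(ord1 i); exact: E.
rewrite -normrX ger0_norm ?sqr_ge0//.
rewrite /dot (bigD1 j)//= expr2 lerDl sumr_ge0// => k _.
by rewrite -expr2 sqr_ge0.
Qed.

Lemma dot_ge0 (R : realType) (n : nat) (x : 'rV[R]_n) : 0 <= dot x x.
Proof. exact: le_trans (dot_ge x). Qed.

Lemma norm_dot (R : realType) (n : nat) (x y : 'rV[R]_n) : `|dot x y| <= n%:R * `|x| * `|y|.
Proof.
rewrite (le_trans (ler_norm_sum _ _ _))//.
have -> : n%:R * `|x| * `|y| = \sum_(i < n) `|x| * `|y|.
  by rewrite sumr_const card_ord -mulrA mulr_natl.
by apply: ler_sum => i _; rewrite normrM ler_pM// norm_coord.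
Qed.

Lemma dot_continuous (R : realType) (n : nat) (b : 'rV[R]_n) : continuous (dot b).
Proof.
move=> x; apply/continuous_normP => e e0.
have B0 : 0 < n%:R * `|b| + 1 by rewrite ltr_wpDl// mulr_ge0.
exists (e / (n%:R * `|b| + 1)); first by rewrite divr_gt0.
move=> y; rewrite ltr_pdivlMr// -dotNr -dotDr => xy.
rewrite (le_lt_trans (norm_dot _ _))// (le_lt_trans _ xy)// mulrC ler_wpM2l//.
by rewrite lerDl.
Qed.

Lemma sq_continuous (R : realType) (n : nat) : continuous (fun x : 'rV[R]_n => dot x x).
Proof.
have c i : continuous (fun x : 'rV[R]_n => x 0 i * x 0 i).
  move=> x; exact: (continuousM (@mx_continuous_coord R n i x) (@mx_continuous_coord R n i x)).
by move=> x; exact: (continuous_sumr c).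
Qed.

(** Up to an additive constant every penalty [a |y - z|^2] has this shape ([shifted_quad]), so one
    family of test functions serves all the maximisations. *)
Definition quad (R : realType) (n : nat) (a : R) (b : 'rV[R]_n) (y : 'rV[R]_n) : R :=
  dot b y + a * dot y y.

Lemma quad_is_derive (R : realType) (n : nat) (a : R) (b x u : 'rV[R]_n) :
  is_derive x u (quad a b) (dot (b + (2 * a) *: x) u).
Proof.
apply/is_derive_lineP.
have -> : (fun s => quad a b (x + s *: u)) =
    cst (quad a b x) + (dot (b + (2 * a) *: x) u \*: id + (a * dot u u) \*: (fun s => s ^+ 2)).
  apply/funext => s; rewrite /quad !fctE /cst /= /GRing.scale/= !dotE (dotC u x); ring.
have d2 : is_derive (0 : R) (1 : R) (fun s : R => s ^+ 2) 0.
  split; first exact: exprn_derivable.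
  by rewrite exp_derive expr1 /GRing.scale/= ?(mulr0, mul0r).
rewrite [X in is_derive _ _ _ X](_ : _ = 0 + (dot (b + (2 * a) *: x) u *: 1 + (a * dot u u) *: (0 : R))); last first.
  by rewrite scaler0 addr0 add0r; exact: (esym (mulr1 _)).
by apply: is_deriveD; apply: is_deriveD.
Qed.

Lemma quad_C1 (R : realType) (n : nat) (a : R) (b : 'rV[R]_n) : C1 (quad a b).
Proof.
split=> [x|u].
  apply: continuousD; first exact: dot_continuous.
  by apply: continuousM; [exact: cst_continuous|exact: sq_continuous].
split=> [x|]; first by have [] := quad_is_derive a b x u.
have C : continuous (fun x : 'rV[R]_n => dot b u + (2 * a) * dot u x).
  move=> x; have c1 : {for x, continuous (fun=> dot b u)} by exact: cst_continuous.
  have c2 : {for x, continuous (fun=> 2 * a)} by exact: cst_continuous.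
  exact: (continuousD c1 (continuousM c2 (@dot_continuous R n u x))).
have E : 'D_u (quad a b) = fun x => dot b u + (2 * a) * dot u x.
  apply/funext => x; have [_ ->] := quad_is_derive a b x u.
  by rewrite !dotE (dotC x).
move=> x; rewrite E; exact: C.
Qed.

Lemma grad_quad (R : realType) (n : nat) (a : R) (b x : 'rV[R]_n) :
  grad (quad a b) x = b + (2 * a) *: x.
Proof.
apply/rowP => i; rewrite mxE; have [_ ->] := quad_is_derive a b x (ev i).
rewrite /dot (bigD1 i)//= big1 => [|j ji]; first by rewrite addr0 /ev [delta_mx _ _ _ _]mxE !eqxx mulr1.
by rewrite /ev [delta_mx _ _ _ _]mxE (negPf ji) andbF mulr0.
Qed.

Lemma visc_sub_quad (R : realType) (n : nat) (F : 'rV[R]_n -> R -> 'rV[R]_n -> R)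
    (u : 'rV[R]_n -> R) (a : R) (b x : 'rV[R]_n) (r : R) : visc_sub F u -> 0 < r ->
  (forall w, `|w| < r -> u (x + w) - quad a b (x + w) <= u x - quad a b x) ->
  F x (u x) (b + (2 * a) *: x) <= 0.
Proof.
move=> subu r0 umax; rewrite -grad_quad; apply: subu; first exact: quad_C1.
by apply/near_normP; exists r => // y yx; have := umax (y - x) yx; rewrite (addrC x) subrK.
Qed.

Lemma visc_super_quad (R : realType) (n : nat) (F : 'rV[R]_n -> R -> 'rV[R]_n -> R)
    (u : 'rV[R]_n -> R) (a : R) (b x : 'rV[R]_n) (r : R) : visc_super F u -> 0 < r ->
  (forall w, `|w| < r -> u x - quad a b x <= u (x + w) - quad a b (x + w)) ->
  0 <= F x (u x) (b + (2 * a) *: x).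
Proof.
move=> subu r0 umax; rewrite -grad_quad; apply: subu; first exact: quad_C1.
by apply/near_normP; exists r => // y yx; have := umax (y - x) yx; rewrite (addrC x) subrK.
Qed.

(** * Lipschitz bounds for subsolutions *)

Lemma periodic_bound (R : realType) (n : nat) (u : 'rV[R]_n -> R) :
  continuous u -> Defs.periodic u -> exists2 C : R, 0 < C & forall x, `|u x| <= C.
Proof.
move=> cu pu; have [C C0 CP] := compact_ex_bound (@cube_compact R n 0 1) cu.
by exists C => // x; have [k kP] := ex_shift_cube x; rewrite -(pu _ k) CP.
Qed.

Lemma ler_eps_scale (R : realType) (x y C : R) : 0 < C ->
  (forall e, 0 < e -> x <= y + C * e) -> x <= y.
Proof.
move=> C0 H; apply/ler_addgt0Pr => e e0.
by have := H (e / C) (divr_gt0 e0 C0); rewrite mulrC divfK// gt_eqF.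
Qed.

(** Passing through the midpoint doubles the number of quadratic errors and divides each by 4, so
    the error halves at every bisection while the linear term is unchanged. *)
Lemma lipschitz_of_quadratic (R : realType) (V : normedModType R) (f : V -> R) (L A : R) :
  0 <= A ->
  (forall x y, f x - f y <= L * `|x - y| + A * `|x - y| ^+ 2) ->
  forall x y, f x - f y <= L * `|x - y|.
Proof.
move=> A0 fLA x y.
have H k : forall x y, f x - f y <= L * `|x - y| + A * `|x - y| ^+ 2 / 2 ^+ k.
  elim: k => [|k ih] {}x {}y; first by rewrite expr0 divr1.
  pose m := 2^-1 *: (x + y).
  have xm : `|x - m| = `|x - y| / 2.
    have -> : x - m = 2^-1 *: (x - y).
      rewrite /m scalerDr opprD addrA scalerBr; congr (_ - _).
      by rewrite -{1}[x]scale1r -scalerBl; congr (_ *: _); field.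
    by rewrite normrZ gtr0_norm ?invr_gt0// mulrC.
  have my : `|m - y| = `|x - y| / 2.
    have -> : m - y = 2^-1 *: (x - y).
      rewrite /m scalerDr -addrA scalerBr; congr (_ + _).
      by rewrite -{2}[y]scale1r -scalerBl -scaleNr; congr (_ *: _); field.
    by rewrite normrZ gtr0_norm ?invr_gt0// mulrC.
  have := ih x m; have := ih m y; rewrite xm my [2 ^+ k.+1]exprS.
  have p0 : 0 < (2 : R) ^+ k by rewrite exprn_gt0.
  have -> : A * `|x - y| ^+ 2 / (2 * 2 ^+ k) =
     A * (`|x - y| / 2) ^+ 2 / 2 ^+ k + A * (`|x - y| / 2) ^+ 2 / 2 ^+ k.
    by field; rewrite gt_eqF.
  lra.
set B := A * `|x - y| ^+ 2 in H *.
have B0 : 0 <= A * `|x - y| ^+ 2 by rewrite mulr_ge0// exprn_ge0.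
apply/ler_addgt0Pr => e e0.
pose k := (Num.truncn (A * `|x - y| ^+ 2 / e)).+1.
apply: le_trans (H k x y) _; rewrite lerD2l ler_pdivrMr ?exprn_gt0//.
have : A * `|x - y| ^+ 2 / e < k%:R by rewrite truncnS_gt.
rewrite ltr_pdivrMr// => /ltW/le_trans; apply.
have kE : (k%:R : R) <= 2 ^+ k.
  by have := ltnW (ltn_expl k (isT : (1 < 2)%N)); rewrite -(ler_nat R) natrX.
by rewrite mulrC ler_wpM2l// ltW.
Qed.

Lemma cont_add (R : realType) (T : topologicalType) (V : normedModType R) (f g : T -> V) :
  continuous f -> continuous g -> continuous (fun x => f x + g x).
Proof. by move=> cf cg x; exact: (continuousD (cf x) (cg x)). Qed.

Lemma cont_sub (R : realType) (T : topologicalType) (V : normedModType R) (f g : T -> V) :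
  continuous f -> continuous g -> continuous (fun x => f x - g x).
Proof. by move=> cf cg x; exact: (continuousB (cf x) (cg x)). Qed.

Lemma cont_comp (S T U : topologicalType) (f : S -> T) (g : T -> U) :
  continuous f -> continuous g -> continuous (fun x => g (f x)).
Proof. by move=> cf cg x; apply: continuous_comp; [exact: cf|exact: cg]. Qed.

Lemma cont_scale (R : realType) (T : topologicalType) (V : normedModType R) (k : R) (f : T -> V) :
  continuous f -> continuous (fun x => k *: f x).
Proof. by move=> cf; apply: (cont_comp cf); exact: scaler_continuous. Qed.

Lemma cont_mulc (R : realType) (T : topologicalType) (k : R) (f : T -> R) :
  continuous f -> continuous (fun x => k * f x).
Proof. exact: cont_scale. Qed.

Lemma cont_sq (R : realType) (n : nat) (T : topologicalType) (f : T -> 'rV[R]_n) :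
  continuous f -> continuous (fun x => dot (f x) (f x)).
Proof. by move=> cf; apply: (cont_comp cf (@sq_continuous R n)). Qed.

Lemma cont_fst (S T : topologicalType) : continuous (fun x : S * T => x.1).
Proof. by move=> x; exact: cvg_fst. Qed.

Lemma cont_snd (S T : topologicalType) : continuous (fun x : S * T => x.2).
Proof. by move=> x; exact: cvg_snd. Qed.

Lemma cont_cst (S T : topologicalType) (a : T) : continuous (fun _ : S => a).
Proof. by move=> x; exact: cvg_cst. Qed.

Lemma ex_max_on (R : realType) (T : topologicalType) (D A : set T) (G : T -> R) (t0 : T) :
  compact A -> continuous G -> A `<=` D -> A t0 ->
  (forall t, D t -> exists2 t', A t' & G t <= G t') ->
  exists2 t, A t & forall t', D t' -> G t' <= G t.
Proof.
move=> cA cG AD At0 dom.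
have [t tA tmax] := compact_EVT_max (ex_intro _ _ At0) cA (continuous_subspaceT cG).
rewrite inE in tA; exists t => // t' /dom[s As] /le_trans; apply.
by apply: tmax; rewrite inE.
Qed.

Lemma ball_large (R : realType) (n : nat) (a C : R) (w : 'rV[R]_n) :
  0 < a -> 0 < C -> C / a + 1 < `|w| -> C <= a * dot w w.
Proof.
move=> a0 C0 wr; apply: (@le_trans _ _ (a * `|w| ^+ 2)); last first.
  by apply: ler_wpM2l; [exact: ltW|exact: dot_ge].
have Ca : 0 < C / a by rewrite divr_gt0.
have : C <= a * (C / a + 1).
  by rewrite mulrDr mulr1 mulrCA divff ?gt_eqF// mulr1 lerDl ltW.
move=> /le_trans; apply; apply: ler_wpM2l; [exact: ltW|rewrite expr2; nra].
Qed.

Lemma dot0 (R : realType) (n : nat) (x : 'rV[R]_n) : dot 0 x = 0.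
Proof. by rewrite /dot big1// => i _; rewrite mxE mul0r. Qed.

Lemma ex_max_quad (R : realType) (n : nat) (u : 'rV[R]_n -> R) (a : R) (z : 'rV[R]_n) :
  continuous u -> Defs.periodic u -> 0 < a ->
  exists y, forall y', u y' - a * dot (y' - z) (y' - z) <= u y - a * dot (y - z) (y - z).
Proof.
move=> cu pu a0; have [C C0 uC] := periodic_bound cu pu.
pose G w := u (z + w) - a * dot w w.
pose r := (2 * C) / a + 1.
have r0 : 0 <= r by rewrite addr_ge0// ltW// divr_gt0// mulr_gt0.
have cG : continuous G.
  apply: cont_sub; last by apply: cont_mulc; exact: sq_continuous.
  apply: cont_comp cu; apply: cont_add; [exact: cont_cst|exact: (fun x => cvg_id)].
have [||w _ wmax] := @ex_max_on R _ setT _ G 0 (@ball_rV_compact R n r r0) cG (fun _ _ => I).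
- by rewrite /= normr0.
- move=> w _; have [wr|wr] := leP `|w| r; first by exists w.
  exists 0; first by rewrite /= normr0.
  have := ball_large a0 (mulr_gt0 (ltr0Sn R 1) C0) wr; rewrite /G dot0.
  have := uC (z + w); have := uC (z + 0); rewrite !ler_norml.
  lra.
exists (z + w) => y'; have := wmax (y' - z) I; rewrite /G (addrC z) subrK.
by rewrite (addrC z w) addrK.
Qed.

Lemma dot_le (R : realType) (n : nat) (x : 'rV[R]_n) : dot x x <= n%:R * `|x| ^+ 2.
Proof. by rewrite expr2 mulrA (le_trans (ler_norm _))// norm_dot. Qed.

(* The maximal values [m z] of [u - a |. - z|^2] (a sup-convolution of [u]) are
   Lipschitz in [z] with a constant independent of [a], and tend to [u z] as [a] grows. *)
Lemma lipschitz_of_test (R : realType) (n : nat) (u : 'rV[R]_n -> R) (Q : R) :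
  continuous u -> Defs.periodic u -> 0 < Q ->
  (forall x z (a : R), 0 < a ->
    (forall y, u y - a * dot (y - z) (y - z) <= u x - a * dot (x - z) (x - z)) ->
    `|(2 * a) *: (x - z)| <= Q) ->
  forall x y, `|u x - u y| <= n%:R * Q * `|x - y|.
Proof.
move=> cu pu Q0 test.
suff H x y : u x - u y <= n%:R * Q * `|x - y|.
  by move=> x y; rewrite ler_norml H andbT lerNl opprB distrC H.
apply/ler_addgt0Pr => e e0.
have [d d0 dP] := (continuous_normP u y).1 (cu y) e e0.
(* With this weight a maximiser satisfies [|Y z - z| <= Q / (2 * a) < d], within the radius of
   continuity of [u] at [y]. *)
pose a := (Q + 1) / d.
have a0 : 0 < a by rewrite divr_gt0// addr_gt0.
have ym z := ex_max_quad z cu pu a0.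
pose Y z := projT1 (cid (ym z)).
have YP z y' : u y' - a * dot (y' - z) (y' - z) <= u (Y z) - a * dot (Y z - z) (Y z - z).
  by rewrite /Y; case: (cid _) => /= ? ; exact.
have a20 : 0 < 2 * a by rewrite mulr_gt0.
have YQ z : `|Y z - z| <= Q / (2 * a).
  have := test (Y z) z a a0 (YP z); rewrite normrZ (gtr0_norm a20).
  by rewrite ler_pdivlMr// [X in _ -> X <= _]mulrC.
pose m z := u (Y z) - a * dot (Y z - z) (Y z - z).
(* Using [Y z] as a competitor for [z'] leaves [2 a (Y z - z).(z - z') + a |z - z'|^2]. The first
   term is linear with the constant supplied by [test]; the second is removed by
   [lipschitz_of_quadratic]. *)
have mlip : forall z z', m z - m z' <= n%:R * Q * `|z - z'|.
  apply: (@lipschitz_of_quadratic R _ m _ (a * n%:R)); first by rewrite mulr_ge0// ltW.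
  move=> z z'; have := YP z' (Y z); rewrite /m.
  have -> : Y z - z' = (Y z - z) + (z - z') by rewrite addrA subrK.
  have h1 := norm_dot (Y z - z) (z - z'); have h2 := dot_le (z - z').
  rewrite ler_norml in h1; have /andP[_ {}h1] := h1.
  have h3 : 2 * a * (n%:R * `|Y z - z| * `|z - z'|) <= n%:R * Q * `|z - z'|.
    rewrite mulrA ler_wpM2r// mulrCA ler_wpM2l//.
    by rewrite mulrC -ler_pdivlMr.
  have h1' := ler_wpM2l (ltW a0) h1; have h2' := ler_wpM2l (ltW a0) h2.
  clear h1 h2; move: (Y z - z) (z - z') h1' h2' h3 => D E h1' h2' h3.
  rewrite !dotE (dotC E D); lra.
have h1 : u x <= m x.
  by have := YP x x; rewrite subrr dot0 mulr0 subr0.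
have h2 : m y <= u y + e.
  have : m y <= u (Y y) by rewrite /m lerBlDr lerDl mulr_ge0 ?dot_ge0// ltW.
  move=> /le_trans; apply; rewrite -lerBlDl ltW// (le_lt_trans (ler_norm _))// dP//.
  rewrite (le_lt_trans (YQ y))// ltr_pdivrMr// /a.
  rewrite mulrCA [d * _]mulrC divfK ?gt_eqF//; lra.
have := mlip x y; lra.
Qed.

Lemma shifted_quad (R : realType) (n : nat) (a : R) (z y : 'rV[R]_n) :
  a * dot (y - z) (y - z) = quad a (- ((2 * a) *: z)) y + a * dot z z.
Proof. by rewrite /quad !dotE (dotC z y); ring. Qed.

(** The order of quantifiers is the point: [L] depends on the energy level [A] and not on [F], so
    one constant serves all discounted equations with [eps < 1]. *)
Lemma subsol_lipschitz (R : realType) (n : nat) (H : 'rV[R]_n -> 'rV[R]_n -> R)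
   (c : 'rV[R]_n) (A : R) :
  superlinear H -> exists2 L : R, 0 < L & forall (F : 'rV[R]_n -> R -> 'rV[R]_n -> R) u,
  continuous u -> Defs.periodic u -> visc_sub F u ->
  (forall x q, F x (u x) q <= 0 -> H x (c + q) <= A) ->
  forall x y, `|u x - u y| <= L * `|x - y|.
Proof.
move=> slH; have [Q Q0 QP] := ham_coercive A slH.
exists (n%:R * (Q + `|c|) + 1); first by rewrite ltr_wpDl// mulr_ge0// addr_ge0// ltW.
move=> F u cu pu subu FA x y.
apply: le_trans (lipschitz_of_test cu pu _ _ x y) _.
- exact: (ltr_wpDr (normr_ge0 c) Q0).
- move=> {}x z a a0 umax.
  have qE : (2 * a) *: (x - z) = - ((2 * a) *: z) + (2 * a) *: x.
    by rewrite scalerBr addrC.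
  have /FA/QP : F x (u x) ((2 * a) *: (x - z)) <= 0.
    rewrite qE; apply: (visc_sub_quad subu ltr01) => w _.
    by have := umax (x + w); rewrite !shifted_quad; lra.
  move=> H2; rewrite -[X in `|X| <= Q + _](addKr c).
  by rewrite (le_trans (ler_normD _ _))// normrN addrC lerD.
- by rewrite ler_wpM2r// lerDl.
Qed.

Lemma visc_sub_center (R : realType) (n : nat) (F : 'rV[R]_n -> R -> 'rV[R]_n -> R)
    (u : 'rV[R]_n -> R) (a : R) (x z : 'rV[R]_n) : visc_sub F u ->
  (forall w, u (x + w) - a * dot (x + w - z) (x + w - z) <= u x - a * dot (x - z) (x - z)) ->
  F x (u x) ((2 * a) *: (x - z)) <= 0.
Proof.
move=> subu umax.
have -> : (2 * a) *: (x - z) = - ((2 * a) *: z) + (2 * a) *: x by rewrite scalerBr addrC.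
apply: (visc_sub_quad subu ltr01) => w _.
by have := umax w; rewrite !shifted_quad; lra.
Qed.

Lemma visc_super_center (R : realType) (n : nat) (F : 'rV[R]_n -> R -> 'rV[R]_n -> R)
    (u : 'rV[R]_n -> R) (a : R) (x z : 'rV[R]_n) : visc_super F u ->
  (forall w, u x - a * dot (x - z) (x - z) <= u (x + w) - a * dot (x + w - z) (x + w - z)) ->
  0 <= F x (u x) ((2 * a) *: (x - z)).
Proof.
move=> subu umax.
have -> : (2 * a) *: (x - z) = - ((2 * a) *: z) + (2 * a) *: x by rewrite scalerBr addrC.
apply: (visc_super_quad subu ltr01) => w _.
by have := umax w; rewrite !shifted_quad; lra.
Qed.

(** * Semiconcavity and differentiability *)

(** The three-point functional in the variables [d = x - y] and [f = x + y - 2 z] ([semiconc_xyz]).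
    Integer translations then act on [x] alone and the penalties control [d] and [f], so a maximum
    exists by compactness. *)
Definition semiconc_functional (R : realType) (n : nat) (v : 'rV[R]_n -> R) (al K : R)
    (x d f : 'rV[R]_n) : R :=
  v x + v (x - d) - 2 * v (x - 2^-1 *: (d + f)) - al * dot f f - K * dot d d.

Lemma semiconc_max (R : realType) (n : nat) (v : 'rV[R]_n -> R) (al K : R) :
  continuous v -> Defs.periodic v -> 0 < al -> 0 < K ->
  exists x d f, forall x' d' f',
    semiconc_functional v al K x' d' f' <= semiconc_functional v al K x d f.
Proof.
move=> cv pv al0 K0; have [C C0 vC] := periodic_bound cv pv.
pose E := ('rV[R]_n * ('rV[R]_n * 'rV[R]_n))%type.
pose G (t : E) := semiconc_functional v al K t.1 t.2.1 t.2.2.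
pose r := (4 * C) / al + 1 + ((4 * C) / K + 1).
have r1 : 0 < (4 * C) / al + 1 by rewrite addr_gt0// divr_gt0// mulr_gt0.
have r2 : 0 < (4 * C) / K + 1 by rewrite addr_gt0// divr_gt0// mulr_gt0.
have r0 : 0 <= r by rewrite /r ltW// addr_gt0.
have cd : continuous (fun t : E => t.2.1) by exact: (cont_comp (@cont_snd _ _) (@cont_fst _ _)).
have cf : continuous (fun t : E => t.2.2) by exact: (cont_comp (@cont_snd _ _) (@cont_snd _ _)).
have cx : continuous (fun t : E => t.1) by exact: (@cont_fst _ _).
have cG : continuous G.
  rewrite /G /semiconc_functional.
  apply: cont_sub; last exact: (@cont_mulc R E K _ (@cont_sq R n E _ cd)).
  apply: cont_sub; last exact: (@cont_mulc R E al _ (@cont_sq R n E _ cf)).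
  apply: cont_sub.
    by apply: cont_add; [exact: (cont_comp cx cv)|apply: (cont_comp _ cv); exact: cont_sub].
  apply: cont_mulc; apply: (cont_comp _ cv); apply: cont_sub => //.
  by apply: cont_scale; exact: cont_add.
pose A : set E := [set x : 'rV[R]_n | forall i, 0 <= x 0 i <= 1] `*`
   ([set d : 'rV[R]_n | `|d| <= r] `*` [set f : 'rV[R]_n | `|f| <= r]).
have cA : compact A.
  apply: compact_setX; first exact: cube_compact.
  by apply: compact_setX; exact: ball_rV_compact.
have A0 : A (0, (0, 0)).
  split=> /=; first by move=> i; rewrite mxE lexx ler01.
  by split; rewrite /= normr0.
have [|[x [d f]] _ max] := @ex_max_on R E setT A G (0, (0, 0)) cA cG (fun _ _ => I) A0.
  move=> [x [d f]] _.
  have big : r < `|d| \/ r < `|f| -> G (x, (d, f)) <= G (0, (0, 0)).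
    move=> dfr.
    have {dfr} : 4 * C <= al * dot f f + K * dot d d.
      have d0 : 0 <= K * dot d d by rewrite mulr_ge0 ?dot_ge0// ltW.
      have f0 : 0 <= al * dot f f by rewrite mulr_ge0 ?dot_ge0// ltW.
      have C4 : 0 < 4 * C by rewrite mulr_gt0.
      case: dfr => hr.
        have := @ball_large R n K (4 * C) d K0 C4 (le_lt_trans _ hr); rewrite /r lerDr ltW// => /(_ isT); lra.
      have := @ball_large R n al (4 * C) f al0 C4 (le_lt_trans _ hr); rewrite /r lerDl ltW// => /(_ isT); lra.
    rewrite /G /semiconc_functional /= addr0 !subr0 scaler0 subr0 dot0.
    have := vC x; have := vC (x - d); have := vC (x - 2^-1 *: (d + f)); rewrite !ler_norml; lra.
  have [dr|dr] := ltP r `|d|; first by exists (0, (0, 0)) => //; apply: big; left.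
  have [fr|fr] := ltP r `|f|; first by exists (0, (0, 0)) => //; apply: big; right.
  have [k kP] := ex_shift_cube x.
  exists (x + intvec k, (d, f)); first by split.
  by rewrite /G /semiconc_functional /= pv ![x + intvec k - _]addrAC !pv.
by exists x, d, f => x' d' f'; exact: (max (x', (d', f')) I).
Qed.

Lemma semiconc_xyz (R : realType) (n : nat) (v : 'rV[R]_n -> R) (al K : R) (x y z : 'rV[R]_n) :
  semiconc_functional v al K x (x - y) (x + y - 2 *: z) =
  v x + v y - 2 * v z - al * dot (x + y - 2 *: z) (x + y - 2 *: z) - K * dot (x - y) (x - y).
Proof.
rewrite /semiconc_functional opprB (addrC x (y - x)) subrK.
congr (_ - 2 * v _ - _ - _).
by apply/rowP => i; rewrite !mxE; field.
Qed.

Lemma semiconcave_viscosity (R : realType) (n : nat) (H : 'rV[R]_n -> 'rV[R]_n -> R)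
    (c : 'rV[R]_n) (h : R) (v : 'rV[R]_n -> R) :
  (0 < n)%N -> periodic_ham H -> C2_ham H -> Hpp_posdef H -> superlinear H ->
  visc_sol_torus (cell_eq H c h) v ->
  exists2 K : R, 0 < K & forall m e, v (m + e) + v (m - e) - 2 * v m <= K * dot e e.
Proof.
move=> n0 pH C2 pd sl [cv [pv [subv supv]]].
have [L L0 /(_ _ v cv pv subv)LP] := subsol_lipschitz c h sl.
have {}LP : forall x y, `|v x - v y| <= L * `|x - y|.
  by apply: LP => x q; rewrite /cell_eq subr_le0.
have [Q Q0 QP] := ham_coercive h sl.
have [K K0 KP] := semiconcave_constant Q n0 C2 pH pd.
have [C C0 CP] := strip_lipschitz Q (ham_cdiff C2) (ham_xperiodic pH).
exists (4 * K); first by rewrite mulr_gt0.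
move=> m0 e0; rewrite leNgt; apply/negP => contra.
(* [mu] is the value of the functional at [m0 + e0], [m0 - e0], [m0]. There [x - y = 2 e0], whence
   the factor 4 in the semiconcavity constant. *)
pose mu := v (m0 + e0) + v (m0 - e0) - 2 * v m0 - 4 * K * dot e0 e0.
have mu0 : 0 < mu by rewrite /mu; lra.
pose B := Q + `|c|.
have B0 : 0 < B by rewrite ltr_pwDl.
(* Chosen for the final contradiction: [|f| <= dl / 2] gives [L |f| <= mu / 4] and
   [4 L^2 C |f| <= (mu / 2)^2 / 4]. With [al = B / dl], the bound [B] on the test gradient [2 al f]
   yields that smallness of [f]. *)
pose dl := Num.min (mu / (2 * L)) ((mu / 2) ^+ 2 / (8 * L ^+ 2 * C)).
have dl0 : 0 < dl.
  by rewrite /dl lt_min !divr_gt0// ?exprn_gt0 ?divr_gt0 ?mulr_gt0// exprn_gt0.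
pose al := B / dl.
have al0 : 0 < al by rewrite divr_gt0.
have [x [d [f max]]] := semiconc_max cv pv al0 K0.
pose y := x - d; pose z := x - 2^-1 *: (d + f).
have yE : y = x - d by []. have zE : z = x - 2^-1 *: (d + f) by [].
have dE : d = x - y by rewrite /y; apply/rowP => i; rewrite !mxE; ring.
have fE : f = x + y - 2 *: z.
  by rewrite /z /y; apply/rowP => i; rewrite !mxE; field.
clearbody y z.
have Max x' y' z' :
  v x' + v y' - 2 * v z' - al * dot (x' + y' - 2 *: z') (x' + y' - 2 *: z') - K * dot (x' - y') (x' - y')
  <= v x + v y - 2 * v z - al * dot f f - K * dot d d.
  rewrite -semiconc_xyz; apply: le_trans (max _ _ _) _.
  by rewrite {1}dE {1}fE semiconc_xyz -dE -fE.
(* The test gradients are [P + 4 K e] at [x], [P - 4 K e] at [y] and [P] at [z]: their momenta are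
   the two ends and the midpoint of a segment. *)
pose e := 2^-1 *: d; pose P := (2 * al) *: f.
have Kd : (4 * K) *: e = (2 * K) *: d.
  by rewrite /e scalerA; congr (_ *: _); field.
have subx : H x (c + (P + (4 * K) *: e)) <= h.
  have := @visc_sub_quad R n _ v (al + K) ((2 * al) *: (y - 2 *: z) - (2 * K) *: y) x 1 subv ltr01.
  have -> : (2 * al) *: (y - 2 *: z) - (2 * K) *: y + (2 * (al + K)) *: x = P + (4 * K) *: e.
    rewrite Kd /P fE dE; apply/rowP => i; rewrite !mxE; ring.
  rewrite /cell_eq subr_le0; apply => w _.
  have := Max (x + w) y z; rewrite fE dE /quad.
  have -> : x + w + y - 2 *: z = x + w + (y - 2 *: z) by apply/rowP => i; rewrite !mxE; ring.
  have -> : x + y - 2 *: z = x + (y - 2 *: z) by apply/rowP => i; rewrite !mxE; ring.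
  move: (y - 2 *: z) => Y; rewrite !dotE (dotC w x) (dotC Y x) (dotC Y w) (dotC y w) (dotC y x).
  lra.
have suby : H y (c + (P - (4 * K) *: e)) <= h.
  have := @visc_sub_quad R n _ v (al + K) ((2 * al) *: (x - 2 *: z) - (2 * K) *: x) y 1 subv ltr01.
  have -> : (2 * al) *: (x - 2 *: z) - (2 * K) *: x + (2 * (al + K)) *: y = P - (4 * K) *: e.
    rewrite Kd /P fE dE; apply/rowP => i; rewrite !mxE; ring.
  rewrite /cell_eq subr_le0; apply => w _.
  have := Max x (y + w) z; rewrite fE dE /quad.
  have -> : x + (y + w) - 2 *: z = y + w + (x - 2 *: z) by apply/rowP => i; rewrite !mxE; ring.
  have -> : x + y - 2 *: z = y + (x - 2 *: z) by apply/rowP => i; rewrite !mxE; ring.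
  move: (x - 2 *: z) => Y; rewrite !dotE (dotC w y) (dotC Y y) (dotC Y w) (dotC x w) (dotC x y).
  lra.
have supz : h <= H z (c + P).
  have := @visc_super_quad R n _ v (- (2 * al)) ((2 * al) *: (x + y)) z 1 supv ltr01.
  have -> : (2 * al) *: (x + y) + (2 * - (2 * al)) *: z = P.
    rewrite /P fE; apply/rowP => i; rewrite !mxE; ring.
  rewrite /cell_eq subr_ge0; apply => w _.
  have := Max x y (z + w); rewrite fE dE /quad.
  move: (x + y) (x - y) => Y X; rewrite !dotE (dotC w z) (dotC Y z) (dotC Y w).
  lra.
have QA := QP _ _ subx; have QB := QP _ _ suby.
(* Both end momenta lie in the ball of radius [Q] by coercivity, and the ball is convex; the
   constants [K] and [C] are thus valid along the whole segment. *)
have Qt (t : R) : `|t| <= 1 -> `|c + P + t *: ((4 * K) *: e)| <= Q.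
  rewrite ler_norml => /andP[t1 t2].
  have -> : c + P + t *: ((4 * K) *: e) =
     ((1 + t) / 2) *: (c + (P + (4 * K) *: e)) + ((1 - t) / 2) *: (c + (P - (4 * K) *: e)).
    by apply/rowP => i; rewrite !mxE; field.
  rewrite (le_trans (ler_normD _ _))// !normrZ !ger0_norm ?divr_ge0//; try lra.
  have := ler_wpM2l (_ : 0 <= (1 + t) / 2) QA; have := ler_wpM2l (_ : 0 <= (1 - t) / 2) QB; lra.
have QP0 : `|c + P| <= Q by have := Qt 0; rewrite normr0 scale0r addr0; apply; exact: ler01.
have fsmall : `|f| <= dl / 2.
  have : `|P| <= B.
    by rewrite -[P](addKr c) (le_trans (ler_normD _ _))// normrN addrC lerD.
  have al2 : 0 < 2 * al by rewrite mulr_gt0.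
  have dl2 : 0 < dl / 2 by rewrite divr_gt0.
  rewrite /P normrZ (gtr0_norm al2) /al.
  have -> : 2 * (B / dl) * `|f| = B * (`|f| / (dl / 2)) by field; rewrite gt_eqF.
  by rewrite -[X in _ <= X]mulr1 (ler_pM2l B0) (ler_pdivrMr _ _ dl2) mul1r.
pose m := x - e.
have xm : x = m + e by rewrite /m subrK.
have ym : y = m - e.
  by rewrite /m /e yE; apply/rowP => i; rewrite !mxE; field.
have zm : z = m - 2^-1 *: f.
  by rewrite zE /m /e; apply/rowP => i; rewrite !mxE; field.
have low : `|e| ^+ 2 <= H x (c + P + (4 * K) *: e) + H y (c + P - (4 * K) *: e) - 2 * H m (c + P).
  have := @derive_second_lower R _ (Hz H) (m, c + P) (e, (4 * K) *: e) (`|e| ^+ 2)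
    (ham_cdiff C2 _).1 (ham_cdiff2 _ C2 _).1.
  rewrite xm ym; apply => t t1.
  exact: (KP _ _ e (Qt t t1)).
have mz : H z (c + P) - H m (c + P) <= C * (`|f| / 2).
  have := CP (z, c + P) (m, c + P) QP0 QP0; rewrite /Hz /= => /(le_trans (ler_norm _))/le_trans; apply.
  apply: ler_wpM2l; first exact: ltW.
  have -> : (z, c + P) - (m, c + P) = (- (2^-1 *: f), 0) :> phase.
    by congr pair => /=; rewrite ?subrr// zm addrAC subrr add0r.
  have i2 : 0 < 2^-1 :> R by rewrite invr_gt0.
  rewrite prod_normE/= normr0 normrN normrZ (gtr0_norm i2) max_l; last by rewrite mulr_ge0// ltW.
  by rewrite mulrC.
(* [H] is at most [h] at both ends and at least [h] at [(z, c + P)]. Since [z] is only [f / 2] away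
   from the midpoint [m], the second difference of [H] is at most [C |f|]. *)
have eC : `|e| ^+ 2 <= C * `|f| by move: subx suby; rewrite !addrA => ? ?; lra.
have i2 : 0 < 2^-1 :> R by rewrite invr_gt0.
(* The maximum is at least [mu]. Dropping the penalties and using the Lipschitz bound of [v] shows
   that [e] and [f] cannot both be small, against [eC] and the choice of [dl]. *)
have mule : mu <= 2 * L * `|e| + L * `|f|.
  have := Max (m0 + e0) (m0 - e0) m0.
  have -> : m0 + e0 + (m0 - e0) - 2 *: m0 = 0 by apply/rowP => i; rewrite !mxE; ring.
  have -> : m0 + e0 - (m0 - e0) = 2 *: e0 by apply/rowP => i; rewrite !mxE; ring.
  rewrite dot0 !dotE.
  have : 0 <= al * dot f f by rewrite mulr_ge0 ?dot_ge0// ltW.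
  have : 0 <= K * dot d d by rewrite mulr_ge0 ?dot_ge0// ltW.
  have vxz : v x - v z <= L * (`|e| + `|f| / 2).
    apply: le_trans (ler_norm _) _; apply: le_trans (LP x z) _; apply: ler_wpM2l; first exact: ltW.
    have -> : x - z = e + 2^-1 *: f by rewrite xm zm; apply/rowP => i; rewrite !mxE; ring.
    by rewrite (le_trans (ler_normD _ _))// lerD2l normrZ (gtr0_norm i2) mulrC.
  have vyz : v y - v z <= L * (`|e| + `|f| / 2).
    apply: le_trans (ler_norm _) _; apply: le_trans (LP y z) _; apply: ler_wpM2l; first exact: ltW.
    have -> : y - z = - e + 2^-1 *: f by rewrite ym zm; apply/rowP => i; rewrite !mxE; ring.
    by rewrite (le_trans (ler_normD _ _))// normrN lerD2l normrZ (gtr0_norm i2) mulrC.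
  rewrite /mu; lra.
have f1 : `|f| <= mu / (2 * L) / 2.
  by rewrite (le_trans fsmall)// ler_wpM2r ?invr_ge0// /dl ge_min lexx.
have f2 : `|f| <= (mu / 2) ^+ 2 / (8 * L ^+ 2 * C) / 2.
  by rewrite (le_trans fsmall)// ler_wpM2r ?invr_ge0// /dl ge_min lexx orbT.
have Lf : L * `|f| <= mu / 4.
  have := ler_wpM2l (ltW L0) f1.
  by rewrite (_ : L * (mu / (2 * L) / 2) = mu / 4)//; field; rewrite gt_eqF.
have Cf : 4 * L ^+ 2 * (C * `|f|) <= (mu / 2) ^+ 2 / 4.
  have := ler_wpM2l (_ : 0 <= 4 * L ^+ 2 * C) f2.
  rewrite (_ : 4 * L ^+ 2 * C * ((mu / 2) ^+ 2 / (8 * L ^+ 2 * C) / 2) = (mu / 2) ^+ 2 / 4); last first.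
    by field; rewrite !gt_eqF.
  by rewrite mulrA; apply; rewrite mulr_ge0 ?ltW// mulr_gt0// exprn_gt0.
have h1 : mu / 2 <= 2 * L * `|e| by lra.
have h2 : (mu / 2) ^+ 2 <= (2 * L * `|e|) ^+ 2.
  by rewrite !expr2; apply: ler_pM => //; lra.
have h3 : (2 * L * `|e|) ^+ 2 <= 4 * L ^+ 2 * (C * `|f|).
  have -> : (2 * L * `|e|) ^+ 2 = 4 * L ^+ 2 * `|e| ^+ 2 by ring.
  by rewrite ler_wpM2l// mulr_ge0// sqr_ge0.
have h4 : 0 < (mu / 2) ^+ 2 by rewrite exprn_gt0// divr_gt0.
lra.
Qed.

(** A steep paraboloid centred at [x] and opening downwards touches [v] from below at some nearby
    [y]. Semiconcavity converts the lower bound at [- w] into an upper bound at [w], so [v] lies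
    between two paraboloids with the same tangent at [y]. *)
Lemma dense_differentiable (R : realType) (n : nat) (v : 'rV[R]_n -> R) (K : R) :
  continuous v -> Defs.periodic v -> 0 < K ->
  (forall m e, v (m + e) + v (m - e) - 2 * v m <= K * dot e e) ->
  forall (x : 'rV[R]_n) (r : R), 0 < r -> exists2 y, `|y - x| < r & differentiable v y.
Proof.
move=> cv pv K0 sc x r r0.
have [C C0 vC] := periodic_bound cv pv.
have cNv : continuous (fun y => - v y) by apply: (cont_comp cv); exact: opp_continuous.
have pNv : Defs.periodic (fun y => - v y) by move=> y k; rewrite pv.
(* The touching point satisfies [a |y - x|^2 <= 2 C < a r^2], which places it in the ball of radius
   [r]. *)
pose a := 2 * C / r ^+ 2 + 1.
have a0 : 0 < a by rewrite ltr_wpDl// divr_ge0 ?sqr_ge0// mulr_ge0// ltW.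
have [y ymax] := ex_max_quad x cNv pNv a0.
exists y.
  have := ymax x; rewrite subrr dot0 mulr0 subr0.
  have := dot_ge (y - x) => /(ler_wpM2l (ltW a0)) h1 h2.
  have h3 : a * `|y - x| ^+ 2 <= 2 * C.
    by have := vC x; have := vC y; rewrite !ler_norml; lra.
  have h4 : a * r ^+ 2 = 2 * C + r ^+ 2.
    by rewrite /a mulrDl mul1r divfK// gt_eqF// exprn_gt0.
  rewrite ltNge; apply/negP => ry.
  have h5 : r ^+ 2 <= `|y - x| ^+ 2 by rewrite !expr2; apply: ler_pM => //; exact: ltW.
  have h6 := ler_wpM2l (ltW a0) h5.
  have h7 : 0 < r ^+ 2 by exact: exprn_gt0.
  lra.
pose p := (- (2 * a)) *: (y - x).
have lin : linear (dot p) by move=> k u w; rewrite dotDr dotZr.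
have [L LE] := ex_linear lin.
suff [] : differentiable v y /\ 'd v y = L :> ('rV[R]_n -> R) by [].
apply: differentiable_normP; first by rewrite LE; exact: dot_continuous.
move=> e e0.
have low w : dot p w - a * dot w w <= v (y + w) - v y.
  have := ymax (y + w); rewrite (addrAC y w) /p; move: (y - x) => Y.
  rewrite !dotE (dotC w Y); lra.
clearbody p.
pose A := (a + K) * n%:R.
have A0 : 0 <= A by rewrite mulr_ge0// addr_ge0// ltW.
exists (e / (A + 1)); first by rewrite divr_gt0// ltr_wpDl.
move=> w wd; rewrite LE.
have h1 := low w; have := low (- w); rewrite !dotE => h2; have h3 := sc y w.
have : `|v (y + w) - v y - dot p w| <= (a + K) * dot w w.
  have := dot_ge0 w => /(mulr_ge0 (ltW K0)); have := dot_ge0 w => /(mulr_ge0 (ltW a0)).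
  rewrite ler_norml; lra.
move=> /le_trans; apply.
apply: (@le_trans _ _ (A * `|w| ^+ 2)).
  by rewrite /A -mulrA ler_wpM2l ?dot_le// addr_ge0// ltW.
rewrite expr2 mulrA ler_wpM2r//.
move: wd; rewrite ltr_pdivlMr ?ltr_wpDl// => wd.
apply: le_trans (ltW wd); rewrite mulrC ler_wpM2l// lerDl//.
Qed.

(** [v] itself is not an admissible test function. Adding [M |w|^2] to [v (x + w) - p.w] produces an
    interior local minimum near [x], where a quadratic test has gradient [p - 2 M w], close to [p];
    continuity of [H] gives the inequality in the limit. *)
Lemma visc_super_differentiable (R : realType) (n : nat) (H : 'rV[R]_n -> 'rV[R]_n -> R)
    (c : 'rV[R]_n) (h : R) (v : 'rV[R]_n -> R) (x : 'rV[R]_n) :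
  periodic_ham H -> C2_ham H -> continuous v -> visc_super (cell_eq H c h) v ->
  differentiable v x -> h <= H x (c + \row_i (('d v x : 'rV[R]_n -> R) (ev i))).
Proof.
move=> pH C2 cv supv dv; set p := \row_i _.
have dE w : ('d v x : 'rV[R]_n -> R) w = dot p w.
  rewrite {1}((rV_finspan R n).1 w) linear_sum /dot; apply: eq_bigr => i _.
  by rewrite linearZ mxE mulrC.
have [C C0 CP] := strip_lipschitz (`|c + p| + 2) (ham_cdiff C2) (ham_xperiodic pH).
apply: (@ler_eps_scale _ _ _ (2 * C)); first by rewrite mulr_gt0.
move=> e0 e00; pose e := Num.min e0 1.
have e1 : e <= 1 by rewrite ge_min lexx orbT.
have ee0 : e <= e0 by rewrite ge_min lexx.
have e_gt0 : 0 < e by rewrite lt_min e00 ltr01.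
have [d d0 dP] := differentiable_norm dv e_gt0.
pose r := Num.min (d / 2) e.
have rd : r < d by rewrite gt_min ltr_pdivrMr// ltr_pMr// ltr1n.
have re : r <= e by rewrite ge_min lexx orbT.
have r0 : 0 < r by rewrite lt_min divr_gt0.
(* Differentiability gives [M |w| <= e] at the minimum, whereas [M r = 2 e] on the boundary: the
   minimum is interior and the gradient moves by at most [2 e]. *)
pose M := 2 * e / r.
have M0 : 0 < M by rewrite divr_gt0// mulr_gt0.
pose G w := - (v (x + w) - dot p w + M * dot w w).
have cG : continuous G.
  apply: (@cont_comp _ _ _ (fun w => v (x + w) - dot p w + M * dot w w) -%R); last exact: opp_continuous.
  apply: cont_add; last by apply: cont_mulc; exact: sq_continuous.
  apply: cont_sub; last exact: dot_continuous.
  by apply: (cont_comp _ cv); apply: cont_add; [exact: cont_cst|exact: (fun x => cvg_id)].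
have [||w /= wr wmax] := @ex_max_on R _ [set w : 'rV[R]_n | `|w| <= r] [set w | `|w| <= r]
    G 0 (@ball_rV_compact R n r (ltW r0)) cG (fun _ => id).
- by rewrite /= normr0 ltW.
- by move=> w wr; exists w.
have wsmall : M * `|w| <= e.
  have [->|w0] := eqVneq w 0; first by rewrite normr0 mulr0 ltW.
  have nw : 0 < `|w| by rewrite normr_gt0.
  have := wmax 0; rewrite /= normr0 ltW// => /(_ isT).
  rewrite /G addr0 dot0 mulr0 dotC dot0.
  have := dP w (le_lt_trans wr rd); rewrite dE ler_norml => /andP[h1 _].
  have := ler_wpM2l (ltW M0) (dot_ge w) => h2 h3.
  by rewrite -(ler_pM2r nw) -mulrA -expr2; lra.
have w2 : `|w| < r.
  have : M * `|w| < M * r.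
    rewrite (le_lt_trans wsmall)// /M divfK ?gt_eqF//; lra.
  by rewrite ltr_pM2l.
have Mw : `|(2 * M) *: w| <= 2 * e.
  have M2 : 0 < 2 * M by rewrite mulr_gt0.
  by rewrite normrZ (gtr0_norm M2) -mulrA ler_pM2l.
have rw0 : 0 < r - `|w| by rewrite subr_gt0.
have loc w' : `|w'| < r - `|w| -> v (x + w) - quad (- M) (p + (2 * M) *: x) (x + w) <=
    v (x + w + w') - quad (- M) (p + (2 * M) *: x) (x + w + w').
  move=> w'r; have ww : `|w + w'| <= r.
    by rewrite (le_trans (ler_normD _ _))// -lerBrDl ltW.
  have := wmax (w + w') ww; rewrite /G addrA.
  rewrite /quad !dotE (dotC w' w) (dotC w' x) (dotC w x); lra.
have pE : c + (p + (2 * M) *: x + (2 * - M) *: (x + w)) = c + p - (2 * M) *: w.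
  by apply/rowP => i; rewrite !mxE; ring.
have := visc_super_quad supv rw0 loc; rewrite /cell_eq subr_ge0 pE => h1.
have b1 : `|c + p - (2 * M) *: w| <= `|c + p| + 2.
  rewrite (le_trans (ler_normD _ _))// normrN lerD2l (le_trans Mw)//; lra.
have b2 : `|c + p| <= `|c + p| + 2 by rewrite lerDl.
have := CP (x + w, c + p - (2 * M) *: w) (x, c + p) b1 b2; rewrite /Hz /=.
move=> /(le_trans (ler_norm _)) h2.
have h3 : `|(x + w, c + p - (2 * M) *: w) - (x, c + p)| <= 2 * e0.
  have -> : (x + w, c + p - (2 * M) *: w) - (x, c + p) = (w, - ((2 * M) *: w)) :> phase.
    by congr pair => /=; rewrite addrAC subrr add0r.
  rewrite prod_normE/= normrN ge_max; apply/andP; split; lra.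
have := ler_wpM2l (ltW C0) h3.
lra.
Qed.

(** * The discounted solution *)

Lemma doubling_max (R : realType) (n : nat) (v u : 'rV[R]_n -> R) (al : R) :
  continuous v -> Defs.periodic v -> continuous u -> Defs.periodic u -> 0 < al ->
  exists x d, forall x' d',
    v x' - u (x' - d') - al * dot d' d' <= v x - u (x - d) - al * dot d d.
Proof.
move=> cv pv cu pu al0.
have [C C0 vC] := periodic_bound cv pv; have [C' C'0 uC] := periodic_bound cu pu.
pose E := ('rV[R]_n * 'rV[R]_n)%type.
pose G (t : E) := v t.1 - u (t.1 - t.2) - al * dot t.2 t.2.
have CC : 0 < 2 * (C + C') by rewrite mulr_gt0// addr_gt0.
pose r := 2 * (C + C') / al + 1.
have r0 : 0 <= r by rewrite addr_ge0// ltW// divr_gt0.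
have cd : continuous (fun t : E => t.2) by exact: (@cont_snd _ _).
have cx : continuous (fun t : E => t.1) by exact: (@cont_fst _ _).
have cG : continuous G.
  apply: cont_sub; last exact: (@cont_mulc R E al _ (@cont_sq R n E _ cd)).
  apply: cont_sub; first exact: (@cont_comp _ _ _ _ _ cx cv).
  by apply: (@cont_comp _ _ _ (fun t : E => t.1 - t.2) u); [exact: cont_sub|exact: cu].
pose A : set E := [set x : 'rV[R]_n | forall i, 0 <= x 0 i <= 1] `*`
   [set d : 'rV[R]_n | `|d| <= r].
have cA : compact A by apply: compact_setX; [exact: cube_compact|exact: ball_rV_compact].
have A0 : A (0, 0).
  by split=> /=; [move=> i; rewrite mxE lexx ler01|rewrite normr0].
have dom t : setT t -> exists2 t', A t' & G t <= G t'.
  case: t => x d _; have [dr|dr] := leP `|d| r.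
    have [k kP] := ex_shift_cube x; exists (x + intvec k, d); first by split.
    by rewrite /G /= pv (addrAC x) pu.
  exists (0, 0) => //; have := ball_large al0 CC dr.
  rewrite /G /= subr0 dot0.
  have := vC x; have := vC 0; have := uC (x - d); have := uC 0; rewrite !ler_norml; lra.
have [[x d] _ max] := @ex_max_on R E setT A G (0, 0) cA cG (fun _ _ => I) A0 dom.
by exists x, d => x' d'; exact: (max (x', d') I).
Qed.

(** At a maximum of [v x - u y - al |x - y|^2] both equations see the same momentum, so subtracting
    them leaves [eps * u y >= - C |x - y|]. The weight [al] may depend on [eps], which makes the
    right side at least [- eps * e]; comparing with other points costs the oscillation [2 V] of
    [v]. *)
Lemma discounted_lower_bound (R : realType) (n : nat) (H : 'rV[R]_n -> 'rV[R]_n -> R)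
    (c : 'rV[R]_n) (h : R) (v : 'rV[R]_n -> R) :
  periodic_ham H -> C2_ham H -> superlinear H ->
  visc_sol_torus (cell_eq H c h) v ->
  exists2 A : R, 0 < A & forall eps u, 0 < eps ->
    visc_sol_torus (discounted_eq H c h eps) u -> forall x, - A <= u x.
Proof.
move=> pH C2 sl [cv [pv [subv _]]].
have [V V0 vV] := periodic_bound cv pv.
have [Q Q0 QP] := ham_coercive h sl.
have [C C0 CP] := strip_lipschitz Q (ham_cdiff C2) (ham_xperiodic pH).
exists (2 * V); first by rewrite mulr_gt0.
move=> eps u eps0 [cu [pu [_ supu]]] x'.
rewrite lerNl; apply/ler_addgt0Pr => e e0.
pose B := Q + `|c|.
have B0 : 0 < B by rewrite ltr_pwDl.
pose dl := eps * e / C.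
have dl0 : 0 < dl by rewrite divr_gt0// mulr_gt0.
pose al := B / (2 * dl).
have al0 : 0 < al by rewrite divr_gt0// mulr_gt0.
have [x [d max]] := doubling_max cv pv cu pu al0.
have [y yE] : exists y, y = x - d by eexists.
have dE : d = x - y by rewrite yE opprB (addrC x) subrK.
have subx : H x (c + (2 * al) *: d) <= h.
  have := @visc_sub_center R n _ v al x y subv; rewrite -dE /cell_eq subr_le0; apply => w.
  have := max (x + w) (x + w - y).
  rewrite -yE dE opprB (addrC (x + w)) subrK; lra.
have supy : h <= eps * u y + H y (c + (2 * al) *: d).
  have qE : (2 * - al) *: (y - x) = (2 * al) *: d.
    by rewrite dE; apply/rowP => i; rewrite !mxE; ring.
  have : 0 <= discounted_eq H c h eps y (u y) ((2 * - al) *: (y - x)).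
    apply: (visc_super_center supu) => w.
    have := max x (x - (y + w)).
    have -> : x - (x - (y + w)) = y + w by apply/rowP => i; rewrite !mxE; ring.
    rewrite -yE dE.
    have -> : y + w - x = - (x - (y + w)) by rewrite opprB.
    have -> : y - x = - (x - y) by rewrite opprB.
    rewrite ![dot (- _) _]dotNl ![dot _ (- _)]dotNr; lra.
  by rewrite qE /discounted_eq; lra.
have QA := QP _ _ subx.
have dsmall : `|d| <= dl.
  have : `|(2 * al) *: d| <= B.
    by rewrite -[(2 * al) *: d](addKr c) (le_trans (ler_normD _ _))// normrN addrC lerD.
  have al2 : 0 < 2 * al by rewrite mulr_gt0.
  rewrite normrZ (gtr0_norm al2) /al.
  have -> : 2 * (B / (2 * dl)) * `|d| = B * (`|d| / dl) by field; rewrite gt_eqF.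
  by rewrite -[X in _ <= X]mulr1 (ler_pM2l B0) (ler_pdivrMr _ _ dl0) mul1r.
have := CP (y, c + (2 * al) *: d) (x, c + (2 * al) *: d) QA QA; rewrite /Hz /=.
have -> : (y, c + (2 * al) *: d) - (x, c + (2 * al) *: d) = (- d, 0) :> phase.
  by congr pair => /=; rewrite ?subrr// dE opprB.
rewrite prod_normE/= normr0 normrN max_l// ler_norml => /andP[_ HH].
have h1 : C * `|d| <= eps * e.
  by have := ler_wpM2l (ltW C0) dsmall; rewrite (_ : C * dl = eps * e)// /dl; field; rewrite gt_eqF.
have h2 : - e <= u y.
  rewrite -(ler_pM2l eps0); lra.
have := max x' 0; rewrite subr0 dot0 -yE.
have := vV x; have := vV x'; have : 0 <= al * dot d d by rewrite mulr_ge0 ?dot_ge0// ltW.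
rewrite !ler_norml; lra.
Qed.

Lemma is_derive_fst (R : realType) (U V : normedModType R) (f : R -> U * V) (s : R) (d : U * V) :
  is_derive s (1 : R) f d -> is_derive s (1 : R) (fun t => (f t).1) d.1.
Proof.
move=> [df <-].
have C : (fun h : R => h^-1 *: ((((fun t => (f t).1)) \o shift s) (h *: (1 : R)) - (f s).1)) @ 0^' -->
    ('D_1 f s).1.
  exact: (cvg_comp _ _ df (@cont_fst _ _ ('D_1 f s))).
by split; [apply/cvg_ex; eexists; exact: C|exact/cvg_lim].
Qed.

Lemma is_derive_curve (R : realType) (V : normedModType R) (f : V -> R) (X : R -> V)
    (s : R) (d : V) : differentiable f (X s) -> is_derive s (1 : R) X d ->
  is_derive s (1 : R) (fun t => f (X t)) (('d f (X s) : V -> R) d).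
Proof.
move=> df [dX <-].
have dX' : differentiable X s by exact/derivable1_diffP.
have dc : differentiable (f \o X) s by exact: differentiable_comp.
split; first exact/derivable1_diffP.
rewrite (deriveE _ dc) diff_comp//=; congr ('d f (X s) _).
by rewrite deriveE.
Qed.

(** One-sided, because the maximum in [trajectory_growth] may be attained at the final time. *)
Lemma left_min_derive_le0 (R : realType) (g : R -> R) (s d : R) :
  is_derive s (1 : R) g d -> 0 < s -> (forall t, 0 <= t <= s -> g s <= g t) -> d <= 0.
Proof.
move=> [dg gd] s0 gmin.
have dg' : differentiable g s by exact/derivable1_diffP.
apply/ler_addgt0Pr => e e0; rewrite add0r.
have [r r0 rP] := differentiable_norm dg' e0.
pose t := Num.min (r / 2) s.
have t0 : 0 < t by rewrite lt_min divr_gt0.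
have tr : `|- t| < r by rewrite normrN gtr0_norm// gt_min ltr_pdivrMr// ltr_pMr// ltr1n.
have := rP _ tr; rewrite normrN (gtr0_norm t0).
have -> : ('d g s : R -> R) (- t) = - t * d.
  by rewrite (deriv1E dg) derive1E gd.
have : g s <= g (s - t) by apply: gmin; rewrite subr_ge0 gerBl (ltW t0) andbT ge_min lexx orbT.
move=> h1 /(le_trans (ler_norm _)) h2.
by rewrite -(ler_pM2l t0); lra.
Qed.

(** As [u] has no derivative along the orbit, it is evaluated at [X s + f] with a penalty on [f]. At
    a maximum with [s > 0], differentiating the smooth remainder in time and using convexity of [H]
    gives [h + kap <= H (X s) q], where [q = c + 2 al f] is the test momentum of the subsolution
    [u]. The equation of [u] allows only [h + eps * A] plus a small error, so the maximum sits at
    time 0. *)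
Lemma trajectory_growth (R : realType) (n : nat) (H : 'rV[R]_n -> 'rV[R]_n -> R)
    (c : 'rV[R]_n) (h eps A : R) (v u : 'rV[R]_n -> R) (gamma : R -> phase) :
  periodic_ham H -> C2_ham H -> Hpp_posdef H -> superlinear H ->
  visc_sol_torus (cell_eq H c h) v -> 0 < eps ->
  visc_sol_torus (discounted_eq H c h eps) u -> (forall x, - A <= u x) ->
  ham_traj H gamma -> (forall s, graph_dv c v (gamma s)) ->
  forall T, 0 <= T ->
  u (gamma T).1 - v (gamma T).1 <= u (gamma 0).1 - v (gamma 0).1 + eps * A * T.
Proof.
move=> pH C2 pd sl [cv [pv [_ supv]]] eps0 [cu [pu [subu _]]] uA traj graph T T0.
have [Q Q0 QP] := ham_coercive (h + eps * A) sl.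
have [L L0 LP] := subsol_lipschitz c (h + eps * A) sl.
have epsA x : - (eps * A) <= eps * u x by rewrite -mulrN ler_pM2l.
have {}LP : forall x y, `|u x - u y| <= L * `|x - y|.
  apply: (LP _ _ cu pu subu) => x q; rewrite /discounted_eq; have := epsA x; lra.
have [C C0 CP] := strip_lipschitz Q (ham_cdiff C2) (ham_xperiodic pH).
have [Cu Cu0 uC] := periodic_bound cu pu.
apply/ler_addgt0Pr => e e0.
(* Excess slope in [kap] that makes the contradiction strict; over the time [T] it costs at most
   [e / 2]. *)
pose sg := e / (2 * (T + 1)).
have T1 : 0 < T + 1 by rewrite ltr_wpDl.
have sg0 : 0 < sg by rewrite divr_gt0// mulr_gt0.
have sgT : sg * T <= e / 2.
  rewrite /sg (_ : e / (2 * (T + 1)) * T = e / 2 * (T / (T + 1))); last by field; rewrite gt_eqF.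
  by rewrite ler_piMr// ?ler_pdivrMr ?mul1r ?lerDl// ltW// divr_gt0.
pose kap := eps * A + sg.
pose B := Q + `|c|.
have B0 : 0 < B by rewrite ltr_pwDl.
(* With [|f| <= dl], moving [u] from [X s + f] to [X s] costs at most [e / 2], and moving [H] costs
   at most half of [sg]. *)
pose dl := Num.min (e / (2 * L)) (sg / (2 * C)).
have dl0 : 0 < dl by rewrite lt_min !divr_gt0// mulr_gt0.
pose al := B / (2 * dl).
have al0 : 0 < al by rewrite divr_gt0// mulr_gt0.
have al2 : 0 < 2 * al by rewrite mulr_gt0.
pose X s := (gamma s).1.
have dgam s : is_derive s (1 : R) gamma (ham_field H (gamma s)).
  by have [? <-] := traj s; exact/derivableP.
have dX s : is_derive s (1 : R) X (ham_field H (gamma s)).1 by exact: is_derive_fst.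
have cX : continuous X.
  by move=> s; apply: differentiable_continuous; apply/derivable1_diffP; case: (dX s).
pose E := (R * 'rV[R]_n)%type.
pose G (t : E) := u (X t.1 + t.2) - v (X t.1) - kap * t.1 - al * dot t.2 t.2.
have c1 : continuous (fun t : E => t.1) by exact: (@cont_fst _ _).
have c2 : continuous (fun t : E => t.2) by exact: (@cont_snd _ _).
have cX1 : continuous (fun t : E => X t.1) by exact: (@cont_comp _ _ _ _ _ c1 cX).
have cG : continuous G.
  apply: cont_sub; last exact: (@cont_mulc R E al _ (@cont_sq R n E _ c2)).
  apply: cont_sub; last exact: (@cont_mulc R E kap _ c1).
  apply: cont_sub; last exact: (@cont_comp _ _ _ _ _ cX1 cv).
  apply: (@cont_comp _ _ _ (fun t : E => X t.1 + t.2) u); last exact: cu.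
  exact: cont_add.
pose r := 2 * Cu / al + 1.
have r0 : 0 <= r by rewrite addr_ge0// ltW// divr_gt0// mulr_gt0.
pose K : set E := `[0, T]%classic `*` [set f : 'rV[R]_n | `|f| <= r].
pose D : set E := [set t | 0 <= t.1 <= T].
have cK : compact K by apply: compact_setX; [exact: segment_compact|exact: ball_rV_compact].
have KD : K `<=` D by move=> [s f] [/=]; rewrite /D /= in_itv.
have K0 : K (0, 0) by split=> /=; rewrite ?in_itv/= ?lexx// normr0.
have dom t : D t -> exists2 t', K t' & G t <= G t'.
  case: t => s f; rewrite /D /= => sT; have [fr|fr] := leP `|f| r.
    by exists (s, f) => //; split => //=; rewrite in_itv.
  exists (s, 0); first by split=> /=; rewrite ?in_itv//= normr0.
  have := ball_large al0 (mulr_gt0 (ltr0Sn R 1) Cu0) fr.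
  rewrite /G /= dot0; have := uC (X s + f); have := uC (X s + 0); rewrite !ler_norml; lra.
have [[s f] Ksf max] := ex_max_on cK cG KD K0 dom.
have sT : 0 <= s <= T by case: Ksf; rewrite /= in_itv.
have {}max s' f' : 0 <= s' <= T ->
    u (X s' + f') - v (X s') - kap * s' - al * dot f' f' <=
    u (X s + f) - v (X s) - kap * s - al * dot f f by move=> ?; exact: (max (s', f')).
have [y yE] : exists y, y = X s + f by eexists.
have fE : f = y - X s by rewrite yE addrC addKr.
have suby : eps * u y + H y (c + (2 * al) *: f) <= h.
  have := @visc_sub_center R n _ u al y (X s) subu; rewrite -fE /discounted_eq => Y.
  suff : eps * u y + H y (c + (2 * al) *: f) - h <= 0 by lra.
  apply: Y => w; have := max s (y + w - X s) sT.
  rewrite -yE (addrC (X s)) subrK; lra.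
have Hy : H y (c + (2 * al) *: f) <= h + eps * A by have := epsA y; lra.
have QA := QP _ _ Hy.
have fsmall : `|f| <= dl.
  have : `|(2 * al) *: f| <= B.
    by rewrite -[(2 * al) *: f](addKr c) (le_trans (ler_normD _ _))// normrN addrC lerD.
  rewrite normrZ (gtr0_norm al2) /al.
  have -> : 2 * (B / (2 * dl)) * `|f| = B * (`|f| / dl) by field; rewrite gt_eqF.
  by rewrite -[X in _ <= X]mulr1 (ler_pM2l B0) (ler_pdivrMr _ _ dl0) mul1r.
have Lf : L * `|f| <= e / 2.
  have : `|f| <= e / (2 * L) by rewrite (le_trans fsmall)// ge_min lexx.
  move=> /(ler_wpM2l (ltW L0)) /le_trans; apply.
  by rewrite (_ : L * (e / (2 * L)) = e / 2)//; field; rewrite gt_eqF.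
have Cf : C * `|f| <= sg / 2.
  have : `|f| <= sg / (2 * C) by rewrite (le_trans fsmall)// ge_min lexx orbT.
  move=> /(ler_wpM2l (ltW C0)) /le_trans; apply.
  by rewrite (_ : C * (sg / (2 * C)) = sg / 2)//; field; rewrite gt_eqF.
have uyX : u y - u (X s) <= e / 2.
  apply: le_trans (ler_norm _) _; apply: le_trans (LP _ _) _.
  by rewrite -fE.
suff s0 : s = 0.
  have := max T 0; rewrite T0 lexx => /(_ isT).
  rewrite addr0 dot0 -yE s0.
  have : 0 <= al * dot f f by rewrite mulr_ge0 ?dot_ge0// ltW.
  move: uyX; rewrite s0 /X /kap; lra.
apply/eqP; rewrite eq_le; have [s0 sT'] := andP sT; rewrite s0 andbT leNgt; apply/negP => sp.
have [dv pE] := graph s.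
pose p := (gamma s).2.
have Xd : 'd v (X s) = dot (p - c) :> ('rV[R]_n -> R).
  apply/funext => w; rewrite /p pE addrAC subrr add0r.
  rewrite {1}((rV_finspan R n).1 w) linear_sum /dot; apply: eq_bigr => i _.
  by rewrite linearZ mxE mulrC.
have Hh : h <= H (X s) p.
  by rewrite /p pE; exact: (visc_super_differentiable pH C2 cv supv dv).
pose X' := (ham_field H (gamma s)).1.
have dq : differentiable (quad al (- ((2 * al) *: y))) (X s) /\
    'd (quad al (- ((2 * al) *: y))) (X s) = dot (- ((2 * al) *: f)) :> ('rV[R]_n -> R).
  have cq : cdiff (quad al (- ((2 * al) *: y))).
    by move=> w; have [_ /(_ w)] := quad_C1 al (- ((2 * al) *: y)).
  have [dq ->] := cdiff_differentiable (rV_finspan R n) (X s) cq; split=> //.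
  apply/funext => w; have [_ ->] := quad_is_derive al (- ((2 * al) *: y)) (X s) w.
  by rewrite fE; congr dot; apply/rowP => i; rewrite !mxE; ring.
have g1 : is_derive s (1 : R) (fun t => v (X t)) (dot (p - c) X').
  by rewrite -Xd; exact: is_derive_curve.
have g2 : is_derive s (1 : R) (fun t => quad al (- ((2 * al) *: y)) (X t)) (dot (- ((2 * al) *: f)) X').
  by rewrite -dq.2; apply: is_derive_curve; first exact: dq.1.
have g3 : is_derive s (1 : R) (fun t : R => kap * t) (kap * 1).
  exact: (@is_deriveZ R R R id kap s 1 1 (is_derive_id s 1)).
have Z := left_min_derive_le0 (is_deriveD (is_deriveD g1 g2) g3) sp.
(* The point [y] is kept fixed while [t] varies, so [u y] is a constant and only [v], the penalty
   and [kap * t] depend on time. *)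
have {Z} : dot (p - c) X' + dot (- ((2 * al) *: f)) X' + kap * 1 <= 0.
  apply: Z => t /andP[t0 ts].
  have := max t (y - X t); rewrite t0 (le_trans ts sT') => /(_ isT).
  rewrite (addrC (X t)) subrK -yE fE.
  have sq z : al * dot (y - z) (y - z) = quad al (- ((2 * al) *: y)) z + al * dot y y.
    by rewrite -shifted_quad -[z - y]opprB dotNl dotNr opprK.
  rewrite !sq !fctE /=; lra.
rewrite mulr1 => Z.
have conv := ham_convex (X s) p (c + (2 * al) *: f) C2 pd.
have convE : \sum_i 'D_(dirp i) (Hz H) (X s, p) * (c + (2 * al) *: f - p) 0 i =
    dot X' (c + (2 * al) *: f - p).
  by apply: eq_bigr => i _; rewrite /X' /= mxE /p /X -surjective_pairing.
rewrite convE in conv.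
have HC : H (X s) (c + (2 * al) *: f) <= H y (c + (2 * al) *: f) + C * `|f|.
  have := CP (y, c + (2 * al) *: f) (X s, c + (2 * al) *: f) QA QA; rewrite /Hz /=.
  have -> : (y, c + (2 * al) *: f) - (X s, c + (2 * al) *: f) = (f, 0) :> phase.
    by congr pair => /=; rewrite ?subrr// fE.
  rewrite prod_normE/= normr0 max_l// ler_norml => /andP[h1 _]; lra.
have := epsA y.
move: Z conv; rewrite !dotE ![dot _ X']dotC /kap; lra.
Qed.

(** * Global existence of the Hamiltonian flow *)

Lemma derivable_cont (R : realType) (f df : R -> R) :
  (forall s, is_derive s (1 : R) f (df s)) -> continuous f.
Proof.
by move=> D s; apply: differentiable_continuous; apply/derivable1_diffP; case: (D s).
Qed.

Lemma primitive_right (R : realType) (g : R -> R) (a : R) : continuous g ->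
  exists F : R -> R, forall x, a < x -> is_derive x (1 : R) F (g x).
Proof.
move=> cg; exists (fun x => (\int[lebesgue_measure]_(t in `[a, x]) g t)%R) => x ax.
have ig : lebesgue_measure.-integrable `[a, x + 1] (EFin \o g).
  apply: continuous_compact_integrable; first exact: segment_compact.
  by apply: continuous_subspaceT => y; exact: cg.
have x1 : x < x + 1 by rewrite ltrDl.
have [dF Fg] := @continuous_FTC1_closed R g a x (x + 1) x1 ig ax (cg x).
by split; [exact: dF|rewrite -derive1E; exact: Fg].
Qed.

Lemma const_right (R : realType) (F : R -> R) (a x y : R) :
  (forall t, a < t -> is_derive t (1 : R) F 0) -> a < x -> x <= y -> F x = F y.
Proof.
move=> dF ax xy.
have [||c _] := @MVT_segment R F (fun=> 0) x y xy.
- by move=> t; rewrite in_itv/= => /andP[xt _]; apply: dF; exact: lt_trans xt.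
- apply: continuous_in_subspaceT => t; rewrite inE/= in_itv/= => /andP[xt _].
  by apply: differentiable_continuous; apply/derivable1_diffP; case: (dF t (lt_le_trans ax xt)).
by rewrite mul0r => /eqP; rewrite subr_eq0 => /eqP.
Qed.

(** An integral from a base point is a primitive only to the right of it. Those based at [- N.+1],
    normalised to vanish at 0, agree wherever two of them are defined, so each [s] may use its
    own. *)
Lemma primitive (R : realType) (g : R -> R) : continuous g ->
  exists G : R -> R, G 0 = 0 /\ forall s, is_derive s (1 : R) G (g s).
Proof.
move=> cg.
pose F (N : nat) := projT1 (cid (@primitive_right R g (- N.+1%:R) cg)).
have FP N (x : R) : - N.+1%:R < x -> is_derive x (1 : R) (F N) (g x).
  by rewrite /F; case: (cid _) => /= ?; exact.
have agree N M (x : R) : - N.+1%:R < x -> - M.+1%:R < x -> F N x - F N 0 = F M x - F M 0.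
  move=> Nx Mx; pose a := Num.max (- N.+1%:R) (- M.+1%:R) : R.
  have d0 t : a < t -> is_derive t (1 : R) (F N - F M) 0.
    rewrite gt_max => /andP[/FP dN /FP dM]; rewrite -(subrr (g t)); exact: is_deriveB.
  have a0 : a < 0 by rewrite gt_max !oppr_lt0 !ltr0n.
  have ax : a < x by rewrite gt_max Nx Mx.
  have : (F N - F M) x = (F N - F M) 0.
    have [x0|/ltW x0] := leP x 0; first exact: const_right d0 ax x0.
    by apply/esym; exact: const_right d0 a0 x0.
  rewrite !fctE; lra.
(* The strict inequality [- (N s).+1 < s] leaves a neighbourhood of [s] on which the primitive
   chosen for [s] is still valid. *)
pose N (s : R) := (Num.truncn `|s|).
have NP s : - (N s).+1%:R < s.
  by rewrite ltrNl (le_lt_trans (ler_norm _))// normrN truncnS_gt.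
exists (fun s => F (N s) s - F (N s) 0); split; first by rewrite subrr.
move=> s.
have D : is_derive s (1 : R) (fun t => F (N s) t - F (N s) 0) (g s).
  rewrite -[g s]subr0; apply: is_deriveB; exact: FP.
apply: near_eq_is_derive D.
apply/near_normP; exists (s + (N s).+1%:R); first by have := NP s; lra.
move=> t ts; apply: agree => //.
have := ler_norm (s - t); rewrite distrC => h; lra.
Qed.

(** Both [g + f] and [g - f] are nondecreasing and vanish at 0; the absolute value of [g] covers
    negative times. *)
Lemma derive_dominated (R : realType) (f g df dg : R -> R) :
  (forall s, is_derive s (1 : R) f (df s)) -> (forall s, is_derive s (1 : R) g (dg s)) ->
  f 0 = 0 -> g 0 = 0 -> (forall s, `|df s| <= dg s) -> forall s, `|f s| <= `|g s|.
Proof.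
move=> Df Dg f0 g0 dfg s.
have mono (e : R -> R) (de : R -> R) : (forall s, is_derive s (1 : R) e (de s)) ->
    (forall s, 0 <= de s) -> forall x y, x <= y -> e x <= e y.
  move=> De de0 x y xy.
  have [c _] := MVT_segment xy (fun t _ => De t) (continuous_subspaceT (derivable_cont De)).
  by move=> E; rewrite -subr_ge0 E mulr_ge0// subr_ge0.
have m1 := mono _ _ (fun s => is_deriveD (Dg s) (Df s)).
have m2 := mono _ _ (fun s => is_deriveB (Dg s) (Df s)).
have p1 t : 0 <= dg t + df t by have := dfg t; rewrite ler_norml; lra.
have p2 t : 0 <= dg t - df t by have := dfg t; rewrite ler_norml; lra.
have [s0|/ltW s0] := leP 0 s.
  have := m1 p1 _ _ s0; have := m2 p2 _ _ s0; rewrite !fctE f0 g0 => h1 h2.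
  by have := ler_norm (g s); rewrite ler_norml; lra.
have := m1 p1 _ _ s0; have := m2 p2 _ _ s0; rewrite !fctE f0 g0 => h1 h2.
by have := ler_norm (- g s); rewrite normrN ler_norml; lra.
Qed.

(** The sequences [a k - 2 M / 2^k] and [a k + 2 M / 2^k] are monotone in opposite senses, so the
    supremum of the first lies below every term of the second. *)
Lemma geometric_limit (R : realType) (a : nat -> R) (M : R) :
  0 <= M -> (forall k, `|a k.+1 - a k| <= M / 2 ^+ k) ->
  exists l, forall k, `|a k - l| <= 2 * M / 2 ^+ k.
Proof.
move=> M0 aM.
pose b k := a k - 2 * M / 2 ^+ k; pose d k := a k + 2 * M / 2 ^+ k.
have half k : 2 * M / 2 ^+ k.+1 = M / 2 ^+ k.
  by rewrite exprS; field; rewrite gt_eqF// exprn_gt0.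
have twice k : 2 * M / 2 ^+ k = M / 2 ^+ k + M / 2 ^+ k.
  by rewrite mulr_natl mulrnAl mulr2n.
have bS k : b k <= b k.+1.
  by rewrite /b half twice; have := aM k; rewrite ler_norml; lra.
have dS k : d k.+1 <= d k.
  by rewrite /d half twice; have := aM k; rewrite ler_norml; lra.
have bd j k : b j <= d k.
  have bmono i : b j <= b (j + i)%N.
    by elim: i => [|i ih]; [rewrite addn0|rewrite addnS (le_trans ih)].
  have dmono i : d (k + i)%N <= d k.
    by elim: i => [|i ih]; [rewrite addn0|rewrite addnS (le_trans (dS _))].
  apply: le_trans (bmono k) _; rewrite addnC; apply: le_trans _ (dmono j).
  have : 0 <= 2 * M / 2 ^+ (k + j) by rewrite divr_ge0 ?exprn_ge0// mulr_ge0.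
  by rewrite /b /d; lra.
have hs : has_sup (range b).
  by split; [exists (b 0%N); exists 0%N|exists (d 0%N) => _ [j _ <-]].
exists (sup (range b)) => k.
have h1 : b k <= sup (range b) by apply: sup_upper_bound => //; exists k.
have h2 : sup (range b) <= d k.
  by apply: ge_sup; [exists (b 0%N); exists 0%N|move=> _ [j _ <-]].
by rewrite ler_norml; move: h1 h2; rewrite /b /d; lra.
Qed.

(* Picard iteration; the weight [exp(2Ls) + exp(-2Ls)] makes the Picard map a
   contraction of ratio 1/2 on the whole line. *)
Lemma ode_exists (R : realType) (I : finType) (F : I -> (I -> R) -> R) (L : R) (z0 : I -> R) :
  0 < L ->
  (forall i (a b : I -> R) m, (forall j, `|a j - b j| <= m) -> `|F i a - F i b| <= L * m) ->
  exists y : R -> I -> R, (forall i, y 0 i = z0 i) /\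
    forall s i, is_derive s (1 : R) (fun t => y t i) (F i (y s)).
Proof.
move=> L0 lipF.
(* [S' = 2 L W] and [|S| <= W], so integrating an error [L * (M * W)] returns at most
   [M / 2 * W]. *)
pose W (s : R) := expR (2 * L * s) + expR (- (2 * L * s)).
pose S (s : R) := expR (2 * L * s) - expR (- (2 * L * s)).
have dE (k s : R) : is_derive s (1 : R) (fun s => expR (k * s)) (k * expR (k * s)).
  have dk : is_derive s (1 : R) (fun s : R => k * s) k.
    by have := @is_deriveZ R R R id k s 1 1 (is_derive_id s 1); rewrite [X in is_derive _ _ _ X](mulr1 k).
  by rewrite mulrC; exact: (@is_derive1_comp R expR (fun s => k * s) s _ _ (is_derive_expR _) dk).
have WE : W = fun s => expR (2 * L * s) + expR (- (2 * L) * s).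
  by apply/funext => s; rewrite /W mulNr.
have SE : S = fun s => expR (2 * L * s) - expR (- (2 * L) * s).
  by apply/funext => s; rewrite /S mulNr.
have dS s : is_derive s (1 : R) S (2 * L * W s).
  have D := is_deriveB (dE (2 * L) s) (dE (- (2 * L)) s).
  rewrite SE (_ : 2 * L * W s = 2 * L * expR (2 * L * s) - - (2 * L) * expR (- (2 * L) * s)).
    exact: D.
  by rewrite WE; ring.
have cW : continuous W.
  by rewrite WE; apply: cont_add; [exact: (derivable_cont (dE _))|exact: (derivable_cont (dE _))].
have W0 s : 0 < W s by rewrite addr_gt0// expR_gt0.
have SW s : `|S s| <= W s.
  by rewrite ler_norml /S /W; have := expR_gt0 (2 * L * s); have := expR_gt0 (- (2 * L * s)); lra.
have S00 : S 0 = 0 by rewrite /S mulr0 oppr0 subrr.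
have contF (y : R -> I -> R) : (forall i, continuous (fun t => y t i)) ->
    forall i, continuous (fun t => F i (y t)).
  move=> cy i s; apply/continuous_normP => e e0.
  have e2 : 0 < e / (2 * L) by rewrite divr_gt0// mulr_gt0.
  have : \forall t \near s, forall j, `|y s j - y t j| < e / (2 * L).
    apply: (@filter_forall R I (fun j t => `|y s j - y t j| < e / (2 * L)) (nbhs s) _) => j.
    by have /cvgrPdist_lt/(_ _ e2) := cy j s.
  move=> /near_normP[d d0 dP]; exists d => // t /dP yt; rewrite distrC.
  have := lipF i (y s) (y t) (e / (2 * L)) (fun j => ltW (yt j)).
  rewrite (_ : L * (e / (2 * L)) = e / 2); last by field; rewrite gt_eqF.
  move=> /le_lt_trans; apply; lra.
(* The value [cst 0] at discontinuous [g] only makes the Picard map total; all iterates and the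
   limit are continuous. *)
pose P (g : R -> R) : R -> R :=
  if pselect (continuous g) is left cg then projT1 (cid (@primitive R g cg)) else cst 0.
have PP g : continuous g -> P g 0 = 0 /\ forall s, is_derive s (1 : R) (P g) (g s).
  by move=> cg; rewrite /P; case: pselect => // cg'; case: (cid _).
pose step (y : R -> I -> R) : R -> I -> R := fun s i => z0 i + P (fun t => F i (y t)) s.
have stepD y : (forall i, continuous (fun t => y t i)) ->
    forall i s, is_derive s (1 : R) (fun t => step y t i) (F i (y s)).
  move=> cy i s; have [_ D] := PP _ (contF y cy i).
  rewrite -[F i (y s)]add0r; apply: is_deriveD; exact: D.
have step0 y i : (forall i, continuous (fun t => y t i)) -> step y 0 i = z0 i.
  by move=> cy; rewrite /step (PP _ (contF y cy i)).1 addr0.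
have stepC y : (forall i, continuous (fun t => y t i)) -> forall i, continuous (fun t => step y t i).
  by move=> cy i; exact: (derivable_cont (stepD y cy i)).
pose y := fun k => iter k step (fun _ => z0).
have yC k : forall i, continuous (fun t => y k t i).
  by elim: k => [|k ih] i; [move=> ?; exact: cvg_cst|exact: stepC].
pose C := \sum_i `|F i z0| / (2 * L).
have C0 : 0 <= C by rewrite sumr_ge0// => i _; rewrite divr_ge0// mulr_ge0// ltW.
have contract (y1 y2 : R -> I -> R) (M : R) : (forall i, continuous (fun t => y1 t i)) ->
    (forall i, continuous (fun t => y2 t i)) -> 0 <= M ->
    (forall s j, `|y1 s j - y2 s j| <= M * W s) ->
    forall s i, `|step y1 s i - step y2 s i| <= M / 2 * W s.
  move=> cy1 cy2 M0 yM s i.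
  have D1 t := is_deriveB (stepD _ cy1 i t) (stepD _ cy2 i t).
  have D2 t : is_derive t (1 : R) (fun t => M / 2 * S t) (M / 2 * (2 * L * W t)).
    exact: (@is_deriveZ R R R S (M / 2) t 1 _ (dS t)).
  have := derive_dominated D1 D2; rewrite !fctE !step0// subrr S00 mulr0.
  move=> /(_ erefl erefl) H.
  have {}H := H (fun t => le_trans (lipF i _ _ _ (yM t)) _) s.
  apply: le_trans (H _) _.
    by move=> t; rewrite (_ : L * (M * W t) = M / 2 * (2 * L * W t))//; field.
  by rewrite normrM ger0_norm ?divr_ge0// ler_wpM2l ?divr_ge0.
have base s i : `|y 1%N s i - y 0%N s i| <= C * W s.
  have D1 t := is_deriveB (stepD _ (yC 0%N) i t) (is_derive_cst (z0 i) t (1 : R)).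
  have D2 t : is_derive t (1 : R) (fun t => C * S t) (C * (2 * L * W t)).
    exact: (@is_deriveZ R R R S C t 1 _ (dS t)).
  have := derive_dominated D1 D2; rewrite !fctE /cst step0; last exact: (yC 0%N).
  rewrite subrr S00 mulr0 => /(_ erefl erefl) H.
  apply: le_trans (H _ s) _.
    move=> t; rewrite subr0 /=.
    have W1 : 1 <= W t.
      rewrite /W; have [t0|/ltW t0] := leP 0 t.
        have := expR_ge1Dx (2 * L * t); have := expR_gt0 (- (2 * L * t)).
        have : 0 <= 2 * L * t by rewrite mulr_ge0// mulr_ge0// ltW.
        lra.
      have := expR_ge1Dx (- (2 * L * t)); have := expR_gt0 (2 * L * t).
      have : 2 * L * t <= 0 by rewrite mulr_ge0_le0// mulr_ge0// ltW.
      lra.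
    apply: (@le_trans _ _ (C * (2 * L))); last first.
      by rewrite [leRHS]mulrA ler_peMr// mulr_ge0// mulr_ge0// ltW.
    rewrite /C mulr_suml (bigD1 i)//= divfK; last by rewrite mulf_neq0// gt_eqF.
    by rewrite lerDl sumr_ge0// => j _; rewrite mulr_ge0 ?divr_ge0// mulr_ge0// ltW.
  by rewrite normrM ger0_norm// ler_wpM2l.
have dist k s i : `|y k.+1 s i - y k s i| <= C / 2 ^+ k * W s.
  elim: k s i => [|k ih] s i; first by rewrite expr0 divr1; exact: base.
  have := contract _ _ (C / 2 ^+ k) (yC k.+1) (yC k) _ ih s i.
  rewrite (_ : C / 2 ^+ k / 2 = C / 2 ^+ k.+1); last by rewrite exprSr invfM mulrA.
  by apply; rewrite divr_ge0// exprn_ge0.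
have lim s i : exists l, forall k, `|y k s i - l| <= 2 * C / 2 ^+ k * W s.
  have [||l lP] := @geometric_limit R (fun k => y k s i) (C * W s).
  - by rewrite mulr_ge0// ltW.
  - by move=> k; rewrite mulrAC; exact: dist.
  by exists l => k; rewrite mulrAC -(mulrA 2); exact: lP.
pose Y s i := projT1 (cid (lim s i)).
have YP k s i : `|y k s i - Y s i| <= 2 * C / 2 ^+ k * W s.
  by rewrite /Y; case: (cid _) => /= l; exact.
have small (M e : R) : 0 <= M -> 0 < e -> exists k, M / 2 ^+ k < e.
  move=> M0 e0; exists (Num.truncn (M / e)).+1.
  set k := (Num.truncn (M / e)).+1.
  rewrite ltr_pdivrMr ?exprn_gt0//.
  have : M / e < k%:R by rewrite truncnS_gt.
  rewrite ltr_pdivrMr// => /lt_le_trans; apply; rewrite mulrC; apply: ler_wpM2l; first exact: ltW.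
  by have := ltnW (ltn_expl k (isT : (1 < 2)%N)); rewrite -(ler_nat R) natrX.
have YC i : continuous (fun t => Y t i).
  move=> s; apply/continuous_normP => e e0.
  have M0 : 0 <= 2 * C * (W s + 1) by rewrite mulr_ge0 ?mulr_ge0// addr_ge0// ltW.
  have [k kP] := small _ (e / 3) M0 (divr_gt0 e0 (ltr0Sn R 2)).
  have [d1 d10 d1P] := (continuous_normP _ _).1 (yC k i s) _ (divr_gt0 e0 (ltr0Sn R 2)).
  have [d2 d20 d2P] := (continuous_normP _ _).1 (cW s) _ ltr01.
  exists (Num.min d1 d2); first by rewrite lt_min d10.
  move=> t; rewrite lt_min => /andP[/d1P h1 /d2P h2].
  have Wt : W t <= W s + 1 by have := ler_norm (W t - W s); lra.
  have Ws : W s <= W s + 1 by rewrite lerDl.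
  have q0 : 0 <= 2 * C / 2 ^+ k by rewrite divr_ge0 ?exprn_ge0// mulr_ge0.
  have h3 := le_trans (YP k t i) (ler_wpM2l q0 Wt).
  have h4 := le_trans (YP k s i) (ler_wpM2l q0 Ws).
  have kE : 2 * C / 2 ^+ k * (W s + 1) < e / 3 by rewrite mulrAC.
  move: h1 h3 h4; rewrite !ltr_norml !ler_norml; lra.
(* The iterate [y k.+1] is close to [Y] by convergence and to [step Y] by contraction. *)
have YE s i : Y s i = step Y s i.
  apply/eqP; rewrite -subr_eq0 -normr_le0; apply/ler_addgt0Pr => e e0; rewrite add0r.
  have M0 : 0 <= 2 * C * W s by rewrite mulr_ge0 ?mulr_ge0// ltW.
  have [k kP] := small _ (e / 2) M0 (divr_gt0 e0 (ltr0Sn R 1)).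
  have q0 : 0 <= 2 * C / 2 ^+ k by rewrite divr_ge0 ?exprn_ge0// mulr_ge0.
  have h1 := contract _ _ _ (yC k) YC q0 (YP k) s i.
  have h2 := YP k.+1 s i.
  have E1 : 2 * C / 2 ^+ k.+1 * W s = 2 * C / 2 ^+ k / 2 * W s by rewrite exprSr invfM mulrA.
  have E2 : 2 * C / 2 ^+ k / 2 * W s = 2 * C * W s / 2 ^+ k / 2 by ring.
  rewrite E1 E2 in h2; rewrite E2 in h1.
  move: h1 h2 kP; rewrite -/(y k.+1) -[step (y k)]/(y k.+1) => h1 h2 kP.
  move: h1 h2; rewrite !ler_norml; lra.
exists Y; split=> [i|s i]; first by rewrite YE step0.
have -> : (fun t => Y t i) = (fun t => step Y t i) by apply/funext => t; exact: YE.
exact: stepD.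
Qed.

Lemma is_derive_pair (R : realType) (U V : normedModType R) (f : R -> U) (g : R -> V)
    (s : R) (df : U) (dg : V) :
  is_derive s (1 : R) f df -> is_derive s (1 : R) g dg ->
  is_derive s (1 : R) (fun t => (f t, g t)) (df, dg).
Proof.
move=> [ef <-] [eg <-].
have C : (fun h : R => h^-1 *: (((fun t => (f t, g t)) \o shift s) (h *: (1 : R)) - (f s, g s))) @ 0^' -->
    ('D_1 f s, 'D_1 g s).
  exact: (cvg_pair ef eg).
by split; [apply/cvg_ex; eexists; exact: C|exact/cvg_lim].
Qed.

Lemma is_derive_row (R : realType) (n : nat) (f : R -> 'I_n -> R) (s : R) (d : 'I_n -> R) :
  (forall i, is_derive s (1 : R) (fun t => f t i) (d i)) ->
  is_derive s (1 : R) (fun t => \row_i f t i) (\row_i d i).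
Proof.
move=> fd.
have E i j : (fun t => (\row_i f t i : 'rV[R]_n) i j) = fun t => f t j.
  by apply/funext => t; rewrite mxE.
have D : derivable (fun t => \row_i f t i : 'rV[R]_n) s 1.
  by apply/derivable_mxP => i j; rewrite E; case: (fd j).
split => //; rewrite derive_mx//; apply/matrixP => i j; rewrite mxE E mxE.
by case: (fd j).
Qed.

(** A cutoff in the energy: 1 up to [E + 1], 0 from [E + 2], affine between. Momenta are bounded
    below the level [E + 2], so the truncated field lives on a bounded strip. *)
Definition clamp (R : realType) (E t : R) : R := Num.max 0 (Num.min 1 (E + 2 - t)).

Lemma clamp_range (R : realType) (E t : R) : 0 <= clamp E t <= 1.
Proof. by rewrite /clamp le_max lexx /= ge_max ler01 ge_min lexx. Qed.

Lemma clamp1 (R : realType) (E t : R) : t <= E + 1 -> clamp E t = 1.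
Proof. by move=> h; rewrite /clamp min_l ?max_r//; lra. Qed.

Lemma clamp0 (R : realType) (E t : R) : E + 2 <= t -> clamp E t = 0.
Proof. by move=> h; rewrite /clamp max_l// ge_min; apply/orP; right; lra. Qed.

Lemma clamp_lipschitz (R : realType) (E t t' : R) : `|clamp E t - clamp E t'| <= `|t - t'|.
Proof.
have cl r : [\/ r <= E + 1 /\ clamp E r = 1, E + 2 <= r /\ clamp E r = 0 |
    E + 1 <= r <= E + 2 /\ clamp E r = E + 2 - r].
  have [r1|r1] := leP r (E + 1); first by apply: Or31; rewrite clamp1.
  have [r2|r2] := leP (E + 2) r; first by apply: Or32; rewrite clamp0.
  apply: Or33; split; first by rewrite !ltW.
  by rewrite /clamp min_r ?max_r//; lra.
have n1 := ler_norm (t - t'); have n2 := ler_norm (t' - t); rewrite (distrC t' t) in n2.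
move: (`|t - t'|) n1 n2 => N n1 n2; rewrite ler_norml.
case: (cl t) => -[h ->]; case: (cl t') => -[h' ->]; lra.
Qed.

Definition ham_coord (R : realType) (n : nat) (H : 'rV[R]_n -> 'rV[R]_n -> R)
    (i : 'I_n + 'I_n) (z : phase) : R := phase_coord (ham_field H z) i.

Lemma ham_coord_cdiff (R : realType) (n : nat) (H : 'rV[R]_n -> 'rV[R]_n -> R) (i : 'I_n + 'I_n) :
  C2_ham H -> periodic_ham H -> forall B, exists2 C : R, 0 < C &
  (forall z, `|z.2| <= B -> `|ham_coord H i z| <= C) /\
  (forall z z', `|z.2| <= B -> `|z'.2| <= B -> `|ham_coord H i z - ham_coord H i z'| <= C * `|z - z'|).
Proof.
move=> C2 pH B.
have main (u : phase) : exists2 C : R, 0 < C &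
  (forall z, `|z.2| <= B -> `|'D_u (Hz H) z| <= C) /\
  (forall z z', `|z.2| <= B -> `|z'.2| <= B -> `|'D_u (Hz H) z - 'D_u (Hz H) z'| <= C * `|z - z'|).
  have [C1 C10 h1] := @strip_bound R n ('D_u (Hz H)) B (ham_cdiff C2 u).2 (D_xperiodic _ (ham_xperiodic pH)).
  have [C2' C20 h2] := @strip_lipschitz R n ('D_u (Hz H)) B (ham_cdiff2 u C2) (D_xperiodic _ (ham_xperiodic pH)).
  exists (C1 + C2'); first by rewrite addr_gt0.
  split=> [z zB|z z' zB zB'].
    by apply: le_trans (h1 z zB) _; rewrite lerDl ltW.
  by apply: le_trans (h2 z z' zB zB') _; apply: ler_wpM2r => //; rewrite lerDr ltW.
case: i => i.
  have [C C0 [h1 h2]] := main (dirp i); exists C => //.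
  by split=> [z|z z']; rewrite /ham_coord /= !mxE; [exact: h1|exact: h2].
have [C C0 [h1 h2]] := main (dirx i); exists C => //.
split=> [z|z z']; rewrite /ham_coord /= !mxE; first by rewrite normrN; exact: h1.
by rewrite -opprD normrN; exact: h2.
Qed.

(* The field [clamp (H z) X_H(z)] is globally Lipschitz and conserves [H], so on
   the energy level of [z0] it generates the Hamiltonian flow. *)
Lemma ham_traj_exists (R : realType) (n : nat) (H : 'rV[R]_n -> 'rV[R]_n -> R) (z0 : phase) :
  periodic_ham H -> C2_ham H -> superlinear H ->
  exists gamma, ham_traj H gamma /\ gamma 0 = z0.
Proof.
move=> pH C2 sl.
pose E := Hz H z0.
have [Q Q0 QP] := ham_coercive (E + 2) sl.
have dHf z : 'D_(ham_field H z) (Hz H) z = 0.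
  rewrite (cdiff_coord (@phase_finspan R n) _ _ (ham_cdiff C2)) big_sumType.
  transitivity (\sum_i 'D_(dirp i) (Hz H) z * 'D_(dirx i) (Hz H) z +
      \sum_i - ('D_(dirx i) (Hz H) z * 'D_(dirp i) (Hz H) z)).
    congr (_ + _); apply: eq_bigr => i _.
      have -> : phase_coord (ham_field H z) (inl i) = 'D_(dirp i) (Hz H) z by rewrite [LHS]mxE.
      exact: erefl.
    have -> : phase_coord (ham_field H z) (inr i) = - 'D_(dirx i) (Hz H) z.
      by rewrite [LHS]mxE mxE.
    exact: mulNr.
  rewrite -big_split big1// => i _ /=.
  by rewrite [X in X - _]mulrC subrr.
(* Bounds are taken up to [Q + 1] although the truncated field vanishes beyond [Q]. A point where it
   may be nonzero is then at distance at least 1 from any point outside the larger strip, and a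
   plain bound serves as a Lipschitz estimate ([far]). *)
pose Hc (i : 'I_n + 'I_n) := ham_coord_cdiff i C2 pH (Q + 1).
pose M := \sum_i projT1 (cid2 (Hc i)).
have Cpos i : 0 < projT1 (cid2 (Hc i)) by case: (cid2 _).
have CM i : projT1 (cid2 (Hc i)) <= M.
  by rewrite /M (bigD1 i)// lerDl; apply: sumr_ge0 => j _; exact: ltW (Cpos j).
have M0 : 0 <= M by apply: sumr_ge0 => j _; exact: ltW (Cpos j).
have bM i z : `|z.2| <= Q + 1 -> `|ham_coord H i z| <= M.
  by move=> zQ; apply: le_trans (CM i); case: (cid2 _) => /= C _ [h _]; exact: h.
have lM i z z' : `|z.2| <= Q + 1 -> `|z'.2| <= Q + 1 ->
    `|ham_coord H i z - ham_coord H i z'| <= M * `|z - z'|.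
  move=> zQ zQ'; apply: (@le_trans _ _ (projT1 (cid2 (Hc i)) * `|z - z'|)).
    by case: (cid2 _) => /= C _ [_ h]; exact: h.
  by apply: ler_wpM2r.
have [Lh Lh0 lH] := strip_lipschitz (Q + 1) (ham_cdiff C2) (ham_xperiodic pH).
pose K i z := clamp E (Hz H z) * ham_coord H i z.
have K0 i z : Q < `|z.2| -> K i z = 0.
  move=> zQ; rewrite /K clamp0 ?mul0r// leNgt; apply/negP => /ltW/(QP z.1 z.2).
  by rewrite leNgt zQ.
pose L := Lh * M + M + 1.
have L0 : 0 < L by rewrite ltr_wpDl// addr_ge0// mulr_ge0// ltW.
have KL0 i z z' : `|z.2| <= Q + 1 -> `|z'.2| <= Q + 1 -> `|K i z - K i z'| <= L * `|z - z'|.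
  move=> zQ zQ'.
  have -> : K i z - K i z' = (clamp E (Hz H z) - clamp E (Hz H z')) * ham_coord H i z +
      clamp E (Hz H z') * (ham_coord H i z - ham_coord H i z') by rewrite /K; ring.
  apply: le_trans (ler_normD _ _) _; rewrite !normrM.
  have h1 : `|clamp E (Hz H z) - clamp E (Hz H z')| * `|ham_coord H i z| <= Lh * `|z - z'| * M.
    apply: ler_pM => //; last exact: bM.
    exact: le_trans (clamp_lipschitz _ _ _) (lH _ _ zQ zQ').
  have h2 : `|clamp E (Hz H z')| * `|ham_coord H i z - ham_coord H i z'| <= 1 * (M * `|z - z'|).
    apply: ler_pM => //; last exact: lM.
    by have := clamp_range E (Hz H z') => /andP[c0 c1]; rewrite ger0_norm.
  have := normr_ge0 (z - z'); rewrite /L; lra.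
have far i z z' : Q + 1 < `|z'.2| -> `|K i z| <= L * `|z - z'|.
  move=> zQ'; have [zQ|zQ] := ltP Q `|z.2|.
    by rewrite (K0 _ _ zQ) normr0 mulr_ge0// ltW.
  have h1 : `|K i z| <= M.
    rewrite normrM -[leRHS]mul1r; apply: ler_pM => //; last by apply: bM; rewrite (le_trans zQ)// lerDl.
    by have := clamp_range E (Hz H z) => /andP[c0 c1]; rewrite ger0_norm.
  have h2 : 1 <= `|z - z'|.
    have : `|z'.2| - `|z.2| <= `|z'.2 - z.2| by exact: lerB_dist.
    have : `|z'.2 - z.2| <= `|z - z'| by rewrite distrC prod_normE/= le_max lexx orbT.
    lra.
  apply: le_trans h1 _; apply: (@le_trans _ _ (M * `|z - z'|)); first by rewrite ler_peMr.
  apply: ler_wpM2r => //; have : 0 <= Lh * M by rewrite mulr_ge0// ltW.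
  by rewrite /L; lra.
have KL i z z' : `|K i z - K i z'| <= L * `|z - z'|.
  have [zQ|zQ] := leP `|z.2| (Q + 1); last first.
    rewrite (K0 i z) ?sub0r ?normrN ?(distrC z); last by apply: le_lt_trans zQ; rewrite lerDl.
    exact: far.
  have [zQ'|zQ'] := leP `|z'.2| (Q + 1); first exact: KL0.
  rewrite (K0 i z') ?subr0; last by apply: le_lt_trans zQ'; rewrite lerDl.
  exact: far.
pose zof (a : 'I_n + 'I_n -> R) : @phase R n := (\row_i a (inl i), \row_i a (inr i)).
have zofn a b m : 0 <= m -> (forall j, `|a j - b j| <= m) -> `|zof a - zof b| <= m.
  move=> m0 ab; rewrite prod_normE/= ge_max; apply/andP; split.
    by apply: norm_rV_le => // i; rewrite !mxE.
  by apply: norm_rV_le => // i; rewrite !mxE.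
have [||y [y0 yD]] := @ode_exists R _ (fun i a => K i (zof a)) L (phase_coord z0).
- exact: L0.
- move=> i a b m ab; have m0 : 0 <= m := le_trans (normr_ge0 _) (ab i).
  apply: le_trans (KL _ _ _) _; apply: ler_wpM2l; first exact: ltW.
  exact: zofn.
pose gamma s := zof (y s).
have dg s : is_derive s (1 : R) gamma (zof (fun i => K i (gamma s))).
  by apply: is_derive_pair; apply: is_derive_row => i; exact: yD.
have fieldE z : zof (fun i => K i z) = clamp E (Hz H z) *: ham_field H z.
  congr pair; apply/rowP => i; first by rewrite /K /ham_coord !mxE /= mxE.
  by rewrite /K /ham_coord !mxE /= !mxE.
have dE s : is_derive s (1 : R) (fun t => Hz H (gamma t)) 0.
  have [dH HE] := cdiff_differentiable (@phase_finspan R n) (gamma s) (ham_cdiff C2).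
  have := is_derive_curve dH (dg s).
  have -> // : ('d (Hz H) (gamma s) : phase -> R) (zof (fun i => K i (gamma s))) = 0.
  by rewrite HE fieldE derive_dirZ ?dHf ?mulr0//; exact: (ham_cdiff C2 _).1.
have g0 : gamma 0 = z0.
  rewrite [z0]surjective_pairing; congr pair; apply/rowP => i; rewrite mxE y0//.
have Hc' s : Hz H (gamma s) = E.
  by rewrite (is_derive_0_is_cst s 0 dE) g0.
exists gamma; split=> // s.
have := dg s; rewrite fieldE Hc' clamp1 ?scale1r; last by rewrite lerDl.
by case.
Qed.

(** * Ergodization of linear flows *)

(** For [|s| <= 1] the identity [1 - cos s = 2 sin (s / 2)^2] and the mean value theorem for [sin]
    give the bound; for [|s|] between 1 and [pi] monotonicity of [cos] and [s^2 <= 16] do. *)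
Lemma cos_quadratic_bound (R : realType) :
  exists2 k : R, 0 < k & forall s : R, `|s| <= pi -> k * s ^+ 2 <= 1 - cos s.
Proof.
have c10 : 0 < cos 1 :> R := cos1_gt0 R.
have pi1 : 1 <= pi :> R by have := pi_ge2 R; lra.
have c11 : cos 1 < 1 :> R.
  by rewrite -[X in _ < X]cos0 ltr_cos ?in_itv/= ?lexx ?ler01 ?ltr01 ?pi_ge0.
pose k := Num.min (cos 1 ^+ 2 / 2) ((1 - cos 1) / 16) : R.
have k0 : 0 < k by rewrite lt_min !divr_gt0 ?exprn_gt0 ?subr_gt0.
exists k => // s; wlog s0 : s / 0 <= s.
  move=> H; have [|/ltW s0] := leP 0 s; first exact: H.
  by rewrite -[s]opprK cosN sqrrN normrN; apply: H; rewrite oppr_ge0.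
rewrite ger0_norm// => spi.
have [s1|/ltW s1] := leP s 1.
  have -> : 1 - cos s = 2 * sin (s / 2) ^+ 2.
    have := cos_mulr2n (s / 2); rewrite (_ : s / 2 *+ 2 = s); last by rewrite -mulr_natr divfK.
    by move=> ->; rewrite cos2sin2 mulr2n; ring.
  have h : cos 1 * (s / 2) <= sin (s / 2).
    have s20 : 0 <= s / 2 by rewrite divr_ge0.
    have [x] := MVT_segment s20 (fun x _ => is_derive_sin x) (continuous_subspaceT (@continuous_sin R)).
    rewrite in_itv/= sin0 !subr0 => /andP[x0 xs] ->.
    rewrite ler_wpM2r// le_eqVlt; apply/orP.
    have [->|x1] := eqVneq x 1; [by left|right].
    by rewrite ltr_cos ?in_itv/= ?ler01 ?x0//; lra.
  have h2 : (cos 1 * (s / 2)) ^+ 2 <= sin (s / 2) ^+ 2.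
    by rewrite !expr2 ler_pM// mulr_ge0 ?divr_ge0// ltW.
  apply: (@le_trans _ _ (cos 1 ^+ 2 / 2 * s ^+ 2)).
    by rewrite ler_wpM2r ?sqr_ge0// ge_min lexx.
  have -> : cos 1 ^+ 2 / 2 * s ^+ 2 = 2 * (cos 1 * (s / 2)) ^+ 2 by field.
  by rewrite ler_wpM2l.
have h1 : cos s <= cos 1.
  rewrite le_eqVlt; apply/orP; have [->|s1'] := eqVneq s 1; [by left|right].
  by rewrite ltr_cos ?in_itv/= ?ler01 ?s0//; lra.
have s4 : s ^+ 2 <= 16.
  have : s <= 4 by have := pihalf_lt2 R; lra.
  by move=> s4; rewrite expr2; nra.
apply: (@le_trans _ _ ((1 - cos 1) / 16 * s ^+ 2)).
  by rewrite ler_wpM2r ?sqr_ge0// ge_min lexx orbT.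
have : (1 - cos 1) / 16 * s ^+ 2 <= (1 - cos 1) / 16 * 16.
  by rewrite ler_wpM2l// divr_ge0// subr_ge0 ltW.
lra.
Qed.

Lemma cos_shift_int (R : realType) (x : R) (k : int) :
  cos (2 * pi * (x - k%:~R)) = cos (2 * pi * x).
Proof.
have H (n : nat) (y : R) : cos (2 * pi * (y + n%:R)) = cos (2 * pi * y).
  rewrite mulrDr -(periodicn (@cosD2pi R) n (2 * pi * y)); congr (cos (_ + _)).
  by rewrite -mulrnA -[RHS]mulr_natr natrM; ring.
case: k => n; first by rewrite -[in RHS](subrK (n%:R) x) H.
by rewrite NegzE mulrNz opprK -pmulrn H.
Qed.

Lemma sum_sin_diff (R : realType) (J : nat) (s : R) :
  \sum_(j < J) \sum_(l < J) sin ((j%:R - l%:R) * s) = 0.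
Proof.
set S := LHS; suff : S = - S by lra.
rewrite {1}/S exchange_big /= -sumrN; apply: eq_bigr => j _; rewrite -sumrN.
by apply: eq_bigr => l _; rewrite -sinN -mulNr opprB.
Qed.

(** The squared modulus of the geometric sum of [exp(i j s)] over [j < J], that is, [J] times the
    Fejer kernel. *)
Definition dirichlet_sq (R : realType) (J : nat) (s : R) : R :=
  (\sum_(j < J) cos (j%:R * s)) ^+ 2 + (\sum_(j < J) sin (j%:R * s)) ^+ 2.

(** This is why times are sampled at differences [j - l]: the sine part cancels by antisymmetry and
    a nonnegative kernel remains. *)
Lemma sum_cos_diff (R : realType) (J : nat) (A s : R) :
  \sum_(j < J) \sum_(l < J) cos (A + (j%:R - l%:R) * s) = cos A * dirichlet_sq J s.
Proof.
transitivity (cos A * \sum_(j < J) \sum_(l < J) cos ((j%:R - l%:R) * s) -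
    sin A * \sum_(j < J) \sum_(l < J) sin ((j%:R - l%:R) * s)).
  rewrite !mulr_sumr -sumrB; apply: eq_bigr => j _.
  by rewrite !mulr_sumr -sumrB; apply: eq_bigr => l _; rewrite cosD.
rewrite sum_sin_diff mulr0 subr0; congr (_ * _).
rewrite /dirichlet_sq !expr2 !mulr_suml -big_split; apply: eq_bigr => j _ /=.
rewrite !mulr_sumr -big_split; apply: eq_bigr => l _ /=.
by rewrite mulrBl cosB.
Qed.

(** Multiplying the geometric sum by [1 - exp(i s)] telescopes to [1 - exp(i J s)]; [hC] and [hS]
    are the real and imaginary parts. The squared moduli are [2 - 2 cos s] and at most 4. *)
Lemma dirichlet_sq_bound (R : realType) (J : nat) (s : R) :
  (1 - cos s) * dirichlet_sq J s <= 2.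
Proof.
set C := \sum_(j < J) cos (j%:R * s); set S := \sum_(j < J) sin (j%:R * s).
have tele (f : nat -> R) : \sum_(j < J) (f j - f j.+1) = f 0%N - f J.
  elim: J {C S} => [|J ih]; first by rewrite big_ord0 subrr.
  by rewrite big_ord_recr /= ih; ring.
have hC : C - (cos s * C - sin s * S) = 1 - cos (J%:R * s).
  have := tele (fun j => cos (j%:R * s)); rewrite mul0r cos0 => <-.
  rewrite /C /S !mulr_sumr -!sumrB; apply: eq_bigr => j _.
  by rewrite -natr1 mulrDl mul1r cosD; ring.
have hS : S - (sin s * C + cos s * S) = - sin (J%:R * s).
  have := tele (fun j => sin (j%:R * s)); rewrite mul0r sin0 sub0r => <-.
  rewrite /C /S !mulr_sumr -big_split -sumrB; apply: eq_bigr => j _ /=.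
  by rewrite -natr1 mulrDl mul1r sinD; ring.
have E : (2 - 2 * cos s) * dirichlet_sq J s =
    (C - (cos s * C - sin s * S)) ^+ 2 + (S - (sin s * C + cos s * S)) ^+ 2.
  rewrite /dirichlet_sq -/C -/S.
  have -> : (C - (cos s * C - sin s * S)) ^+ 2 + (S - (sin s * C + cos s * S)) ^+ 2 =
    (1 + (cos s ^+ 2 + sin s ^+ 2) - 2 * cos s) * (C ^+ 2 + S ^+ 2) by ring.
  by rewrite cos2Dsin2; ring.
have := cos2Dsin2 (J%:R * s); have := cos_geN1 (J%:R * s).
rewrite hC hS in E; lra.
Qed.

(** * Squared trigonometric polynomials sampled along a linear flow *)

Section trig_poly.
Context (R : realType) (n N : nat).
Implicit Types (b : {ffun 'I_n -> 'I_N.+1} -> R) (x : 'rV[R]_n).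
Local Notation Z := {ffun 'I_n -> 'I_N.+1}.

Definition pairing (z : Z) x : R := 2 * pi * \sum_i (z i)%:R * x 0 i.

(* [|\sum_z b z exp(2 i pi z.x)|^2] *)
Definition trig_sq b x : R :=
  (\sum_z b z * cos (pairing z x)) ^+ 2 + (\sum_z b z * sin (pairing z x)) ^+ 2.

Lemma trig_sq_expand b x :
  trig_sq b x = \sum_z \sum_z' b z * b z' * cos (pairing z x - pairing z' x).
Proof.
rewrite /trig_sq !expr2 !mulr_suml -big_split; apply: eq_bigr => z _ /=.
rewrite !mulr_sumr -big_split; apply: eq_bigr => z' _ /=.
by rewrite cosB; ring.
Qed.

Lemma pairing_line z x (t : R) w : pairing z (x + t *: w) = pairing z x + t * pairing z w.
Proof.
rewrite /pairing mulrCA -mulrDr; congr (_ * _); rewrite mulr_sumr -big_split.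
by apply: eq_bigr => i _ /=; rewrite !mxE; ring.
Qed.

Lemma trig_sq_average b x w (J : nat) :
  \sum_(j < J) \sum_(l < J) trig_sq b (x + (j%:R - l%:R) *: w) =
  \sum_z \sum_z' b z * b z' * (cos (pairing z x - pairing z' x) *
     dirichlet_sq J (pairing z w - pairing z' w)).
Proof.
under eq_bigr do under eq_bigr do rewrite trig_sq_expand.
transitivity (\sum_(j < J) \sum_z \sum_z' \sum_(l < J)
    b z * b z' * cos (pairing z (x + (j%:R - l%:R) *: w) - pairing z' (x + (j%:R - l%:R) *: w))).
  apply: eq_bigr => j _; rewrite exchange_big; apply: eq_bigr => z _; exact: exchange_big.
rewrite exchange_big; apply: eq_bigr => z _; rewrite exchange_big; apply: eq_bigr => z' _ /=.
rewrite -sum_cos_diff mulr_sumr; apply: eq_bigr => j _; rewrite mulr_sumr; apply: eq_bigr => l _.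
by congr (_ * cos _); rewrite !pairing_line; ring.
Qed.

(** The diagonal [z = z'] contributes exactly [J^2 sum b^2]. Off the diagonal, [|b z * b z'|] is at
    most the mean of the squares, which costs a factor equal to the number of frequencies. *)
Lemma trig_sq_average_bound b x w (J : nat) (ep : R) : 0 <= ep ->
  (forall z z' : Z, z != z' -> dirichlet_sq J (pairing z w - pairing z' w) <= ep * J%:R ^+ 2) ->
  `|\sum_(j < J) \sum_(l < J) trig_sq b (x + (j%:R - l%:R) *: w) - J%:R ^+ 2 * \sum_z b z ^+ 2|
    <= ep * J%:R ^+ 2 * #|{: Z}|%:R * \sum_z b z ^+ 2.
Proof.
move=> ep0 hD; rewrite trig_sq_average.
have D0 (s : R) : 0 <= dirichlet_sq J s by rewrite addr_ge0 ?sqr_ge0.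
have DJ : dirichlet_sq J 0 = J%:R ^+ 2 :> R.
  rewrite /dirichlet_sq; under eq_bigr do rewrite mulr0 cos0.
  under [X in _ + X ^+ 2]eq_bigr do rewrite mulr0 sin0.
  by rewrite sumr_const card_ord big1// expr0n/= addr0 -mulr_natr mul1r.
have -> : \sum_z \sum_z' b z * b z' * (cos (pairing z x - pairing z' x) *
     dirichlet_sq J (pairing z w - pairing z' w)) - J%:R ^+ 2 * \sum_z b z ^+ 2 =
   \sum_z \sum_(z' | z' != z) b z * b z' * (cos (pairing z x - pairing z' x) *
     dirichlet_sq J (pairing z w - pairing z' w)).
  rewrite mulr_sumr -sumrB; apply: eq_bigr => z _.
  by rewrite (bigD1 z)//= !subrr cos0 DJ mul1r; ring.
apply: le_trans (ler_norm_sum _ _ _) _.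
apply: (@le_trans _ _ (\sum_z \sum_z' ep * J%:R ^+ 2 * ((b z ^+ 2 + b z' ^+ 2) / 2))).
  apply: ler_sum => z _; apply: le_trans (ler_norm_sum _ _ _) _.
  rewrite [leRHS](bigD1 z)//= ler_wpDl//.
    apply: mulr_ge0; first exact: mulr_ge0 ep0 (sqr_ge0 _).
    exact: divr_ge0 (addr_ge0 (sqr_ge0 _) (sqr_ge0 _)) (ler0n _ _).
  apply: ler_sum => z' zz'; rewrite normrM mulrC ler_pM//.
    rewrite normrM (ger0_norm (D0 _)) -[leRHS]mul1r ler_pM//; first exact: cos_max.
    by apply: hD; rewrite eq_sym.
  rewrite ler_norml; have := sqr_ge0 (b z - b z'); have := sqr_ge0 (b z + b z').
  by rewrite !expr2; lra.
have -> : \sum_z \sum_z' ep * J%:R ^+ 2 * ((b z ^+ 2 + b z' ^+ 2) / 2) =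
    ep * J%:R ^+ 2 * \sum_z \sum_z' (b z ^+ 2 / 2 + b z' ^+ 2 / 2).
  rewrite mulr_sumr; apply: eq_bigr => z _; rewrite mulr_sumr; apply: eq_bigr => z' _.
  by field.
rewrite -[leRHS]mulrA ler_wpM2l//; first exact: mulr_ge0 ep0 (sqr_ge0 _).
under eq_bigr do rewrite big_split/= sumr_const.
by rewrite big_split/= sumr_const sumrMnl -mulrnDl -mulr_suml -splitr mulr_natl lexx.
Qed.

End trig_poly.

Section shift.
Context (R : realType) (n N : nat).
Local Notation Z := {ffun 'I_n -> 'I_N.+1}.

(** The shift is cyclic so that it is a bijection of the index set; the wrap-around is harmless for
    coefficients vanishing at the last index. *)
Definition cyc_up (i : 'I_n) (z : Z) : Z := [ffun k => if k == i then ordS (z k) else z k].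
Definition cyc_down (i : 'I_n) (z : Z) : Z := [ffun k => if k == i then ord_pred (z k) else z k].

Lemma cyc_upK i : cancel (cyc_up i) (cyc_down i).
Proof. by move=> z; apply/ffunP => k; rewrite !ffunE; case: eqP => // _; rewrite ordSK. Qed.

Lemma cyc_downK i : cancel (cyc_down i) (cyc_up i).
Proof. by move=> z; apply/ffunP => k; rewrite !ffunE; case: eqP => // _; rewrite ord_predK. Qed.

Lemma pairing_cyc_up (i : 'I_n) (z : Z) (x : 'rV[R]_n) : z i != ord_max ->
  pairing (cyc_up i z) x = pairing z x + 2 * pi * x 0 i.
Proof.
move=> zi; rewrite /pairing -mulrDr; congr (_ * _).
rewrite (bigD1 i)//= [in RHS](bigD1 i)//= ffunE eqxx addrAC; congr (_ + _).
  have -> : (ordS (z i) : nat) = (z i).+1.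
    rewrite /= modn_small// ltnS ltn_neqAle -ltnS ltn_ord andbT.
    by move: zi; apply: contra_neq => zi; apply: val_inj.
  by rewrite -natr1; ring.
by apply: eq_bigr => k ki; rewrite ffunE (negPf ki).
Qed.

(** Shifting the coefficients along [i] multiplies the polynomial by [exp(2 i pi x_i)], so the
    difference multiplies it by [1 - exp(2 i pi x_i)], whose squared modulus is
    [2 - 2 cos (2 pi x_i)]. *)
Lemma trig_sq_shift (a : Z -> R) (i : 'I_n) (x : 'rV[R]_n) :
  (forall z : Z, z i = ord_max -> a z = 0) ->
  trig_sq (fun z => a z - a (cyc_down i z)) x = (2 - 2 * cos (2 * pi * x 0 i)) * trig_sq a x.
Proof.
move=> a0.
have bij : {on [pred _ | true], bijective (cyc_up i)}.
  by apply: onW_bij; exists (cyc_down i); [exact: cyc_upK|exact: cyc_downK].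
rewrite /trig_sq.
set C := \sum_z a z * cos _; set S := \sum_z a z * sin _.
set X := 2 * pi * x 0 i.
have -> : \sum_z (a z - a (cyc_down i z)) * cos (pairing z x) = C - (cos X * C - sin X * S).
  under eq_bigr do rewrite mulrBl.
  rewrite sumrB; congr (_ - _); rewrite (reindex (cyc_up i))//=.
  rewrite /C /S !mulr_sumr -sumrB; apply: eq_bigr => z _; rewrite cyc_upK.
  have [/a0 ->|zi] := eqVneq (z i) ord_max; first by rewrite !mul0r !mulr0 subrr.
  by rewrite (pairing_cyc_up _ zi) cosD; ring.
have -> : \sum_z (a z - a (cyc_down i z)) * sin (pairing z x) = S - (sin X * C + cos X * S).
  under eq_bigr do rewrite mulrBl.
  rewrite sumrB; congr (_ - _); rewrite (reindex (cyc_up i))//=.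
  rewrite /C /S !mulr_sumr -big_split; apply: eq_bigr => z _; rewrite cyc_upK /=.
  have [/a0 ->|zi] := eqVneq (z i) ord_max; first by rewrite !mul0r !mulr0 addr0.
  by rewrite (pairing_cyc_up _ zi) sinD; ring.
have -> : (C - (cos X * C - sin X * S)) ^+ 2 + (S - (sin X * C + cos X * S)) ^+ 2 =
    (1 + (cos X ^+ 2 + sin X ^+ 2) - 2 * cos X) * (C ^+ 2 + S ^+ 2) by ring.
by rewrite cos2Dsin2; ring.
Qed.

Lemma sum_prod_sqr (g : 'I_n -> 'I_N.+1 -> R) :
  \sum_(z : Z) (\prod_k g k (z k)) ^+ 2 = \prod_k \sum_j g k j ^+ 2.
Proof.
rewrite bigA_distr_bigA /=; apply: eq_bigr => z _.
by rewrite -prodrXl.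
Qed.

Lemma prod_shift (t : 'I_N.+1 -> R) (i : 'I_n) (z : Z) :
  \prod_k t (z k) - \prod_k t (cyc_down i z k) =
  \prod_k (if k == i then t (z k) - t (ord_pred (z k)) else t (z k)).
Proof.
rewrite (bigD1 i)//= [X in _ - X](bigD1 i)//= [RHS](bigD1 i)//= ffunE eqxx mulrBl.
congr (_ * _ - _ * _); apply: eq_bigr => k /negPf ki; last by rewrite ffunE ki.
by rewrite ki.
Qed.

End shift.

(** Vanishes at both ends [0] and [2 * m], as the cyclic shift requires. Its square sum is at least
    [m^3 / 3] and that of its differences at most [3 m]; the ratio [9 / m^2] localises at scale
    [1 / m]. *)
Definition tent (m j : nat) : nat := minn j (2 * m - j).

Lemma sum_sqr_ge (m : nat) : (m ^ 3 <= 3 * \sum_(j < m.+1) j ^ 2)%N.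
Proof.
elim: m => [|m ih]; first by rewrite exp0n.
rewrite big_ord_recr /= mulnDr; move: (\sum_(j < m.+1) j ^ 2)%N ih => S ih.
by move: ih; rewrite !expnS !expn0; nia.
Qed.

Lemma tent_sqr_sum (R : realType) (m : nat) :
  m%:R ^+ 3 <= 3 * \sum_(j < (2 * m).+1) ((tent m j)%:R : R) ^+ 2.
Proof.
have h : (m ^ 3 <= 3 * \sum_(j < (2 * m).+1) tent m j ^ 2)%N.
  apply: leq_trans (sum_sqr_ge m) _; rewrite leq_mul2l /=.
  rewrite -!(big_mkord xpredT (fun j => j ^ 2)%N) -(big_mkord xpredT (fun j => tent m j ^ 2)%N).
  rewrite [leqRHS](@big_cat_nat _ _ _ m.+1)//=; last by rewrite ltnS; lia.
  rewrite -[leqLHS]addn0 leq_add// !big_nat leq_sum// => j jm.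
  by rewrite leq_sqr /tent; lia.
rewrite -(ler_nat R) natrX natrM natr_sum in h.
by apply: le_trans h _; rewrite ler_wpM2l//; apply: ler_sum => j _; rewrite natrX.
Qed.

Lemma tent_diff_sum (R : realType) (m : nat) : (0 < m)%N ->
  \sum_(j < (2 * m).+1) ((tent m j)%:R - (tent m (ord_pred j))%:R : R) ^+ 2 <= 3 * m%:R.
Proof.
move=> m0; apply: (@le_trans _ _ (\sum_(j < (2 * m).+1) 1)).
  apply: ler_sum => j _.
  have h : (tent m j <= (tent m (ord_pred j)).+1)%N /\ (tent m (ord_pred j) <= (tent m j).+1)%N.
    (* At [j = 0] the cyclic predecessor is [2 * m], where [tent] vanishes too. *)
    have [j0|j0] := posnP j.
      have -> : (ord_pred j : nat) = (2 * m)%N by rewrite /= j0 add0n /= modn_small.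
      by rewrite j0 /tent; lia.
    have -> : (ord_pred j : nat) = (j.-1)%N.
      rewrite /=; have -> : (j + (2 * m).+1).-1 = (j.-1 + (2 * m).+1)%N by lia.
      by rewrite modnDr modn_small//; have := ltn_ord j; lia.
    by rewrite /tent; have := ltn_ord j; lia.
  move: h; rewrite -!(ler_nat R) -!natr1; move: (_%:R) (_%:R) => p q [h1 h2].
  rewrite -(expr1n _ 2) -[leRHS]real_normK ?num_real// -[leLHS]real_normK ?num_real//.
  by rewrite ler_pXn2r ?nnegrE// normr1 ler_norml; lra.
rewrite sumr_const card_ord -natrM ler_nat; lia.
Qed.

(** A weighted mean argument: with [trig_sq a] as weight, the mean of the sum over [i] of
    [2 - 2 cos (2 pi X_i)] is a quotient of averages of [trig_sq (b i)] and [trig_sq a]. These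
    averages are known up to a factor in [[1/2, 3/2]], so some sample does not exceed the
    quotient. *)
Lemma trig_sample (R : realType) (n m J : nat) (ep : R) (x w : 'rV[R]_n) :
  (0 < n)%N -> (0 < m)%N -> (0 < J)%N -> 0 <= ep ->
  ep * ((2 * m).+1 ^ n)%:R <= 2^-1 ->
  (forall z z' : {ffun 'I_n -> 'I_(2 * m).+1}, z != z' ->
    dirichlet_sq J (pairing z w - pairing z' w) <= ep * J%:R ^+ 2) ->
  exists j l : 'I_J, forall i : 'I_n,
    2 - 2 * cos (2 * pi * (x + (j%:R - l%:R) *: w) 0 i) <= 28 * n%:R / m%:R ^+ 2.
Proof.
move=> n0 m0 J0 ep0 epZ hD.
pose Z := {ffun 'I_n -> 'I_(2 * m).+1}.
pose t (j : 'I_(2 * m).+1) : R := (tent m j)%:R.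
pose a (z : Z) := \prod_k t (z k).
pose b i (z : Z) := a z - a (cyc_down i z).
pose A := \sum_z a z ^+ 2.
pose S := \sum_j t j ^+ 2.
have mR : 0 < m%:R :> R by rewrite ltr0n.
have S0 : 0 < S.
  have := tent_sqr_sum R m; rewrite -/S; have : 0 < m%:R ^+ 3 :> R by rewrite exprn_gt0.
  lra.
have AE : A = S ^+ n.
  by rewrite /A /a (sum_prod_sqr (fun _ => t)) prodr_const card_ord.
have A0 : 0 < A by rewrite AE exprn_gt0.
have bE i : \sum_z b i z ^+ 2 <= 9 / m%:R ^+ 2 * A.
  rewrite /b /a; under eq_bigr do rewrite prod_shift.
  rewrite (sum_prod_sqr (fun k j => if k == i then t j - t (ord_pred j) else t j)).
  rewrite AE (bigD1 i)//= eqxx.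
  have -> : \prod_(k < n | k != i) \sum_j (if k == i then t j - t (ord_pred j) else t j) ^+ 2 =
      \prod_(k < n | k != i) S.
    by apply: eq_bigr => k /negPf ->.
  have -> : S ^+ n = S * \prod_(k < n | k != i) S.
    by transitivity (\prod_(k < n) S); [rewrite prodr_const card_ord|rewrite (bigD1 i)].
  rewrite mulrA ler_wpM2r//; first by rewrite prodr_ge0// => k _; rewrite ltW.
  apply: le_trans (tent_diff_sum R m0) _.
  have h : m%:R ^+ 3 <= 3 * S := tent_sqr_sum R m.
  have -> : 9 / m%:R ^+ 2 * S = 3 / m%:R ^+ 2 * (3 * S) by ring.
  apply: le_trans (ler_wpM2l _ h); last by rewrite divr_ge0// exprn_ge0// ltW.
  by rewrite (_ : 3 / m%:R ^+ 2 * m%:R ^+ 3 = 3 * m%:R)//; field; rewrite gt_eqF.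
pose X (j l : 'I_J) := x + (j%:R - l%:R) *: w.
have J2 : 0 < J%:R ^+ 2 :> R by rewrite exprn_gt0// ltr0n.
have cardZ : #|{: Z}| = ((2 * m).+1 ^ n)%N by rewrite card_ffun !card_ord.
have avg (d : Z -> R) : `|\sum_(j < J) \sum_(l < J) trig_sq d (X j l) - J%:R ^+ 2 * \sum_z d z ^+ 2|
    <= 2^-1 * J%:R ^+ 2 * \sum_z d z ^+ 2.
  apply: le_trans (trig_sq_average_bound d x ep0 hD) _.
  rewrite ler_wpM2r//; first by rewrite sumr_ge0// => z _; rewrite sqr_ge0.
  by rewrite mulrAC ler_wpM2r ?sqr_ge0// cardZ.
have avga : 2^-1 * J%:R ^+ 2 * A <= \sum_(j < J) \sum_(l < J) trig_sq a (X j l).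
  by have := avg a; rewrite ler_norml -/A => /andP[h _]; lra.
have avgb i : \sum_(j < J) \sum_(l < J) trig_sq (b i) (X j l) <= 27 / 2 / m%:R ^+ 2 * (J%:R ^+ 2 * A).
  have := avg (b i); rewrite ler_norml => /andP[_ h].
  have := ler_wpM2l (ltW J2) (bE i).
  have -> : 27 / 2 / m%:R ^+ 2 * (J%:R ^+ 2 * A) = 3 / 2 * (J%:R ^+ 2 * (9 / m%:R ^+ 2 * A)) by field; rewrite gt_eqF.
  lra.
have P0 (d : Z -> R) y : 0 <= trig_sq d y by rewrite addr_ge0 ?sqr_ge0.
(* The quotient is at most [n * (3/2 * 9 / m^2) / (1/2) = 27 n / m^2]; 28 makes the contradiction
   strict. *)
pose K := 28 * n%:R / m%:R ^+ 2 : R.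
have c0 (s : R) : 0 <= 2 - 2 * cos s by have := cos_le1 s; lra.
have [|] := pselect (exists j l : 'I_J,
    \sum_i (2 - 2 * cos (2 * pi * (X j l) 0 i)) <= K).
  move=> [j [l h]]; exists j, l => i; apply: le_trans h.
  by rewrite (bigD1 i)//= lerDl sumr_ge0.
move=> no; exfalso.
have big (j l : 'I_J) : K * trig_sq a (X j l) <= \sum_i trig_sq (b i) (X j l).
  have aN i (z : Z) : z i = ord_max -> a z = 0.
    move=> zi; rewrite /a (bigD1 i)//= zi /t /tent /= subnn minn0.
    by rewrite mul0r.
  under eq_bigr do rewrite (trig_sq_shift _ (aN _)).
  rewrite -mulr_suml ler_wpM2r//; rewrite leNgt; apply/negP => /ltW h.
  by apply: no; exists j, l.
have : K * (2^-1 * J%:R ^+ 2 * A) <= \sum_(i < n) 27 / 2 / m%:R ^+ 2 * (J%:R ^+ 2 * A).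
  have K0 : 0 <= K by rewrite divr_ge0 ?exprn_ge0// ?mulr_ge0// ltW.
  apply: le_trans (ler_wpM2l K0 avga) _.
  apply: (@le_trans _ _ (\sum_i \sum_(j < J) \sum_(l < J) trig_sq (b i) (X j l))); last first.
    by apply: ler_sum => i _; exact: avgb.
  rewrite [leRHS]exchange_big mulr_sumr; apply: ler_sum => j _.
  rewrite [leRHS]exchange_big mulr_sumr; apply: ler_sum => l _; exact: big.
have SE (y : R) : \sum_(i < n) y = n%:R * y by rewrite sumr_const card_ord mulr_natl.
rewrite SE /K => h.
have nA : 0 < n%:R / m%:R ^+ 2 * (J%:R ^+ 2 * A).
  by rewrite mulr_gt0 ?divr_gt0 ?ltr0n ?exprn_gt0// mulr_gt0.
have e1 : 28 * n%:R / m%:R ^+ 2 * (2^-1 * J%:R ^+ 2 * A) = 14 * (n%:R / m%:R ^+ 2 * (J%:R ^+ 2 * A)).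
  by field; rewrite gt_eqF.
have e2 : n%:R * (27 / 2 / m%:R ^+ 2 * (J%:R ^+ 2 * A)) = 27 / 2 * (n%:R / m%:R ^+ 2 * (J%:R ^+ 2 * A)).
  by field; rewrite gt_eqF.
rewrite e1 e2 in h; lra.
Qed.

(** * Quantitative density of Diophantine linear flows *)

Lemma nearest_int (R : realType) (x : R) : exists k : int, `|x - k%:~R| <= 2^-1.
Proof.
exists (Num.floor (x + 2^-1)).
have h1 := ge_floor (x + 2^-1); have h2 := floorD1_gt (x + 2^-1).
rewrite intrD1 in h2; rewrite ler_norml; lra.
Qed.

(** Treated apart because [n <= 2 * eta], on which the general argument rests, follows from
    [n - 1 < eta] only when [n >= 2]. On the circle the speed is at least [nu] and every point is
    met within one turn. *)
Lemma ergodization1 (R : realType) (omega : 'rV[R]_1) (nu eta : R) :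
  0 < nu -> diophantine nu eta omega ->
  forall th : 'rV[R]_1, exists (t : R) (k : 'rV[int]_1),
    0 <= t <= nu^-1 /\ th + t *: omega = intvec k.
Proof.
move=> nu0 dio th.
have nuo : nu <= `|omega 0 0|.
  have := dio (const_mx 1); rewrite !big_ord1 !mxE normr1 powR1 !mulr1; apply.
  by apply/eqP => /matrixP/(_ 0 0); rewrite !mxE.
have o0 : omega 0 0 != 0 by rewrite -normr_gt0 (lt_le_trans nu0).
have [y [y0 [y1 [k yk]]]] : exists y : R, 0 <= y /\ y <= 1 /\ exists k : int,
    th 0 0 + Num.sg (omega 0 0) * y = k%:~R.
  have h1 := ge_floor (th 0 0); have h2 := floorD1_gt (th 0 0); rewrite intrD1 in h2.
  case: (ltgtP (omega 0 0) 0) o0 => // om _.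
    exists (th 0 0 - (Num.floor (th 0 0))%:~R); rewrite ltr0_sg//.
    by do 2 (split; first lra); exists (Num.floor (th 0 0)); ring.
  exists ((Num.floor (th 0 0))%:~R + 1 - th 0 0); rewrite gtr0_sg//.
  by do 2 (split; first lra); exists (Num.floor (th 0 0) + 1); rewrite intrD; ring.
exists (y / `|omega 0 0|), (const_mx k); split.
  rewrite divr_ge0//=; apply: (@le_trans _ _ (`|omega 0 0|^-1)).
    by rewrite ler_piMl// invr_ge0.
  by rewrite lef_pV2 ?posrE// (lt_le_trans nu0).
apply/rowP => i; rewrite (ord1 i) !mxE -yk; congr (_ + _).
rewrite [X in _ * X = _]numEsg; field.
by rewrite normr_eq0.
Qed.

(** A difference of two frequencies has [l^1] norm at most [2 n m], so the Diophantine condition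
    bounds its product with [omega] from below. The small time step [tau] keeps the phase in
    [[- pi, pi]], where [1 - cos] is bounded below quadratically, and [dirichlet_sq_bound]
    concludes. *)
Lemma diophantine_dirichlet (R : realType) (n m J : nat) (omega : 'rV[R]_n) (nu eta tau ck : R)
    (z z' : {ffun 'I_n -> 'I_(2 * m).+1}) :
  (0 < n)%N -> (0 < m)%N -> 0 < nu -> 0 < eta -> diophantine nu eta omega ->
  0 < ck -> (forall s : R, `|s| <= pi -> ck * s ^+ 2 <= 1 - cos s) ->
  0 < tau -> tau * (`|omega| * (2 * n%:R * m%:R)) <= 2^-1 -> z != z' ->
  dirichlet_sq J (pairing z (tau *: omega) - pairing z' (tau *: omega)) <=
    (8 * ck * (tau * (nu / (2 * n%:R * m%:R) `^ eta)) ^+ 2)^-1.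
Proof.
move=> n0 m0 nu0 eta0 dio ck0 ckP tau0 taus zz'.
have nR : 1 <= n%:R :> R by rewrite ler1n.
have mR : 1 <= m%:R :> R by rewrite ler1n.
pose zeta : 'rV[int]_n := \row_i ((z i : nat)%:Z - (z' i : nat)%:Z).
have zetaE i : ((zeta 0 i)%:~R : R) = (z i)%:R - (z' i)%:R by rewrite mxE intrD mulrNz -!pmulrn.
have zeta0 : zeta != 0.
  apply: contra_neq zz' => z0; apply/ffunP => i; apply: val_inj => /=.
  have /rowP/(_ i) := z0; rewrite !mxE => /eqP; rewrite subr_eq0 => /eqP.
  by move=> [].
pose q := \sum_i omega 0 i * (zeta 0 i)%:~R.
have sE : pairing z (tau *: omega) - pairing z' (tau *: omega) = 2 * pi * (tau * q).
  rewrite /pairing -mulrBr -sumrB; congr (_ * _); rewrite mulr_sumr; apply: eq_bigr => i _.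
  by rewrite zetaE !mxE; ring.
have zm i : `|(zeta 0 i)%:~R : R| <= 2 * m%:R.
  rewrite zetaE.
  have b (y : 'I_(2 * m).+1) : 0 <= ((y : nat)%:R : R) <= 2 * m%:R.
    by rewrite ler0n /= -natrM ler_nat -ltnS ltn_ord.
  have := b (z i); have := b (z' i); rewrite ler_norml; lra.
pose l := \sum_i `|(zeta 0 i)%:~R : R|.
have lle : l <= 2 * n%:R * m%:R.
  apply: (@le_trans _ _ (\sum_(i < n) 2 * m%:R)); first by apply: ler_sum.
  by rewrite sumr_const card_ord -[X in X <= _]mulr_natl; lra.
have l1 : 1 <= l.
  have /rV0Pn[i zi] := zeta0.
  rewrite /l (bigD1 i)//=; apply: (@le_trans _ _ `|(zeta 0 i)%:~R : R|).
    rewrite -intr_norm -[1](mulr1z 1) ler_int.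
    by rewrite -gtz0_ge1 normr_gt0.
  by rewrite lerDl sumr_ge0.
set q0 := nu / _.
have D0 : 0 < 2 * n%:R * m%:R :> R by rewrite !mulr_gt0// (lt_le_trans ltr01).
have q00 : 0 < q0 by rewrite divr_gt0// powR_gt0.
have qlow : q0 <= `|q|.
  apply: le_trans (dio zeta zeta0); rewrite -/l /q0 powRN.
  apply: ler_wpM2l; first exact: ltW.
  rewrite lef_pV2 ?posrE ?powR_gt0//; last exact: lt_le_trans l1.
  have l0 : 0 <= l := le_trans ler01 l1.
  by apply: ge0_ler_powR => //; [exact: ltW|rewrite nnegrE ltW].
have qup : `|q| <= `|omega| * (2 * n%:R * m%:R).
  apply: le_trans (ler_norm_sum _ _ _) _.
  apply: (@le_trans _ _ (`|omega| * l)); last exact: ler_wpM2l.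
  rewrite /l mulr_sumr; apply: ler_sum => i _; rewrite normrM; apply: ler_wpM2r => //.
  exact: norm_coord.
set s := pairing _ _ - _.
have pi2 := pi_ge2 R.
have pp : 0 <= 2 * pi :> R by rewrite mulr_ge0 ?pi_ge0.
have spi : `|s| <= pi.
  rewrite /s sE normrM (ger0_norm pp) normrM (gtr0_norm tau0).
  have : tau * `|q| <= 2^-1 by apply: le_trans taus; rewrite ler_pM2l.
  have := pi_gt0 R; move: (tau * `|q|) => a; nra.
have s2 : 16 * (tau * q0) ^+ 2 <= s ^+ 2.
  rewrite /s sE -[X in _ <= X]real_normK ?num_real// normrM (ger0_norm pp) normrM (gtr0_norm tau0).
  have -> : 16 * (tau * q0) ^+ 2 = (4 * (tau * q0)) ^+ 2 by ring.
  rewrite !expr2; have h : 4 * (tau * q0) <= 2 * pi * (tau * `|q|).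
    apply: ler_pM => //; [by rewrite mulr_ge0// ltW|lra|by rewrite ler_pM2l].
  have h0 : 0 <= 4 * (tau * q0) by rewrite mulr_ge0// mulr_ge0// ltW.
  exact: ler_pM.
have := dirichlet_sq_bound J s; have := ckP s spi.
have Dge : 0 <= dirichlet_sq J s by rewrite addr_ge0 ?sqr_ge0.
move: (dirichlet_sq J s) Dge => D Dge h1 h2.
have tq : 0 < (tau * q0) ^+ 2 by rewrite exprn_gt0// mulr_gt0.
have h3 : 8 * ck * (tau * q0) ^+ 2 * D <= 1.
  have : ck * (16 * (tau * q0) ^+ 2) * D <= 2.
    apply: le_trans h2; apply: ler_wpM2r => //; apply: le_trans h1.
    by apply: ler_wpM2l => //; exact: ltW.
  lra.
have p8 : 0 < 8 * ck * (tau * q0) ^+ 2 by rewrite mulr_gt0// mulr_gt0.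
by rewrite -[X in _ <= X]mulr1 ler_pdivlMl.
Qed.

Lemma ergodization (R : realType) (n : nat) (omega : 'rV[R]_n) (nu eta : R) :
  (0 < n)%N -> 0 < nu -> n%:R - 1 < eta -> diophantine nu eta omega ->
  exists2 Ct : R, 0 < Ct & forall (m : nat) (th : 'rV[R]_n), (0 < m)%N ->
    exists (t : R) (k : 'rV[int]_n), 0 <= t <= Ct * m%:R `^ (2 * eta) /\
      `|th + t *: omega - intvec k| <= Ct / m%:R.
Proof.
case: n omega => // -[|n] omega _ nu0 en dio.
  have eta0 : 0 < eta by lra.
  exists (nu^-1); first by rewrite invr_gt0.
  move=> m th m0; have [t [k [/andP[t0 t1] tk]]] := ergodization1 nu0 dio th.
  exists t, k; split; last first.
    have -> : th + t *: omega - intvec k = 0 by apply/eqP; rewrite subr_eq0; apply/eqP.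
    by rewrite normr0 divr_ge0// invr_ge0 ltW.
  rewrite t0 /=; apply: le_trans t1 _; apply: ler_peMr; first by rewrite invr_ge0 ltW.
  rewrite -[X in X <= _](powRr0 m%:R) ler_powR ?ler1n//; lra.
move: n omega en dio => n' omega en dio; set n := n'.+2 in omega en dio *.
have n0 : (0 < n)%N by [].
have nR : 2 <= n%:R :> R by rewrite ler_nat.
have eta0 : 0 < eta by lra.
have [ck ck0 ckP] := cos_quadratic_bound R.
pose G : R := (2 * n%:R) `^ eta.
have G0 : 0 < G by rewrite powR_gt0// mulr_gt0// ltr0n.
(* Solves [8 ck nu^2 / G^2 * Y = 2 * 3^n]: the averaging time then beats the count
   [(2 m + 1)^n <= 3^n m^(2 eta)] of frequencies. *)
pose Y := 3 ^+ n * G ^+ 2 / (4 * ck * nu ^+ 2).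
have Y0 : 0 <= Y.
  apply: divr_ge0; apply: mulr_ge0; [by rewrite exprn_ge0|exact: sqr_ge0| |exact: sqr_ge0].
  by rewrite mulr_ge0// ltW.
pose C2 := n%:R / ck + 1.
have C20 : 1 <= C2 by rewrite /C2 lerDr divr_ge0// ltW.
exists (2 * (Y + 1) + 2 + C2); first by lra.
move=> m th m0.
have mR : 1 <= m%:R :> R by rewrite ler1n.
have m00 : 0 < m%:R :> R by rewrite ltr0n.
pose mE : R := m%:R `^ eta.
have mE1 : 1 <= mE.
  by rewrite /mE -[X in X <= _](powRr0 m%:R) ler_powR// ltW.
have m2E : m%:R `^ (2 * eta) = mE ^+ 2 by rewrite mulrC powRrM powR_mulrn// powR_ge0.
pose tau := (4 * (`|omega| + 1) * n%:R * m%:R)^-1.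
have o1 : 0 < `|omega| + 1 by rewrite ltr_wpDl.
have den : 0 < 4 * (`|omega| + 1) * n%:R * m%:R by rewrite !mulr_gt0// (lt_le_trans _ nR).
have tau0 : 0 < tau by rewrite invr_gt0.
have tau1 : tau <= 1.
  rewrite invf_le1//.
  have h1 : 1 <= n%:R * m%:R :> R by rewrite -natrM ler1n muln_gt0 m0.
  have := normr_ge0 omega; rewrite -mulrA; nra.
have taus : tau * (`|omega| * (2 * n%:R * m%:R)) <= 2^-1.
  rewrite /tau ler_pdivrMl//; have : 0 <= n%:R * m%:R :> R by rewrite mulr_ge0.
  have := normr_ge0 omega; nra.
pose X := (Y + 1) * mE ^+ 2.
(* The length [J * tau] of the sampled time window lies between [X] and [X + 1], with [X] of order
   [m^(2 eta)]. *)
pose J := (Num.truncn (X / tau)).+1.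
have Xge : 0 <= X by apply: mulr_ge0; [lra|exact: sqr_ge0].
have X0 : 0 <= X / tau by apply: divr_ge0 => //; exact: ltW.
have JX : X <= J%:R * tau.
  by rewrite -ler_pdivrMr// ltW// truncnS_gt.
have JX' : J%:R * tau <= X + 1.
  have : J%:R <= X / tau + 1 by rewrite -natr1 lerD2r truncn_le.
  move=> /(ler_wpM2r (ltW tau0)); rewrite mulrDl mul1r divfK ?gt_eqF//; lra.
pose q0 := nu / (2 * n%:R * m%:R) `^ eta.
have q0E : q0 = nu / (G * mE).
  by rewrite /q0 powRM// mulr_ge0.
have q00 : 0 < q0 by rewrite q0E divr_gt0// mulr_gt0// (lt_le_trans ltr01).
have J0 : 0 < J%:R :> R by rewrite ltr0n.
pose ep := (8 * ck * (tau * q0) ^+ 2)^-1 / J%:R ^+ 2.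
have p8 : 0 < 8 * ck * (tau * q0) ^+ 2.
  by rewrite mulr_gt0// ?exprn_gt0// mulr_gt0.
have ep0 : 0 <= ep by rewrite divr_ge0 ?exprn_ge0// invr_ge0 ltW.
have epZ : ep * ((2 * m).+1 ^ n)%:R <= 2^-1.
  have -> : ep = (8 * ck * ((J%:R * tau) * q0) ^+ 2)^-1.
    rewrite /ep -invfM; congr (_^-1); ring.
  have XE : X * q0 = (Y + 1) * nu * mE / G.
    by rewrite /X q0E; field; rewrite !gt_eqF// (lt_le_trans ltr01).
  have cube : ((2 * m).+1 ^ n)%:R <= 3 ^+ n * mE ^+ 2 :> R.
    rewrite natrX; apply: (@le_trans _ _ ((3 * m%:R) ^+ n)).
      rewrite lerXn2r ?nnegrE ?mulr_ge0//.
      by rewrite -natr1 natrM; lra.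
    rewrite exprMn ler_wpM2l ?exprn_ge0// -m2E -powR_mulrn//.
    by rewrite ler_powR//; lra.
  have lowJ : (X * q0) ^+ 2 <= (J%:R * tau * q0) ^+ 2.
    have Xq : 0 <= X * q0 by apply: mulr_ge0 => //; exact: ltW.
    rewrite !expr2; have h : X * q0 <= J%:R * tau * q0 by rewrite ler_pM2r.
    exact: ler_pM.
  have key : 2 * (3 ^+ n * mE ^+ 2) <= 8 * ck * (X * q0) ^+ 2.
    rewrite XE.
    have -> : 8 * ck * ((Y + 1) * nu * mE / G) ^+ 2 = 8 * ck * nu ^+ 2 / G ^+ 2 * mE ^+ 2 * (Y + 1) ^+ 2.
      by field; rewrite gt_eqF.
    have hY : Y <= (Y + 1) ^+ 2 by nra.
    have -> : 2 * (3 ^+ n * mE ^+ 2) = 8 * ck * nu ^+ 2 / G ^+ 2 * mE ^+ 2 * Y.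
      by rewrite /Y; field; rewrite !gt_eqF.
    apply: ler_wpM2l hY; apply: mulr_ge0; last exact: sqr_ge0.
    apply: divr_ge0; last exact: sqr_ge0.
    by apply: mulr_ge0; [rewrite mulr_ge0// ltW|exact: sqr_ge0].
  have den2 : 0 < 8 * ck * (J%:R * tau * q0) ^+ 2.
    apply: mulr_gt0; first by rewrite mulr_gt0.
    by apply: exprn_gt0; apply: mulr_gt0 => //; exact: mulr_gt0.
  rewrite mulrC ler_pdivrMr//.
  have : 8 * ck * (X * q0) ^+ 2 <= 8 * ck * (J%:R * tau * q0) ^+ 2.
    by apply: ler_wpM2l => //; rewrite mulr_ge0// ltW.
  lra.
have hD (z z' : {ffun 'I_n -> 'I_(2 * m).+1}) : z != z' ->
    dirichlet_sq J (pairing z (tau *: omega) - pairing z' (tau *: omega)) <= ep * J%:R ^+ 2.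
  move=> zz'; rewrite /ep divfK ?expf_eq0/= ?gt_eqF//.
  exact: diophantine_dirichlet.
(* The base point is moved ahead by [J * tau], since [(j - l) * tau] may be as low as nearly
   [- J * tau]; the resulting time is nonnegative and at most [2 J tau]. *)
have [j [l jl]] := trig_sample (th + (J%:R * tau) *: omega) n0 m0 (ltn0Sn _) ep0 epZ hD.
pose t := J%:R * tau + (j%:R - l%:R) * tau.
have tE : th + (J%:R * tau) *: omega + (j%:R - l%:R) *: (tau *: omega) = th + t *: omega.
  by rewrite /t scalerDl addrA scalerA.
have jJ (i : 'I_J) : 0 <= (i%:R : R) <= J%:R by rewrite ler0n ler_nat ltnW.
have t0 : 0 <= t.
  rewrite /t -mulrDl; apply: mulr_ge0; last exact: ltW.
  have := jJ j; have := jJ l; lra.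
have t1 : t <= 2 * (J%:R * tau).
  have : (j%:R - l%:R) * tau <= J%:R * tau.
    by rewrite ler_pM2r//; have := jJ j; have := jJ l; lra.
  by rewrite /t; lra.
pose y := th + t *: omega.
pose k : 'rV[int]_n := \row_i projT1 (cid (nearest_int (y 0 i))).
have kP i : `|y 0 i - (k 0 i)%:~R| <= 2^-1.
  by rewrite /k mxE; exact: (projT2 (cid (nearest_int (y 0 i)))).
exists t, k; split.
  rewrite t0 m2E /=.
  have : 1 <= mE ^+ 2 by rewrite expr2; nra.
  rewrite /X in JX'; have : 0 <= C2 * mE ^+ 2 by rewrite mulr_ge0 ?exprn_ge0//; lra.
  lra.
apply: (@le_trans _ _ (C2 / m%:R)); last first.
  by rewrite ler_wpM2r ?invr_ge0//; lra.
apply: norm_rV_le => [|i]; first by rewrite divr_ge0//; lra.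
have -> : (th + t *: omega - intvec k) 0 i = y 0 i - (k 0 i)%:~R by rewrite !mxE.
have := jl i; rewrite tE -/y -(cos_shift_int (y 0 i) (k 0 i)).
move: (y 0 i - (k 0 i)%:~R) (kP i) => u u2 hu.
have pi2 := pi_ge2 R.
have spi : `|2 * pi * u| <= pi.
  have pp : 0 <= 2 * pi :> R by rewrite mulr_ge0 ?pi_ge0.
  rewrite normrM (ger0_norm pp).
  have := pi_gt0 R; nra.
have h1 := ckP _ spi.
have h2 : 16 * u ^+ 2 <= (2 * pi * u) ^+ 2.
  have -> : (2 * pi * u) ^+ 2 = 4 * pi ^+ 2 * u ^+ 2 by ring.
  by rewrite ler_wpM2r ?sqr_ge0//; nra.
have h3 : ck * (16 * u ^+ 2) <= 14 * n%:R / m%:R ^+ 2.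
  have := ler_wpM2l (ltW ck0) h2; lra.
have h4 : u ^+ 2 <= (C2 / m%:R) ^+ 2.
  have h5 : u ^+ 2 <= n%:R / ck / m%:R ^+ 2.
    rewrite -(ler_pM2l (mulr_gt0 ck0 (ltr0Sn R 15))).
    have -> : ck * 16 * (n%:R / ck / m%:R ^+ 2) = 16 * n%:R / m%:R ^+ 2 by field; rewrite !gt_eqF.
    have : 0 <= n%:R / m%:R ^+ 2 :> R by rewrite divr_ge0 ?exprn_ge0.
    lra.
  apply: le_trans h5 _; rewrite expr_div_n ler_wpM2r ?invr_ge0 ?exprn_ge0//.
  have : 0 <= n%:R / ck by rewrite divr_ge0// ltW.
  rewrite /C2; move: (n%:R / ck) => a; nra.
rewrite -(ler_pXn2r (_ : (0 < 2)%N)) ?nnegrE ?divr_ge0//; last by lra.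
by rewrite real_normK ?num_real.
Qed.

(** * The convergence rate *)

Lemma C1_map_coord_cdiff (R : realType) (n : nat) (Phi : 'rV[R]_n -> phase) (i : 'I_n) :
  C1_map Phi -> cdiff (fun th => (Phi th).1 0 i).
Proof.
move=> [_ dPhi] u; have [du cu] := dPhi u.
have D th : is_derive th u (fun th => (Phi th).1 0 i) (('D_u Phi th).1 0 i).
  have /is_derive_lineP/is_derive_fst [D1 E1] := derivableP (du th).
  apply/is_derive_lineP; split; first by move/derivable_mxP : D1; apply.
  by rewrite -E1 derive_mx// mxE.
split=> [th|]; first by case: (D th).
have -> : 'D_u (fun th => (Phi th).1 0 i) = fun th => ('D_u Phi th).1 0 i.
  by apply/funext => th; case: (D th).
have c1 : continuous (fun th => ('D_u Phi th).1).
  exact: (@cont_comp _ _ _ ('D_u Phi) fst cu (@cont_fst _ _)).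
exact: (@cont_comp _ _ _ _ (fun x : 'rV[R]_n => x 0 i) c1 (@mx_continuous_coord R n i)).
Qed.

(** A box suffices: in the application one angle is brought into the unit cube and the other lies
    within distance 1 of it, hence the values [-1] and [2]. *)
Lemma C1_map_lipschitz (R : realType) (n : nat) (Phi : 'rV[R]_n -> phase) (a b : R) :
  C1_map Phi -> exists2 C : R, 0 < C & forall th th' : 'rV[R]_n,
    (forall i, a <= th 0 i <= b) -> (forall i, a <= th' 0 i <= b) ->
    `|(Phi th).1 - (Phi th').1| <= C * `|th - th'|.
Proof.
move=> C1P.
have H (ij : 'I_n * 'I_n) := compact_ex_bound (@cube_compact R n a b)
  (C1_map_coord_cdiff ij.1 C1P (ev ij.2)).2.
pose K (ij : 'I_n * 'I_n) := projT1 (cid2 (H ij)).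
have K0 ij : 0 < K ij by rewrite /K; case: (cid2 _).
have KP ij (th : 'rV[R]_n) : (forall i, a <= th 0 i <= b) ->
    `|'D_(ev ij.2) (fun th => (Phi th).1 0 ij.1) th| <= K ij.
  by rewrite /K; case: (cid2 _) => /= C _; exact.
exists (\sum_ij K ij + 1).
  by rewrite ltr_wpDl// sumr_ge0// => ij _; exact: ltW.
move=> th th' ab ab'.
have S0 : 0 <= \sum_ij K ij by apply: sumr_ge0 => ij _; exact: ltW.
apply: norm_rV_le => [|i]; first by rewrite mulr_ge0// addr_ge0.
have cf := C1_map_coord_cdiff i C1P.
have [t /andP[t0 t1]] := mvt_segment_line th' (cf (th - th')).1.
rewrite (addrC th') subrK => E.
have -> : ((Phi th).1 - (Phi th').1) 0 i = (Phi th).1 0 i - (Phi th').1 0 i by rewrite !mxE.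
rewrite E; apply: le_trans (cdiff_bound (rV_finspan R n) _ _ cf) _.
apply: ler_wpM2r => //; apply: (@le_trans _ _ (\sum_j K (i, j))).
  apply: ler_sum => j _; apply: (KP (i, j)) => l.
  have /andP[a1 b1] := ab l; have /andP[a2 b2] := ab' l; rewrite !mxE.
  by apply/andP; split; nra.
have -> : \sum_ij K ij = \sum_i \sum_j K (i, j).
  by rewrite pair_big /=; apply: eq_bigr => -[].
rewrite [X in _ <= X + _](bigD1 i)//= -addrA lerDl addr_ge0//.
by apply: sumr_ge0 => j _; apply: sumr_ge0 => l _; exact: ltW.
Qed.

Theorem theorem4p5 (R : realType) (n : nat) (H : 'rV[R]_n -> 'rV[R]_n -> R)
  (c : 'rV[R]_n) (h : R) (v : 'rV[R]_n -> R) (omega : 'rV[R]_n) (nu eta : R) :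
  (0 < n)%N ->
  periodic_ham H -> C2_ham H -> Hpp_posdef H -> superlinear H ->
  visc_sol_torus (cell_eq H c h) v ->
  KAM_torus H c v omega ->
  0 < nu -> (n%:R - 1 < eta) -> diophantine nu eta omega ->
  exists beta : R, 0 < beta /\
    exists eps0 : R, 0 < eps0 /\
      forall eps : R, 0 < eps -> eps < eps0 ->
        forall veps : 'rV[R]_n -> R,
          visc_sol_torus (discounted_eq H c h eps) veps ->
          exists k : R, forall x : 'rV[R]_n,
            `|veps x - (v x + k)| <= beta * eps `^ (1 / (1 + 2 * eta)).
Proof.
move=> n0 pH C2 pd sl solv [_ [inv [Phi [[C1P [perP [_ [_ surjP]]]] orbit]]]] nu0 en dio.
have [cv [pv [subv supv]]] := solv.
have n1 : 1 <= n%:R :> R by rewrite ler1n.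
have eta0 : 0 < eta by lra.
have [K K0 sc] := semiconcave_viscosity n0 pH C2 pd sl solv.
have dense := dense_differentiable cv pv K0 sc.
have [A A0 lowA] := discounted_lower_bound pH C2 sl solv.
have [Lv Lv0 /(_ _ v cv pv subv)LvP] := subsol_lipschitz c h sl.
have {}LvP : forall x y, `|v x - v y| <= Lv * `|x - y|.
  by apply: LvP => x q; rewrite /cell_eq subr_le0.
have [Lu Lu0 LuP] := subsol_lipschitz c (h + A) sl.
have [Cp Cp0 CpP] := C1_map_lipschitz (-1) 2 C1P.
have [Ct Ct0 ergo] := ergodization n0 nu0 en dio.
pose L := Lu + Lv.
have L0 : 0 < L by rewrite addr_gt0.
(* The first term is the growth [eps * A * t] over the orbit time, the second the Lipschitz cost of
   missing the target angle by at most [Ct * r]. *)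
pose beta := A * Ct * 2 `^ (2 * eta) + L * Cp * Ct.
have beta0 : 0 < beta.
  by rewrite addr_gt0// !mulr_gt0// powR_gt0.
have den : 0 < 1 + 2 * eta by lra.
pose al := 1 / (1 + 2 * eta).
have al0 : 0 < al by rewrite divr_gt0.
exists beta; split=> //.
(* Ensures [r < 1] and [Ct * r <= 1]; the latter keeps the orbit angle in the box where [Phi] is
   Lipschitz with constant [Cp]. *)
exists (Num.min 1 ((Ct + 1)^-1 `^ (1 + 2 * eta))).
split; first by rewrite lt_min ltr01 powR_gt0// invr_gt0 addr_gt0.
move=> eps eps0; rewrite lt_min => /andP[eps1 epsC] u solu.
have [cu [pu [subu _]]] := solu.
have uA := lowA eps u eps0 solu.
pose r := eps `^ al.
have r0 : 0 < r by rewrite powR_gt0.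
have rE : r `^ (1 + 2 * eta) = eps.
  by rewrite /r -powRrM /al mul1r mulVf ?gt_eqF// powRr1// ltW.
have r1 : r < 1.
  rewrite ltNge; apply/negP => r1.
  have := eps1; rewrite -rE ltNge => /negP; apply.
  by rewrite -[X in X <= _](powRr0 r) ler_powR// ltW.
have rC : Ct * r <= 1.
  rewrite leNgt; apply/negP => Cr.
  have : (Ct + 1)^-1 <= r.
    by rewrite invf_ple ?posrE ?addr_gt0//; rewrite -[r^-1]mul1r ler_pdivrMr//; nra.
  move=> Cr'; have := epsC; rewrite -rE ltNge => /negP; apply.
  have Ci : 0 <= (Ct + 1)^-1 by rewrite invr_ge0 addr_ge0// ltW.
  by apply: ge0_ler_powR => //; [exact: ltW|rewrite nnegrE ltW].
(* Since [eps < 1], [eps * u] is at least [- A], so [u] is tested at the fixed level [h + A] and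
   [Lu] does not depend on [eps]. *)
have {}LuP : forall x y, `|u x - u y| <= Lu * `|x - y|.
  apply: (LuP _ _ cu pu subu) => x q; rewrite /discounted_eq.
  have := uA x; have : - A <= eps * u x by have := uA x; nra.
  lra.
pose w x := u x - v x.
have wL x y : `|w x - w y| <= L * `|x - y|.
  have -> : w x - w y = (u x - u y) - (v x - v y) by rewrite /w; ring.
  apply: le_trans (ler_normB _ _) _; rewrite /L mulrDl; exact: lerD.
have wP x (k : 'rV[int]_n) : w (x + intvec k) = w x by rewrite /w pu pv.
pose m := (Num.truncn r^-1).+1.
have mr : r^-1 <= m%:R by rewrite ltW// truncnS_gt.
have mr2 : m%:R <= 2 / r.
  have : (m%:R : R) <= r^-1 + 1 by rewrite -natr1 lerD2r truncn_le// invr_ge0 ltW.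
  have : 1 <= r^-1 by rewrite invf_ge1// ltW.
  lra.
have m0 : (0 < m)%N by [].
have mR0 : 0 < m%:R :> R by rewrite ltr0n.
have im : (m%:R)^-1 <= r by rewrite invf_ple ?posrE.
have Ctm : Ct / m%:R <= Ct * r by rewrite ler_pM2l.
have r2 : 0 <= 2 / r by rewrite divr_ge0// ltW.
(* By the choice of exponent [eps = r * r ^ (2 eta)], and [m <= 2 / r] cancels the second factor up
   to [2 ^ (2 eta)]. *)
have epsm : eps * m%:R `^ (2 * eta) <= 2 `^ (2 * eta) * r.
  rewrite -{1}rE powRD; last by rewrite (gt_eqF r0) implybT.
  rewrite (powRr1 (ltW r0)) -mulrA mulrC; apply: ler_wpM2r; first exact: ltW.
  apply: (@le_trans _ _ (r `^ (2 * eta) * (2 / r) `^ (2 * eta))).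
    apply: ler_wpM2l; first exact: powR_ge0.
    have e2 : 0 <= 2 * eta by rewrite mulr_ge0// ltW.
    by apply: ge0_ler_powR => //; rewrite nnegrE.
  rewrite -(powRM _ (ltW r0) r2) (_ : r * (2 / r) = 2); first exact: lexx.
  by field; rewrite gt_eqF.
(* The orbit starts over [x] and approaches [y]. Every lift is determined only up to integer
   translations [k1] to [k5], which disappear because [w] is periodic. *)
have main x y : differentiable v x -> differentiable v y -> w y <= w x + beta * r.
  move=> dx dy.
  pose zx : phase := (x, c + \row_i (('d v x : 'rV[R]_n -> R) (ev i))).
  pose zy : phase := (y, c + \row_i (('d v y : 'rV[R]_n -> R) (ev i))).
  have gx : graph_dv c v zx by split.
  have gy : graph_dv c v zy by split.
  have [gamma [traj g0]] := ham_traj_exists zx pH C2 sl.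
  have gg0 : graph_dv c v (gamma 0) by rewrite g0.
  have graph s : graph_dv c v (gamma s) := inv gamma traj gg0 s.
  have [th0 /(_ gamma traj g0) orb] := orbit zx gx.
  have [th1 [k1 [ky _]]] := (surjP zy).1 gy.
  have [k2 cube] := ex_shift_cube th1.
  have [k3 [k3E _]] := perP th1 k2.
  pose th' := th1 + intvec k2.
  have [t [k [/andP[t0 tC] tk]]] := ergo m (th0 - th') m0.
  pose th := t *: omega + th0 - intvec k.
  have thE : th - th' = th0 - th' + t *: omega - intvec k.
    by apply/rowP => i; rewrite !mxE; ring.
  have [k4 [k4E _]] := perP th k.
  rewrite /th subrK in k4E.
  have [k5 [k5E _]] := orb t.
  have tht : `|th - th'| <= Ct * r by rewrite thE (le_trans tk).
  have th1r : forall i, -1 <= th 0 i <= 2.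
    move=> i; have /andP[c0 c1] := cube i.
    have := le_trans (norm_coord (th - th') i) tht.
    have -> : (th - th') 0 i = th 0 i - th' 0 i by rewrite !mxE.
    by rewrite ler_norml -/th' in c0 c1 *; lra.
  have th'r : forall i, -1 <= th' 0 i <= 2.
    by move=> i; have /andP[c0 c1] := cube i; rewrite -/th' in c0 c1; lra.
  have wg : w (gamma t).1 = w (Phi th).1 by rewrite k5E wP k4E wP.
  have wy : w y = w (Phi th').1 by rewrite k3E wP ky wP.
  have := trajectory_growth pH C2 pd sl solv eps0 solu uA traj graph t0.
  rewrite -/(w (gamma t).1) -/(w (gamma 0).1) wg g0 /= => growth.
  have := le_trans (ler_norm _) (le_trans (wL (Phi th').1 (Phi th).1)
    (ler_wpM2l (ltW L0) (CpP _ _ th'r th1r))).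
  rewrite -wy distrC => near.
  have h1 : L * (Cp * `|th - th'|) <= L * (Cp * (Ct * r)).
    by apply: ler_wpM2l; [exact: ltW|apply: ler_wpM2l => //; exact: ltW].
  have h2 : eps * A * t <= A * Ct * (2 `^ (2 * eta) * r).
    apply: (@le_trans _ _ (eps * A * (Ct * m%:R `^ (2 * eta)))).
      by apply: ler_wpM2l => //; rewrite mulr_ge0// ltW.
    have -> : eps * A * (Ct * m%:R `^ (2 * eta)) = A * Ct * (eps * m%:R `^ (2 * eta)) by ring.
    by apply: ler_wpM2l => //; rewrite mulr_ge0// ltW.
  rewrite /beta; lra.
(* Using [main] in both orders against one differentiability point [x0] bounds the oscillation of
   [w], and [w x0] is the constant to add; other points follow by density and the Lipschitz
   bound. *)
have [x0 _ dx0] := dense 0 1 ltr01.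
exists (w x0) => x; rewrite -/al -/r.
apply/ler_addgt0Pr => e e0.
have [y yx dy] := dense x (e / L) (divr_gt0 e0 L0).
have := main _ _ dx0 dy; have := main _ _ dy dx0 => h1 h2.
have h3 : `|w y - w x| <= e.
  apply: le_trans (wL _ _) _; rewrite mulrC -ler_pdivlMr//; exact: ltW.
have -> : u x - (v x + w x0) = w x - w x0 by rewrite /w; ring.
by move: h3; rewrite !ler_norml; lra.
Qed.
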